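(* Suppose that for each $\epsilon$ the initial vorticity $\omega_{0,\epsilon}=\sum_{m=1}^M\omega_{0m,\epsilon}+\omega_{0p,\epsilon}$ belongs to $L^1(\mathbb{R}^2)\cap L^\infty(\mathbb{R}^2)$, and that for each $m=1,\dots,M$ the function $\omega_{0m,\epsilon}$ does not change sign and $\operatorname{supp}(\omega_{0m,\epsilon})\subset B_\epsilon(p_m(0))$. Let $\gamma_{m,\epsilon}=\int_{\mathbb{R}^2}\omega_{0m,\epsilon}\,dx$ and suppose $|\gamma_m-\gamma_{m,\epsilon}|\le C A_\epsilon^{1/2}$ for a constant $C$ independent of $\epsilon$. Suppose also that $A_\epsilon\to0$ as $\epsilon\to0$ and that there exist $\gamma>0$ and $p_1>2$ (independent of $\epsilon$) such that $\|\omega_{0m,\epsilon}\|_{p_1}\le A_\epsilon^{-\gamma}$ for $m=1,\dots,M$. Then for every $T<T^*$ and every $a<\frac12$ there exists $\epsilon_0>0$ such that for all $0<\epsilon\le\epsilon_0$ the solution $\omega_\epsilon$ of the Euler equation with initial vorticity $\omega_{0,\epsilon}$ admits a decomposition $\omega_\epsilon=\sum_{m=1}^M\omega_{m,\epsilon}+\omega_{p,\epsilon}$ such that, for all $t\in[0,T]$ and $m=1,\dots,M$, $$\operatorname{supp}(\omega_{m,\epsilon}(\cdot,t))\subset B_{A_\epsilon^{a}}(p_m(t)),\qquad \int_{\mathbb{R}^2}\omega_{m,\epsilon}(x,t)\,dx=\gamma_{m,\epsilon},$$ and $\|\omega_{p,\epsilon}(\cdot,t)\|_r=\|\omega_{0p,\epsilon}\|_r$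 for every $r\ge1$.
   Context: $B_r(p)$ is the open ball in $\mathbb{R}^2$ with center $p$ and radius $r$; $\|\cdot\|_r$ is the $L^r(\mathbb{R}^2)$ norm; $(x_1,x_2)^\perp=(-x_2,x_1)$. Euler equation: $\partial_t\omega_\epsilon+u_\epsilon\cdot\nabla\omega_\epsilon=0$ on $\mathbb{R}^2\times[0,\infty)$, $\omega_\epsilon(\cdot,0)=\omega_{0,\epsilon}$, with $u_\epsilon(x,t)=\frac1{2\pi}\int\frac{(x-y)^\perp}{|x-y|^2}\omega_\epsilon(y,t)\,dy$. For data in $L^1\cap L^\infty$, ''the solution'' is the unique global (Yudovich) weak solution; it satisfies $\omega_\epsilon(X_\epsilon(\alpha,t),t)=\omega_{0,\epsilon}(\alpha)$, where $\frac{d}{dt}X_\epsilon(\alpha,t)=u_\epsilon(X_\epsilon(\alpha,t),t)$, $X_\epsilon(\alpha,0)=\alpha$, and each $X_\epsilon(\cdot,t)$ is measure preserving. Point vortices: $\gamma_1,\dots,\gamma_M$ are nonzero reals, $p_1^0,\dots,p_M^0\in\mathbb{R}^2$ are distinct points, and $p(t)=(p_1(t),\dots,p_M(t))$ is the solution of the Helmholtz system $\frac{dp_m}{dt}=\sum_{l\ne m}\frac{\gamma_l}{2\pi}\frac{(p_m-p_l)^\perp}{|p_m-p_l|^2}$, $p_m(0)=p_m^0$, with maximal time of existence $T^*\in(0,\infty]$; $p_m(t)\ne p_l(t)$ for all $t\in[0,T^* )$ and $m\ne l$. Fix $q>2$. The quantity $A_\epsilon$ is $$A_\epsilon=\max\Big\{\|\omega_{0p,\epsilon}\|_q^{\frac{q}{2q-2}}\|\omega_{0p,\epsilon}\|_1^{\frac{q-2}{2q-2}},\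 \epsilon\Big\}.$$ *)

(* Defs.v *)
From HB Require Import structures.
From mathcomp Require Import all_boot all_order all_algebra.
From mathcomp Require Import all_classical all_reals all_analysis.

Set Implicit Arguments.
Unset Strict Implicit.
Unset Printing Implicit Defensive.

Import Order.TTheory GRing.Theory Num.Theory.
Import numFieldNormedType.Exports.

Local Open Scope classical_set_scope.
Local Open Scope ring_scope.

Section Plane.
Context {R : realType}.

(* The norm the library puts on R * R is the maximum norm (same topology, but
   not the same balls), hence an explicit Euclidean norm. *)
Definition enorm (z : R * R) : R := Num.sqrt (z.1 ^+ 2 + z.2 ^+ 2).

Definition eball (p : R * R) (r : R) : set (R * R) :=
  [set x | enorm (x - p) < r].

(* R * R with its Borel sets, in the form for which lebesgue_measure is stated.
   Every Lebesgue measurable function has a Borel representative, and the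
   notions below do not depend on the representative. *)
Definition borel2 := (measurableTypeR R * measurableTypeR R)%type.

Definition leb2 : {measure set borel2 -> \bar R} :=
  (@lebesgue_measure R \x @lebesgue_measure R)%E.

Definition measurable2 (f : R * R -> R) : Prop :=
  measurable_fun [set: borel2] f.

Definition Lnorm2 (r : \bar R) (f : R * R -> R) : \bar R :=
  ('N[leb2]_r[EFin \o f])%E.

Definition in_L1_Loo (f : R * R -> R) : Prop :=
  [/\ measurable2 f, (Lnorm2 1 f < +oo)%E & (Lnorm2 +oo f < +oo)%E].

(* Essential support: the complement of the largest open set on which f
   vanishes almost everywhere.  It is always closed. *)
Definition esupp (f : R * R -> R) : set (R * R) :=
  [set x | ~ exists2 U : set (R * R),
       nbhs x U & leb2.-negligible (U `&` [set y | f y <> 0])].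

Definition no_sign_change (f : R * R -> R) : Prop :=
  {ae leb2, forall x, 0 <= f x} \/ {ae leb2, forall x, f x <= 0}.

Definition total_vorticity (f : R * R -> R) : R := \int[leb2]_x f x.

(* K(z) = z^perp / (2 pi |z|^2), with z^perp = (- z_2, z_1); K(0) = 0 by the
   convention 0^-1 = 0. *)
Definition biot_savart_kernel (z : R * R) : R * R :=
  (- z.2 / (2 * pi * enorm z ^+ 2), z.1 / (2 * pi * enorm z ^+ 2)).

Definition velocity (w : R * R -> R) (x : R * R) : R * R :=
  (\int[leb2]_y ((biot_savart_kernel (x - y)).1 * w y),
   \int[leb2]_y ((biot_savart_kernel (x - y)).2 * w y)).

(* c'(t) = v, the derivative being relative to the set of times I, hence
   one-sided at an endpoint of I. *)
Definition velocity_within (I : set R) (c : R -> R * R) (t : R) (v : R * R) :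
    Prop :=
  ((c s).1 - (c t).1) / (s - t) @[s --> within I t^'] --> v.1 /\
  ((c s).2 - (c t).2) / (s - t) @[s --> within I t^'] --> v.2.

Definition future : set R := [set t | 0 <= t].

Definition spacetime_measurable (w : R -> R * R -> R) : Prop :=
  measurable_fun (future `*` setT : set (measurableTypeR R * borel2))
    (fun z => w z.1 z.2).

(* C^1 functions with compact support in R x R^2; their restrictions to t >= 0
   are the test functions on [0, +oo[ x R^2, with no condition at t = 0. *)
Definition test_function (phi : R * (R * R) -> R) : Prop :=
  [/\ forall z, differentiable phi z,
      forall v, continuous (fun z => 'D_v phi z)
    & compact (closure [set z | phi z <> 0])].

Definition euler_weak_solution (w0 : R * R -> R) (w : R -> R * R -> R) : Prop :=
  [/\ spacetime_measurable w,
      exists K : R, forall t, 0 <= t ->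
        (Lnorm2 1 (w t) <= K%:E)%E /\ (Lnorm2 +oo (w t) <= K%:E)%E
    & forall phi, test_function phi ->
        \int[lebesgue_measure]_(t in future) \int[leb2]_x
          (('D_((1, (0, 0)) : R * (R * R)) phi (t, x)
            + (velocity (w t) x).1
                * 'D_((0, (1, 0)) : R * (R * R)) phi (t, x)
            + (velocity (w t) x).2
                * 'D_((0, (0, 1)) : R * (R * R)) phi (t, x)) * w t x)
        + \int[leb2]_x (phi (0, x) * w0 x) = 0].

Definition flow_map (w : R -> R * R -> R) (X : R -> R * R -> R * R) : Prop :=
  forall alpha, X 0 alpha = alpha /\
    forall t, 0 <= t ->
      velocity_within future (X ^~ alpha) t (velocity (w t) (X t alpha)).

Definition measure_preserving (Y : R * R -> R * R) : Prop :=
  measurable_fun [set: borel2] (Y : borel2 -> borel2) /\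
  forall B : set borel2, measurable B -> leb2 (Y @^-1` B) = leb2 B.

(* The global Yudovich solution with vorticity w0 in L^1 and L^oo at time 0:
   the weak solution, transported by the measure preserving flow of its own
   velocity.  By Yudovich's theorem it exists and is unique up to a null set at
   each time. *)
Definition yudovich_solution (w0 : R * R -> R) (w : R -> R * R -> R) : Prop :=
  euler_weak_solution w0 w /\
  exists X : R -> R * R -> R * R,
    [/\ flow_map w X,
        forall t, 0 <= t -> measure_preserving (X t)
      & forall t, 0 <= t -> {ae leb2, forall alpha, w t (X t alpha) = w0 alpha}].

Definition helmholtz_solution (M : nat) (gam : 'I_M -> R)
    (p0 : 'I_M -> R * R) (tau : \bar R) (p : 'I_M -> R -> R * R) : Prop :=
  (forall m, p m 0 = p0 m) /\
  forall t : R, 0 <= t -> (t%:E < tau)%E ->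
    (forall m l, m <> l -> p m t <> p l t) /\
    forall m, velocity_within [set s : R | 0 <= s /\ (s%:E < tau)%E] (p m) t
      (\sum_(l < M | l != m) gam l * (biot_savart_kernel (p m t - p l t)).1,
       \sum_(l < M | l != m) gam l * (biot_savart_kernel (p m t - p l t)).2).

Definition maximal_helmholtz_solution (M : nat) (gam : 'I_M -> R)
    (p0 : 'I_M -> R * R) (Tstar : \bar R) (p : 'I_M -> R -> R * R) : Prop :=
  [/\ (0 < Tstar)%E, helmholtz_solution gam p0 Tstar p
    & forall (tau : \bar R) (p' : 'I_M -> R -> R * R),
        helmholtz_solution gam p0 tau p' -> (tau <= Tstar)%E].

(* A_eps as a function of q, eps and the perturbation f = omega_{0p,eps}; it is
   +oo when f has infinite L^q norm, and at least eps in any case. *)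
Definition Asize (q eps : R) (f : R * R -> R) : \bar R :=
  Order.max (poweR (Lnorm2 q%:E f) (q / (2 * q - 2))
             * poweR (Lnorm2 1 f) ((q - 2) / (2 * q - 2)))%E eps%:E.

End Plane.

(* Main.v *)
(* Everything is done in Lagrangian labels. The flow X is measure preserving and
   w(t, X_t a) = w0(a), so the m-th blob is a cloud of particles whose labels are
   distributed with density |w0m| / |gamma_m|; it moves with the fields of all
   the blobs plus a perturbation of size O(A), because convolution with 1/|x| is
   bounded by C ||f||_q^(q/(2q-2)) ||f||_1^((q-2)/(2q-2)).

   Around the mean position of a blob the self-interaction drops out of the
   second moment, the kernel being odd, and in the higher moments it is dominated
   by lower ones; as long as the blobs stay separated, Gronwall gives moments
   E |x - E x|^(2k) = O(A^k). By the L^p1 bound and a moment of high order, the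
   blob's own field is too weak to push a particle out of the disc of radius
   O(A^a') with a < a' < 1/2, while the mean positions follow the point vortices
   up to O(A^(1/2)). A continuity argument removes the separation assumption.

   The pieces w0m and w0p are carried along by the flow, which is injective and
   continuous since the velocity is log-Lipschitz; its image is sigma-compact,
   which makes the transported pieces Borel in (t, x). *)
Require Import Defs.
From HB Require Import structures.
From mathcomp Require Import all_boot all_order all_algebra.
From mathcomp Require Import all_classical all_reals all_analysis.
From mathcomp Require Import measurable_realfun ess_sup_inf ring lra.

Set Implicit Arguments.
Unset Strict Implicit.
Unset Printing Implicit Defensive.

Import Order.TTheory GRing.Theory Num.Theory.
Import numFieldNormedType.Exports.

Local Open Scope classical_set_scope.
Local Open Scope ring_scope.

(** * Plane geometry and the Biot-Savart kernel *)

Section EuclideanPlane.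
Context {R : realType}.
Implicit Types z w u : R * R.

(** The obstacle is that the L^p1 norms may grow like A^(-gamma). The field of a blob on its own
    particles is then bounded only by a multiple of P(S)^theta A^(-kap), with P(S) the share of the
    blob lying in S. Mean positions and moments therefore have to be propagated without that bound.
    It enters quantitatively once, for the particles at distance at least A^a' from the mean:
    Chebyshev with the moment of order 2 n leaves A^(n (1 - 2 a')), and n is fixed by theta n (1 - 2
    a') >= 1 + kap. This requires a' < 1/2 strictly and moments of arbitrarily high order; the gap
    between a and a' absorbs all constants at the end. The square root of A also enters through the
    circulations, which are prescribed only up to A^(1/2) and drive the mean positions away from the
    vortices at that rate. Trajectories have one-sided derivatives at the ends of the time interval,
    whereas the estimates differentiate expectations at every real time; hence the continuation of
    trajectories along tangents. *)

Definition sqn (z : R * R) : R := z.1 ^+ 2 + z.2 ^+ 2.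
Definition dotp (z w : R * R) : R := z.1 * w.1 + z.2 * w.2.
Definition crossp (z w : R * R) : R := z.1 * w.2 - z.2 * w.1.

Lemma sqn_ge0 z : 0 <= sqn z.
Proof. by rewrite addr_ge0 ?sqr_ge0. Qed.

Lemma enorm_sqr z : enorm z ^+ 2 = sqn z.
Proof. by rewrite sqr_sqrtr ?sqn_ge0. Qed.

Lemma enorm_ge0 z : 0 <= enorm z.
Proof. exact: sqrtr_ge0. Qed.

Lemma dotp_le z w : `|dotp z w| <= enorm z * enorm w.
Proof.
rewrite -ler_sqr ?nnegrE ?mulr_ge0 ?enorm_ge0 ?normr_ge0//.
rewrite -normrX ger0_norm ?sqr_ge0// exprMn !enorm_sqr.
(* Lagrange's identity: |z|^2 |w|^2 - (z.w)^2 is the square of the cross product. *)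
have h : 0 <= crossp z w ^+ 2 by rewrite sqr_ge0.
rewrite -subr_ge0; apply: le_trans h _.
by rewrite le_eqVlt; apply/orP; left; apply/eqP; rewrite /crossp /dotp /sqn; ring.
Qed.

Lemma crossp_le z w : `|crossp z w| <= enorm z * enorm w.
Proof.
have := dotp_le z (w.2, - w.1); rewrite /dotp /crossp /= mulrN.
by rewrite (_ : enorm (w.2, - w.1) = enorm w)// /enorm /= sqrrN addrC.
Qed.

Lemma sqnD z w : sqn (z + w) = sqn z + dotp z w *+ 2 + sqn w.
Proof. by rewrite /sqn /dotp /=; ring. Qed.

Lemma sqnB z w : sqn (z - w) = sqn z - dotp z w *+ 2 + sqn w.
Proof. by rewrite /sqn /dotp /=; ring. Qed.

Lemma enormN z : enorm (- z) = enorm z.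
Proof. by rewrite /enorm /= !sqrrN. Qed.

Lemma enormBC z w : enorm (z - w) = enorm (w - z).
Proof. by rewrite -enormN opprB. Qed.

Lemma enormD z w : enorm (z + w) <= enorm z + enorm w.
Proof.
rewrite -ler_sqr ?nnegrE ?addr_ge0 ?enorm_ge0//.
rewrite sqrrD !enorm_sqr sqnD lerD2r lerD2l lerMn2r /=.
exact: le_trans (ler_norm _) (dotp_le z w).
Qed.

Lemma enormB z w : enorm (z - w) <= enorm z + enorm w.
Proof. by rewrite -(enormN w) enormD. Qed.

Lemma enorm_trans u z w : enorm (z - w) <= enorm (z - u) + enorm (u - w).
Proof. by rewrite (_ : z - w = (z - u) + (u - w)) ?enormD// addrA subrK. Qed.

Lemma ler_enormB z w : enorm z - enorm w <= enorm (z - w).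
Proof. by rewrite lerBlDr -[X in enorm X <= _](subrK w z) enormD. Qed.

Lemma enorm0 : enorm (0 : R * R) = 0.
Proof. by rewrite /enorm /= !expr0n /= addr0 sqrtr0. Qed.

Lemma enorm0_eq0 z : (enorm z == 0) = (z == 0).
Proof.
apply/eqP/eqP => [h|->]; last exact: enorm0.
have := enorm_sqr z; rewrite h expr0n /= => /esym/eqP.
rewrite paddr_eq0 ?sqr_ge0// !sqrf_eq0 => /andP[/eqP h1 /eqP h2].
by rewrite [z]surjective_pairing h1 h2.
Qed.

Lemma enorm_gt0 z : (0 < enorm z) = (z != 0).
Proof. by rewrite lt0r enorm_ge0 andbT enorm0_eq0. Qed.

Lemma sqn_eq0 z : (sqn z == 0) = (z == 0).
Proof. by rewrite -enorm_sqr sqrf_eq0 enorm0_eq0. Qed.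

Lemma norm1_le_enorm z : `|z.1| <= enorm z.
Proof.
by rewrite -sqrtr_sqr ler_sqrt ?addr_ge0 ?sqr_ge0// lerDl sqr_ge0.
Qed.

Lemma norm2_le_enorm z : `|z.2| <= enorm z.
Proof.
by rewrite -sqrtr_sqr ler_sqrt ?addr_ge0 ?sqr_ge0// lerDr sqr_ge0.
Qed.

Lemma enorm_le_normD z : enorm z <= `|z.1| + `|z.2|.
Proof.
rewrite -ler_sqr ?nnegrE ?addr_ge0 ?enorm_ge0//.
rewrite enorm_sqr sqrrD !real_normK ?num_real//.
by rewrite /sqn lerD2r lerDl mulrn_wge0 ?mulr_ge0.
Qed.

Local Notation K := (@biot_savart_kernel R).

Lemma biot_savart_kernelN z : K (- z) = - K z.
Proof. by rewrite /biot_savart_kernel enormN /= !mulNr. Qed.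

(** The kernel is perpendicular to its argument: for [u] parallel to [z] the numerator vanishes. All
    conservation laws of the self-interaction rest on this. *)
Lemma dotp_kernel u z :
  dotp u (K z) = (u.2 * z.1 - u.1 * z.2) / (2 * pi * sqn z).
Proof. by rewrite /dotp /biot_savart_kernel /= enorm_sqr; ring. Qed.

Lemma enorm_kernel z : enorm (K z) = (2 * pi * enorm z)^-1.
Proof.
have [->|z0] := eqVneq z 0.
  by rewrite /biot_savart_kernel enorm0 expr0n /= !mulr0 invr0 !mulr0 enorm0.
have pi0 := @pi_gt0 R.
have n0 : 0 < enorm z by rewrite enorm_gt0.
apply/eqP; rewrite -(@eqrXn2 _ 2) ?enorm_ge0 ?invr_ge0 ?mulr_ge0 ?ltW//.
apply/eqP; rewrite enorm_sqr /sqn /biot_savart_kernel /=.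
have h := enorm_sqr z; rewrite /sqn in h.
transitivity ((z.1 ^+ 2 + z.2 ^+ 2) / (2 * pi * enorm z ^+ 2) ^+ 2).
  by rewrite mulNr sqrrN !expr_div_n -mulrDl addrC.
rewrite -h; move: (enorm z) n0 (pi) pi0 => e e0 c c0; field.
by rewrite !gt_eqF.
Qed.

Lemma pi2_ge1 : 1 <= 2 * pi :> R.
Proof. by have := @pi_ge2 R; lra. Qed.

Lemma enorm_kernel_le z : enorm (K z) <= (enorm z)^-1.
Proof.
rewrite enorm_kernel invfM -[leRHS]mul1r ler_wpM2r ?invr_ge0 ?enorm_ge0//.
by rewrite invf_le1 ?pi2_ge1// (lt_le_trans ltr01 pi2_ge1).
Qed.

(* The inversion z / |z|^2 multiplies distances by 1 / (|z| |w|). *)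
Lemma enorm_kernelB z w : z != 0 -> w != 0 ->
  enorm (K z - K w) <= enorm (z - w) / (enorm z * enorm w).
Proof.
move=> z0 w0.
have nz : 0 < enorm z by rewrite enorm_gt0.
have nw : 0 < enorm w by rewrite enorm_gt0.
have pi0 := @pi_gt0 R.
suff -> : enorm (K z - K w) = enorm (z - w) / (2 * pi * (enorm z * enorm w)).
  rewrite ler_wpM2l ?enorm_ge0// lef_pV2 ?posrE ?mulr_gt0 //.
  by rewrite -[leLHS]mul1r ler_wpM2r ?mulr_ge0 ?enorm_ge0 ?pi2_ge1.
apply/eqP; rewrite -(@eqrXn2 _ 2) ?enorm_ge0 ?divr_ge0 ?mulr_ge0 ?enorm_ge0 ?ltW//.
apply/eqP; rewrite exprMn exprVn !exprMn !enorm_sqr.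
have sz : sqn z != 0 by rewrite sqn_eq0.
have sw : sqn w != 0 by rewrite sqn_eq0.
rewrite /biot_savart_kernel !enorm_sqr /=.
move: sz sw {nz nw z0 w0}; case: z w => z1 z2 [w1 w2].
move: (pi) pi0; rewrite /sqn /= => c c0 sz sw; field.
by rewrite sz sw gt_eqF.
Qed.

End EuclideanPlane.

Ltac nneg := repeat first
  [ assumption | exact: enorm_ge0 | exact: sqn_ge0 | exact: expR_ge0 | exact: powR_ge0
  | exact: ler0n | exact: ler01 | exact: sqr_ge0 | apply: exprn_ge0 | apply: mulr_ge0
  | apply: addr_ge0 | (rewrite invr_ge0) | (apply: ltW; assumption) ].

(** * Pointwise inequalities for the self-interaction of a blob *)

Section KernelAlgebra.
Context {R : realType}.
Implicit Types (z w u : R * R) (a b r : R).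

Lemma ler_dist_exp a b (n : nat) : 0 <= b -> b <= a ->
  `|a ^+ n - b ^+ n| <= n%:R * a ^+ n.-1 * (a - b).
Proof.
move=> b0 ba; have a0 := le_trans b0 ba.
rewrite ger0_norm; last by rewrite subr_ge0 lerXn2r.
rewrite subrXX mulrC ler_wpM2r ?subr_ge0//.
rewrite -mulr_natl; apply: (@le_trans _ _ (\sum_(i < n) a ^+ n.-1)); last first.
  by rewrite sumr_const card_ord -[in leLHS]mulr_natl mulr1.
apply: ler_sum => i _.
rewrite -[in leRHS](@subnK i n.-1); last by rewrite -ltnS (ltn_predK (ltn_ord i)).
rewrite exprD -subn1 -subnDA add1n.
by rewrite ler_pM ?exprn_ge0// lerXn2r.
Qed.

Lemma crossp_subl u w : crossp (u - w) w = crossp u w.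
Proof. by rewrite /crossp /=; ring. Qed.

(* Expanding |u|^2 + |w|^2 - 2 u.w = |u - w|^2 exhibits a difference of powers
   of |u|^2 and |w|^2 that compensates the singularity at u = w. *)
Lemma kernel_moment_bound u w (m : nat) :
  `|(sqn u ^+ m.+2 - sqn w ^+ m.+2) * crossp u w / sqn (u - w)
    - crossp u w * (sqn u ^+ m.+1 - sqn w ^+ m.+1)|
  <= 6 * m.+2%:R * (sqn u * sqn w ^+ m.+1 + sqn w * sqn u ^+ m.+1).
Proof.
(* Exchanging [u] and [w] flips the sign of both factors of each product on the left. *)
wlog uw : u w / enorm w <= enorm u.
  move=> H; have [uw|/ltW wu] := leP (enorm w) (enorm u); first exact: H.
  have := H w u wu.
  rewrite (_ : crossp w u = - crossp u w); last by rewrite /crossp; ring.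
  rewrite (_ : sqn (w - u) = sqn (u - w)); last by rewrite -!enorm_sqr enormBC.
  have -> : (sqn w ^+ m.+2 - sqn u ^+ m.+2) * - crossp u w =
     (sqn u ^+ m.+2 - sqn w ^+ m.+2) * crossp u w by ring.
  have -> : - crossp u w * (sqn w ^+ m.+1 - sqn u ^+ m.+1) =
     crossp u w * (sqn u ^+ m.+1 - sqn w ^+ m.+1) by ring.
  by rewrite [X in _ <= _ * X -> _]addrC.
have [->|duw] := eqVneq u w.
  rewrite (_ : crossp w w = 0) ?mulr0 ?mul0r ?subr0 ?normr0; last by rewrite /crossp; ring.
  by rewrite mulr_ge0// addr_ge0// mulr_ge0 ?exprn_ge0 ?sqn_ge0.
have D0 : 0 < enorm (u - w) by rewrite enorm_gt0 subr_eq0.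
have [D0' d0'] : enorm (u - w) != 0 /\ sqn (u - w) != 0.
  by rewrite -enorm_sqr expf_eq0 /= gt_eqF.
rewrite (_ : _ - _ = crossp u w / sqn (u - w) *
    (dotp u w *+ 2 * (sqn u ^+ m.+1 - sqn w ^+ m.+1)
     - sqn u * sqn w * (sqn u ^+ m - sqn w ^+ m))); last first.
  have h := sqnB u w.
  have -> : dotp u w *+ 2 = sqn u + sqn w - sqn (u - w) by rewrite h; ring.
  move: (sqn (u - w)) d0' => s s0 {h}.
  by rewrite !exprS; field.
have r0 := enorm_ge0 u; have w0 := enorm_ge0 w.
have D1 := @ltW _ _ _ _ D0.
have hab : sqn u - sqn w <= enorm (u - w) * (2 * enorm u).
  rewrite -!enorm_sqr subr_sqr ler_pM ?subr_ge0//.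
  - exact: addr_ge0.
  - exact: ler_enormB.
  - by rewrite mulr2n mulrDl mul1r lerD2l.
have ba : sqn w <= sqn u by rewrite -!enorm_sqr lerXn2r.
have ww : sqn w <= enorm u * enorm w.
  by rewrite -enorm_sqr expr2 ler_wpM2r.
rewrite normrM normrM normfV (ger0_norm (sqn_ge0 (u - w))) -enorm_sqr.
(* The cross product vanishes at [u = w] and gains one power of |u - w|; the other one comes from
   the differences of powers, each at most a multiple of |u - w| |u|. *)
have hc : `|crossp u w| / enorm (u - w) ^+ 2 <= enorm w / enorm (u - w).
  rewrite -crossp_subl ler_pdivrMr ?exprn_gt0//.
  rewrite expr2 [leRHS]mulrA divfK ?gt_eqF// mulrC.
  exact: crossp_le.
apply: (@le_trans _ _ (enorm w / enorm (u - w) * (2 * (enorm u * enorm w) *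
   (m.+1%:R * sqn u ^+ m * (enorm (u - w) * (2 * enorm u))) +
   sqn w * (m%:R * sqn u ^+ m * (enorm (u - w) * (2 * enorm u)))))).
  apply: ler_pM => //; first by rewrite mulr_ge0 ?invr_ge0 ?exprn_ge0.
  apply: le_trans (ler_normB _ _) _; apply: lerD.
  - rewrite normrM ler_pM//.
      by rewrite normrMn mulr_natl lerMn2r dotp_le.
    apply: (le_trans (ler_dist_exp _ (sqn_ge0 w) ba)).
    by rewrite ler_wpM2l// mulr_ge0 ?exprn_ge0 ?sqn_ge0.
  - rewrite normrM normrM !(ger0_norm (sqn_ge0 _)) [leLHS]mulrC [leLHS]mulrA [leRHS]mulrC.
    rewrite ler_wpM2r ?sqn_ge0//.
    apply: (@le_trans _ _ (m%:R * sqn u ^+ m.-1 * (sqn u - sqn w) * sqn u)).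
      by rewrite ler_wpM2r ?sqn_ge0// ler_dist_exp// sqn_ge0.
    case: m => [|m] /=; first by rewrite !mul0r.
    rewrite (_ : _ * sqn u = m.+1%:R * sqn u ^+ m.+1 * (sqn u - sqn w)); last first.
      by rewrite exprS; ring.
    by rewrite ler_wpM2l// mulr_ge0 ?exprn_ge0 ?sqn_ge0.
rewrite [leLHS](_ : _ = 2 * sqn u ^+ m * (enorm u * enorm w) *
   (2 * m.+1%:R * (enorm u * enorm w) + m%:R * sqn w)); last by field.
apply: (@le_trans _ _ (2 * sqn u ^+ m * (enorm u * enorm w) *
   (2 * m.+1%:R * (enorm u * enorm w) + m%:R * (enorm u * enorm w)))).
  rewrite ler_wpM2l//; last by rewrite lerD2l ler_wpM2l.
  by rewrite mulr_ge0 ?mulr_ge0 ?exprn_ge0 ?sqn_ge0.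
have -> : 2 * sqn u ^+ m * (enorm u * enorm w) *
   (2 * m.+1%:R * (enorm u * enorm w) + m%:R * (enorm u * enorm w)) =
   (6 * m%:R + 4) * (sqn w * sqn u ^+ m.+1).
  by rewrite exprS -!enorm_sqr -natr1; ring.
apply: ler_pM.
- by rewrite addr_ge0// mulr_ge0.
- by rewrite mulr_ge0 ?exprn_ge0 ?sqn_ge0.
- have -> : m.+2%:R = m%:R + 2 :> R by rewrite -natrD addn2.
  by lra.
- by rewrite lerDr mulr_ge0 ?exprn_ge0 ?sqn_ge0.
Qed.

(** The subtracted term is linear in [w], so it disappears when averaged over a centered [w]. For
    |w| <= |u| / 2 the rest is of second order in |w| / |u|; for larger [w] only the size of the
    kernel is used. *)
Lemma kernel_radial_bound u w : u != 0 ->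
  `|crossp u w / sqn (u - w) - crossp u w / sqn u|
  <= 10 * (sqn w / sqn u) +
     (if sqn u < 4 * sqn w then enorm u * (enorm (u - w))^-1 else 0).
Proof.
move=> u0.
have r0 : 0 < enorm u by rewrite enorm_gt0.
have a0 : 0 < sqn u by rewrite -enorm_sqr exprn_gt0.
have w0 := enorm_ge0 w; have D0 := enorm_ge0 (u - w).
case: ltP => [uw|wu].
- apply: le_trans (ler_normB _ _) _; rewrite addrC; apply: lerD.
  + rewrite normrM normfV (ger0_norm (sqn_ge0 u)) mulrA ler_wpM2r ?invr_ge0 ?sqn_ge0//.
    apply: (le_trans (crossp_le u w)).
    have : enorm u <= 2 * enorm w.
      rewrite -ler_sqr ?nnegrE ?mulr_ge0 ?enorm_ge0// exprMn !enorm_sqr.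
      by rewrite -natrX; exact: ltW.
    by rewrite -enorm_sqr; nra.
  + rewrite normrM normfV (ger0_norm (sqn_ge0 _)).
    have [->|duw] := eqVneq u w.
      by rewrite subrr -enorm_sqr enorm0 expr0n /= invr0 !mulr0.
    have D1 : 0 < enorm (u - w) by rewrite enorm_gt0 subr_eq0.
    rewrite -enorm_sqr ler_pdivrMr ?exprn_gt0// expr2 mulrA divfK ?gt_eqF//.
    (* Since [u] has no cross product with itself, one power of |u - w| cancels against the
       denominator. *)
    rewrite (_ : crossp u w = - crossp u (u - w)); last by rewrite /crossp /=; ring.
    by rewrite normrN crossp_le.
- rewrite addr0.
  have wr : 2 * enorm w <= enorm u.
    by rewrite -ler_sqr ?nnegrE ?mulr_ge0 ?enorm_ge0// exprMn !enorm_sqr -natrX.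
  have Dr : enorm u <= 2 * enorm (u - w).
    by have := ler_enormB u w; lra.
  have D1 : 0 < enorm (u - w) by lra.
  have d1 : 0 < sqn (u - w) by rewrite -enorm_sqr exprn_gt0.
  (* Over the common denominator both factors of the numerator are O(|u| |w|), and |u| <= 2 |u -
     w|. *)
  rewrite (_ : _ - _ = crossp u w * (dotp u w *+ 2 - sqn w) / (sqn (u - w) * sqn u)); last first.
    have -> : dotp u w *+ 2 = sqn u + sqn w - sqn (u - w) by rewrite sqnB; ring.
    by field; rewrite !gt_eqF.
  rewrite normrM normfV (ger0_norm (mulr_ge0 (sqn_ge0 _) (sqn_ge0 _))).
  rewrite ler_pdivrMr ?mulr_gt0// normrM.
  have -> : 10 * (sqn w / sqn u) * (sqn (u - w) * sqn u) = 10 * sqn w * sqn (u - w).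
    by field; rewrite gt_eqF.
  apply: (@le_trans _ _ ((enorm u * enorm w) * (2 * (enorm u * enorm w) + sqn w))).
    apply: ler_pM => //; first exact: crossp_le.
    apply: (le_trans (ler_normB _ _)).
    apply: lerD; last by rewrite ger0_norm ?sqn_ge0.
    by rewrite normrMn mulr_natl lerMn2r dotp_le.
  rewrite -!enorm_sqr.
  move: (enorm u) (enorm w) (enorm (u - w)) r0 w0 D0 wr Dr {D1 d1 a0} => r q D.
  move=> r0 q0 D0 qr rD.
  have h1 : r * q * (2 * (r * q) + q ^+ 2) <= q ^+ 2 * (r ^+ 2 * (5 / 2)).
    have -> : r * q * (2 * (r * q) + q ^+ 2) = q ^+ 2 * (2 * r ^+ 2 + r * q) by ring.
    by rewrite ler_wpM2l ?sqr_ge0//; nra.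
  apply: (le_trans h1).
  have -> : 10 * q ^+ 2 * D ^+ 2 = q ^+ 2 * (10 * D ^+ 2) by ring.
  rewrite ler_wpM2l ?sqr_ge0//.
  by nra.
Qed.

End KernelAlgebra.

Section PlaneMeasurability.
Context {R : realType}.

Lemma measurable_invr : measurable_fun [set: R] (fun x : R => x^-1).
Proof.
(* A formula through real powers, correct for negative [x] and also at 0, where both sides
   vanish. *)
rewrite (_ : (fun x => _) = (fun x : R => x * (x ^+ 2) `^ (- 1))).
  apply: measurable_funM => //.
  apply: (@measurableT_comp _ _ _ _ _ _ (fun x : R => x `^ (- 1))).
    exact: measurable_powR.
  exact: measurable_funX.
apply/funext => x; have [->|x0] := eqVneq x 0; first by rewrite mul0r invr0.
by rewrite powR_inv1 ?sqr_ge0// expr2 invfM mulrA divff// mul1r.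
Qed.

Context d (T : measurableType d).
Implicit Types f g : T -> R * R.

Lemma measurable_sqn f : measurable_fun setT (fun t => (f t).1) ->
  measurable_fun setT (fun t => (f t).2) ->
  measurable_fun setT (fun t => sqn (f t)).
Proof. by move=> m1 m2; apply: measurable_funD; exact: measurable_funX. Qed.

Lemma measurable_enorm f : measurable_fun setT (fun t => (f t).1) ->
  measurable_fun setT (fun t => (f t).2) ->
  measurable_fun setT (fun t => enorm (f t)).
Proof.
move=> m1 m2.
rewrite (_ : (fun t => _) = (fun t => sqn (f t) `^ (2^-1))).
  apply: (@measurableT_comp _ _ _ _ _ _ (fun x : R => x `^ (2^-1))).
    exact: measurable_powR.
  exact: measurable_sqn.
by apply/funext => t; rewrite powR12_sqrt ?sqn_ge0.
Qed.

Lemma measurable_kernel f : measurable_fun setT (fun t => (f t).1) ->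
  measurable_fun setT (fun t => (f t).2) ->
  measurable_fun setT (fun t => (biot_savart_kernel (f t)).1) /\
  measurable_fun setT (fun t => (biot_savart_kernel (f t)).2).
Proof.
move=> m1 m2.
have mi : measurable_fun setT (fun t => (2 * pi * enorm (f t) ^+ 2)^-1).
  apply: (measurableT_comp measurable_invr).
  by apply: measurable_funM => //; apply: measurable_funX; exact: measurable_enorm.
by split; apply: measurable_funM => //; exact: measurableT_comp.
Qed.

End PlaneMeasurability.

(** * Expectations *)

Section DensityMeasure.
Context d (T : measurableType d) (R : realType).
Variables (mu : {sigma_finite_measure set T -> \bar R}) (f : T -> R).
Hypothesis f0 : forall x, 0 <= f x.
Hypothesis intf : mu.-integrable setT (EFin \o f).
Hypothesis f1 : (\int[mu]_x (f x)%:E = 1)%E.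

Definition density_measure (A : set T) : \bar R := (\int[mu]_(x in A) (f x)%:E)%E.
Local Notation nu := density_measure.

Let nu0 : nu set0 = 0%E. Proof. exact: integral_set0. Qed.

Let nu_ge0 A : (0 <= nu A)%E.
Proof. by apply: integral_ge0 => x _; rewrite lee_fin. Qed.

Let nu_sigma_additive : semi_sigma_additive nu.
Proof.
move=> /= A mA tA mUA.
rewrite /nu integral_bigcup//=; last first.
  by apply: (integrableS _ _ (subsetT _)).
apply: is_cvg_ereal_nneg_natsum_cond => n _ _.
by apply: integral_ge0 => /= x ?; rewrite lee_fin.
Qed.

HB.instance Definition _ := isMeasure.Build _ _ _ nu nu0 nu_ge0 nu_sigma_additive.
HB.instance Definition _ := @Measure_isProbability.Build _ _ R nu f1.

Let nu_dominates : nu `<< mu.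
Proof.
apply/null_content_dominatesP => A mA muA0; rewrite /nu.
apply: null_set_integral => //.
by apply: measurable_funTS; exact: measurable_int intf.
Qed.

Let RN := Radon_Nikodym_SigmaFinite.f nu mu.

Let RN_ae : ae_eq mu setT RN (EFin \o f).
Proof.
apply: integral_ae_eq => //.
- exact: Radon_Nikodym_SigmaFinite.f_integrable nu_dominates.
- exact: measurable_int intf.
- by move=> E _ mE; rewrite -Radon_Nikodym_SigmaFinite.f_integral.
Qed.

(** The Radon-Nikodym derivative of [nu] agrees with [f] almost everywhere, so its change of
    variables formula becomes one for [f]. Only this formula is exported; the measure itself stays
    hidden. *)
Lemma ge0_density_prob : exists P : probability T R,
  forall g : T -> \bar R, (forall x, 0 <= g x)%E -> measurable_fun [set: T] g ->
  (\int[P]_x g x = \int[mu]_x (g x * (f x)%:E))%E.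
Proof.
exists nu => g g0 mg.
rewrite -(Radon_Nikodym_SigmaFinite.change_of_variables nu_dominates)//.
apply: ae_eq_integral => //.
- apply: emeasurable_funM => //.
  exact: measurable_int (Radon_Nikodym_SigmaFinite.f_integrable nu_dominates).
- by apply: emeasurable_funM => //; exact: measurable_int intf.
- exact: ae_eqe_mul2l.
Qed.

End DensityMeasure.

Section Expectation.
Context d (T : measurableType d) (R : realType) (P : probability T R).
Implicit Types f g : T -> R.

(** A class closed under sums, products and powers and integrable for every probability, so that
    most integrability conditions below reduce to closure properties. *)
Definition bmeas (f : T -> R) :=
  measurable_fun setT f /\ exists c, forall x, `|f x| <= c.

Lemma bmeas_integrable f : bmeas f -> P.-integrable setT (EFin \o f).
Proof.
move=> [mf [c fc]]; apply: (@le_integrable _ _ _ _ _ measurableT _ (cst c%:E)).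
- exact/measurable_EFinP.
- by move=> x _ /=; rewrite lee_fin (le_trans (fc x))// ler_norm.
- exact: finite_measure_integrable_cst.
Qed.

Lemma bmeas_cst c : bmeas (fun _ => c).
Proof. by split; [exact: measurable_cst|exists `|c|]. Qed.

Lemma bmeasD f g : bmeas f -> bmeas g -> bmeas (fun x => f x + g x).
Proof.
move=> [mf [c fc]] [mg [c' gc]]; split; first exact: measurable_funD.
by exists (c + c') => x; rewrite (le_trans (ler_normD _ _))// lerD.
Qed.

Lemma bmeasN f : bmeas f -> bmeas (fun x => - f x).
Proof.
move=> [mf [c fc]]; split; first exact: measurableT_comp.
by exists c => x; rewrite normrN.
Qed.

Lemma bmeasB f g : bmeas f -> bmeas g -> bmeas (fun x => f x - g x).
Proof. by move=> hf hg; apply: bmeasD => //; exact: bmeasN. Qed.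

Lemma bmeasM f g : bmeas f -> bmeas g -> bmeas (fun x => f x * g x).
Proof.
move=> [mf [c fc]] [mg [c' gc]]; split; first exact: measurable_funM.
by exists (c * c') => x; rewrite normrM ler_pM.
Qed.

Lemma bmeasX f n : bmeas f -> bmeas (fun x => f x ^+ n).
Proof.
move=> hf; elim: n => [|n IH]; first exact: bmeas_cst.
rewrite (_ : (fun x => _) = (fun x => f x * f x ^+ n)); first exact: bmeasM.
by apply/funext => x; rewrite exprS.
Qed.

Lemma bmeas_sum (I : Type) (r : seq I) (F : I -> T -> R) :
  (forall i, bmeas (F i)) -> bmeas (fun x => \sum_(i <- r) F i x).
Proof.
move=> h; elim: r => [|i r IH].
  rewrite (_ : (fun x => _) = (fun _ => 0)); first exact: bmeas_cst.
  by apply/funext => x; rewrite big_nil.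
rewrite (_ : (fun x => _) = (fun x => F i x + \sum_(i <- r) F i x)); first exact: bmeasD.
by apply/funext => x; rewrite big_cons.
Qed.

Lemma Rintegral_prob_cst (c : R) : \int[P]_x c = c.
Proof. by rewrite Rintegral_cst// [X in fine X]probability_setT /= mulr1. Qed.

Lemma Rintegral_norm_le f (c : R) : P.-integrable setT (EFin \o f) ->
  (forall x, `|f x| <= c) -> `|\int[P]_x f x| <= c.
Proof.
move=> fi fc; apply: (le_trans (le_normr_Rintegral measurableT fi)).
rewrite -[leRHS]Rintegral_prob_cst; apply: le_Rintegral => //.
- exact: (@integrable_norm _ _ _ P setT f).
- exact: bmeas_integrable (bmeas_cst c).
Qed.

Lemma le_norm_Rintegral f g : P.-integrable setT (EFin \o f) ->
  P.-integrable setT (EFin \o g) ->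
  (forall x, `|f x| <= g x) -> `|\int[P]_x f x| <= \int[P]_x g x.
Proof.
move=> fi gi fg; apply: (le_trans (le_normr_Rintegral measurableT fi)).
apply: le_Rintegral => //; exact: (@integrable_norm _ _ _ P setT f).
Qed.

Lemma Rintegral_bmeas_le f (c : R) : bmeas f -> (forall x, f x <= c) ->
  \int[P]_x f x <= c.
Proof.
move=> fi fc.
rewrite -[leRHS]Rintegral_prob_cst; apply: le_Rintegral => //.
- exact: bmeas_integrable.
- exact: bmeas_integrable (bmeas_cst c).
Qed.

End Expectation.

Lemma Rintegral0 d (T : measurableType d) (R : realType)
  (mu : {measure set T -> \bar R}) : \int[mu]_x (0 : R) = 0.
Proof. by rewrite /Rintegral integral0. Qed.

Section IntegrableEFin.
Context d (T : measurableType d) (R : realType) (mu : {measure set T -> \bar R}).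
Implicit Types f g : T -> R.

Lemma integrable_EFinD f g : mu.-integrable setT (EFin \o f) ->
  mu.-integrable setT (EFin \o g) -> mu.-integrable setT (EFin \o (fun x => f x + g x)).
Proof. by move=> hf hg; exact: (integrableD measurableT hf hg). Qed.

Lemma integrable_EFinB f g : mu.-integrable setT (EFin \o f) ->
  mu.-integrable setT (EFin \o g) -> mu.-integrable setT (EFin \o (fun x => f x - g x)).
Proof. by move=> hf hg; exact: (integrableB measurableT hf hg). Qed.

Lemma integrable_EFinZ (c : R) f : mu.-integrable setT (EFin \o f) ->
  mu.-integrable setT (EFin \o (fun x => c * f x)).
Proof. by move=> hf; exact: (integrableZl measurableT c hf). Qed.

Lemma Rintegral_sum (I : Type) (r : seq I) (F : I -> T -> R) :
  (forall i, mu.-integrable setT (EFin \o F i)) ->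
  \int[mu]_x (\sum_(i <- r) F i x) = \sum_(i <- r) \int[mu]_x F i x.
Proof.
move=> h.
suff : mu.-integrable setT (EFin \o (fun x => \sum_(i <- r) F i x)) /\
  \int[mu]_x (\sum_(i <- r) F i x) = \sum_(i <- r) \int[mu]_x F i x by case.
elim: r => [|i r [IH1 IH2]].
  have -> : (fun x => \sum_(i <- [::]) F i x) = (fun _ => 0).
    by apply/funext => x; rewrite big_nil.
  by rewrite big_nil Rintegral0; split => //; exact: integrable0.
have -> : (fun x => \sum_(i <- i :: r) F i x) = (fun x => F i x + \sum_(i <- r) F i x).
  by apply/funext => x; rewrite big_cons.
split; last by rewrite RintegralD// big_cons IH2.
exact: (integrableD measurableT (h i) IH1).
Qed.

End IntegrableEFin.

Lemma measurable_set_lt d (T : measurableType d) (R : realType) (f g : T -> R) :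
  measurable_fun setT f -> measurable_fun setT g -> measurable [set x | f x < g x].
Proof.
move=> mf mg; rewrite -[X in measurable X]setTI.
under eq_set => x do rewrite -lte_fin.
by apply: measurable_lte => //; exact/measurable_EFinP.
Qed.

Lemma measurable_comp_fst d (T : measurableType d) d' (T' : measurableType d')
    d2 (U : measurableType d2) (f : T -> U) : measurable_fun setT f ->
  measurable_fun setT (fun z : T * T' => f z.1).
Proof. by move=> mf; exact: measurableT_comp mf measurable_fst. Qed.

Lemma measurable_comp_snd d (T : measurableType d) d' (T' : measurableType d')
    d2 (U : measurableType d2) (f : T' -> U) : measurable_fun setT f ->
  measurable_fun setT (fun z : T * T' => f z.2).
Proof. by move=> mf; exact: measurableT_comp mf measurable_snd. Qed.

Section ProductExpectation.
Context d (T : measurableType d) d' (T' : measurableType d') (R : realType).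
Variables (P : probability T R) (Q : probability T' R).
Implicit Types H : T * T' -> R.
Local Notation PQ := (P \x Q)%E.

Lemma bmeas_fst (f : T -> R) : bmeas f -> bmeas (fun z : T * T' => f z.1).
Proof. by move=> [mf [c fc]]; split; [exact: measurableT_comp|exists c]. Qed.

Lemma bmeas_snd (f : T' -> R) : bmeas f -> bmeas (fun z : T * T' => f z.2).
Proof. by move=> [mf [c fc]]; split; [exact: measurableT_comp|exists c]. Qed.

Section bounded_sections.
Variables (H : T * T' -> R) (c : R).
Hypothesis mH : measurable_fun setT H.
Hypothesis Hc : forall x, (\int[Q]_y `|H (x, y)|%:E <= c%:E)%E.

(** The Biot-Savart kernel is unbounded and escapes [bmeas]; a bound on the L^1 norms of its
    sections, uniform in the first variable, suffices by Tonelli. *)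
Lemma integrable_prod : PQ.-integrable setT (EFin \o H).
Proof.
apply/integrable12ltyP; first exact/measurable_EFinP.
apply: (@le_lt_trans _ _ (\int[P]_x c%:E)%E).
  apply: ge0_le_integral => //.
  - by move=> x _; apply: integral_ge0.
  - apply: (@measurable_fun_fubini_tonelli_F _ _ _ _ _ Q (fun z => `|(H z)%:E|)%E) => //.
    by apply: measurableT_comp => //; exact/measurable_EFinP.
  - by move=> x _; exact: Hc.
by rewrite integral_cst// [X in (_ * X)%E]probability_setT mule1 ltry.
Qed.

Lemma integrable_section x : Q.-integrable setT (EFin \o (fun y => H (x, y))).
Proof.
apply/integrableP; split.
  apply/measurable_EFinP; exact: measurableT_comp.
exact: (le_lt_trans (Hc x) (ltry _)).
Qed.

Lemma measurable_section_Rintegral :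
  measurable_fun setT (fun x => \int[Q]_y H (x, y)).
Proof.
have := @measurable_fubini_F _ _ _ _ _ P Q _ integrable_prod.
by move=> h; apply: measurableT_comp h.
Qed.

Lemma bmeas_section_Rintegral : bmeas (fun x => \int[Q]_y H (x, y)).
Proof.
split; first exact: measurable_section_Rintegral.
exists c => x; rewrite -lee_fin.
apply: le_trans (Hc x).
rewrite EFin_normr_Rintegral//; last exact: integrable_section.
apply: le_abse_integral => //; exact: measurable_int (integrable_section x).
Qed.

Lemma Rintegral_iter :
  \int[P]_x \int[Q]_y H (x, y) = \int[PQ]_z H z.
Proof.
rewrite [in RHS]/Rintegral -(integral12_prod_meas1 integrable_prod) /Rintegral.
congr fine; apply: eq_integral => x _; rewrite fineK//.
exact: integrable_fin_num (integrable_section x).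
Qed.

End bounded_sections.

Lemma Rintegral_prodM (f : T -> R) (g : T' -> R) : bmeas f -> bmeas g ->
  \int[PQ]_z (f z.1 * g z.2) = \int[P]_x f x * \int[Q]_y g y.
Proof.
move=> hf hg; have [mfg [c fgc]] := bmeasM (bmeas_fst hf) (bmeas_snd hg).
rewrite -(@Rintegral_iter (fun z => f z.1 * g z.2) c)//=; last first.
  move=> x; apply: (@le_trans _ _ (\int[Q]_y c%:E)%E).
    apply: ge0_le_integral => //.
    - apply/measurable_EFinP/measurableT_comp => //.
      by apply: measurable_funM => //; case: hg.
    - by move=> y _; rewrite lee_fin (le_trans _ (fgc (x, y))).
  by rewrite integral_cst// [X in (_ * X)%E]probability_setT mule1.
transitivity (\int[P]_x (f x * \int[Q]_y g y)).
  apply: eq_Rintegral => x _.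
  by rewrite RintegralZl//; exact: bmeas_integrable.
by rewrite RintegralZr//; exact: bmeas_integrable.
Qed.

End ProductExpectation.

Section SwapExpectation.
Context d (T : measurableType d) (R : realType) (P : probability T R).
Local Notation PP := (P \x P)%E.

Lemma Rintegral_swap (H : T * T -> R) : PP.-integrable setT (EFin \o H) ->
  \int[PP]_z H (z.2, z.1) = \int[PP]_z H z.
Proof.
move=> iH; rewrite /Rintegral; congr fine.
have mswap : measurable_fun setT (fun z : T * T => (z.2, z.1)).
  by apply: measurable_fun_pair.
have iH' : PP.-integrable setT (EFin \o (fun z => H (z.2, z.1))).
  have mH : measurable_fun setT H by apply/measurable_EFinP; exact: measurable_int iH.
  apply/integrable12ltyP.
    by apply/measurable_EFinP; apply: (measurableT_comp mH).
  apply/(@integrable21ltyP _ _ _ _ _ P P (EFin \o H)) => //.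
  exact/measurable_EFinP.
rewrite -(integral12_prod_meas1 iH') -(integral21_prod_meas1 iH).
by apply: eq_integral.
Qed.

End SwapExpectation.

(** * Gronwall inequalities *)

Section Gronwall.
Context {R : realType}.
Implicit Types (h dh g dg : R -> R).

Lemma is_derive_continuous h dh : (forall t : R, is_derive t 1 h (dh t)) ->
  continuous h.
Proof.
move=> hd t; apply: differentiable_continuous; apply/derivable1_diffP.
by have := hd t; case.
Qed.

Lemma nonincreasing_of_derive h dh (a b : R) :
  (forall t : R, is_derive t 1 h (dh t)) -> a <= b ->
  (forall t, a < t < b -> dh t <= 0) -> h b <= h a.
Proof.
move=> hd; rewrite le_eqVlt => /orP[/eqP->//|ab] dle.
have [|c cab] := @MVT _ h dh a b ab (fun x _ => hd x).
  by apply: continuous_subspaceT; exact: is_derive_continuous hd.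
rewrite -subr_le0 => ->; rewrite pmulr_lle0 ?subr_gt0//.
by apply: dle; move: cab; rewrite in_itv.
Qed.

Lemma lipschitz_of_derive h dh (V a b : R) :
  (forall t : R, is_derive t 1 h (dh t)) -> (forall t, `|dh t| <= V) ->
  `|h b - h a| <= V * `|b - a|.
Proof.
move=> hd dle; wlog ab : a b / a <= b.
  by move=> H; have [ab|/ltW ab] := leP a b;
    [exact: H | rewrite distrC (distrC b); exact: H].
move: ab; rewrite le_eqVlt => /orP[/eqP->|ab]; first by rewrite !subrr normr0 mulr0.
have [|c cab ->] := @MVT _ h dh a b ab (fun x _ => hd x).
  by apply: continuous_subspaceT; exact: is_derive_continuous hd.
by rewrite normrM ler_wpM2r.
Qed.

Lemma is_derive_expRM (c t : R) :
  is_derive t 1 (fun t => expR (c * t)) (c * expR (c * t)).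
Proof.
have h : is_derive t 1 (fun t : R => c * t) c.
  have := @is_deriveZ R R R id c t 1 1 (is_derive_id _ _).
  by rewrite /GRing.scale /= mulr1.
rewrite mulrC.
exact: (@is_derive1_comp R expR (fun t => c * t) t _ _ (is_derive_expR _) h).
Qed.

(** Integrating factor: the sign of this derivative is that of g' - c (g + b). *)
Lemma is_deriveM_expR g (a b c t : R) : is_derive t 1 g a ->
  is_derive t 1 (fun t => (g t + b) * expR (- c * t))
    ((a - c * (g t + b)) * expR (- c * t)).
Proof.
move=> gd.
have h1 : is_derive t 1 (fun t => g t + b) (a + 0).
  exact: (@is_deriveD R R R g (cst b) t 1 a 0 gd (is_derive_cst _ _ _)).
have := @is_deriveM R R _ _ t 1 _ _ h1 (is_derive_expRM (- c) t).
by move/is_derive_eq; apply; rewrite /GRing.scale /= addr0; ring.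
Qed.

Lemma gronwall g dg (b c T : R) : (forall t : R, is_derive t 1 g (dg t)) ->
  (forall t, 0 < t < T -> dg t <= c * (g t + b)) ->
  forall t, 0 <= t <= T -> g t + b <= (g 0 + b) * expR (c * t).
Proof.
move=> gd dle t /andP[t0 tT].
have := @nonincreasing_of_derive _ _ 0 t (fun t => is_deriveM_expR b c (gd t)) t0.
rewrite mulr0 expR0 mulr1 mulNr expRN ler_pdivrMr ?expR_gt0//.
apply=> s /andP[s0 st]; rewrite pmulr_lle0 ?expR_gt0// subr_le0.
by apply: dle; rewrite s0 (lt_le_trans st tT).
Qed.

(** Used for single particles, whose drift is controlled only outside a disc: the differential
    inequality is needed just where [g] exceeds [kap]. After the last time at which g exp(-c t) is
    at most [kap], this product cannot increase. *)
Lemma gronwall_threshold g dg (kap c T : R) : 0 <= c -> 0 <= kap ->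
  (forall t : R, is_derive t 1 g (dg t)) ->
  (forall t, 0 < t < T -> kap < g t -> dg t <= c * g t) -> g 0 <= kap ->
  forall t, 0 <= t <= T -> g t <= kap * expR (c * t).
Proof.
move=> c0 kap0 gd dle g0 t /andP[t0 tT].
pose h s := (g s + 0) * expR (- c * s).
have hd s := is_deriveM_expR 0 c (gd s).
suff : h t <= kap.
  by rewrite /h addr0 mulNr expRN ler_pdivrMr ?expR_gt0.
rewrite leNgt; apply/negP => kt.
(* Its supremum is the last time before [t] at which [h] is below the threshold. *)
pose S := [set s | 0 <= s <= t /\ h s <= kap].
have S0 : S 0 by split; rewrite ?lexx//= /h addr0 mulr0 expR0 mulr1.
have supS : has_sup S.
  by split; [exists 0|exists t => s [/andP[]]].
pose s := sup S.
have s0 : 0 <= s by apply: sup_upper_bound.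
have st : s <= t by apply: ge_sup; [exists 0|move=> u [/andP[]]].
have hc := is_derive_continuous hd.
have hs : h s <= kap.
  rewrite leNgt; apply/negP => ks.
  have /(hc s) [e /= e0 he] : nbhs (h s) [set x | kap < x] by exact: lt_nbhsr.
  have [u Su us] := sup_adherent e0 supS.
  have us' : u <= s by exact: sup_upper_bound.
  have /= := he u; rewrite -/(h u) => H.
  have : kap < h u by apply: H; rewrite /= ger0_norm ?subr_ge0// ltrBlDl -ltrBlDr.
  by rewrite ltNge; case: Su => _ ->.
suff : h t <= h s by move=> /(lt_le_trans kt); rewrite ltNge hs.
apply: (nonincreasing_of_derive hd st) => u /andP[su ut].
have ku : kap < h u.
  rewrite ltNge; apply/negP => hu.
  have : u <= s by apply: sup_upper_bound => //; split; rewrite // (ltW ut) (ltW (le_lt_trans s0 su)).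
  by rewrite leNgt su.
have u0 : 0 < u by exact: le_lt_trans su.
rewrite pmulr_lle0 ?expR_gt0// subr_le0 addr0.
apply: dle; first by rewrite u0 (lt_le_trans ut tT).
(* The exponential factor is at most 1 and [g u] is positive, so [h u] is at most [g u]. *)
apply: (lt_le_trans ku); rewrite /h addr0.
have gu : 0 < g u.
  by have := le_lt_trans kap0 ku; rewrite /h addr0 pmulr_lgt0 ?expR_gt0.
rewrite -[leRHS]mulr1 ler_pM2l// mulNr expRN invf_le1 ?expR_gt0//.
by rewrite -expR0 ler_expR mulr_ge0// ltW.
Qed.

End Gronwall.

(** * Dynamics of one blob *)

(* A blob is a cloud of fluid particles [x a], [a] ranging over a probability
   space that carries the (normalized) vorticity of the blob. *)
Section Blob.
Context d (T : measurableType d) (R : realType) (P : probability T R).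
Variable x : T -> R * R.
Local Notation K := biot_savart_kernel.
Local Notation PP := (P \x P)%E.

Definition bmeas2 (f : T -> R * R) :=
  bmeas (fun a => (f a).1) /\ bmeas (fun a => (f a).2).

Definition expectation2 (f : T -> R * R) : R * R :=
  (\int[P]_a (f a).1, \int[P]_a (f a).2).

Definition centered (a : T) : R * R := x a - expectation2 x.

Definition self_velocity (a : T) : R * R :=
  expectation2 (fun b => K (x a - x b)).

Hypothesis bx : bmeas2 x.
Variable c : R.
Hypothesis xc : forall a, (\int[P]_b (enorm (x a - x b))^-1%:E <= c%:E)%E.

Local Notation xi := centered.
Local Notation S := self_velocity.

Lemma bmeas_centered : bmeas2 xi.
Proof. by case: bx => h1 h2; split; apply: bmeasB => //; exact: bmeas_cst. Qed.

Lemma bmeas_sqn_centered : bmeas (fun a => sqn (xi a)).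
Proof. by case: bmeas_centered => h1 h2; apply: bmeasD; exact: bmeasX. Qed.

Lemma bmeas_enorm (f : T -> R * R) : bmeas2 f -> bmeas (fun a => enorm (f a)).
Proof.
move=> [[m1 [c1 h1]] [m2 [c2 h2]]]; split; first exact: measurable_enorm.
exists (c1 + c2) => a; rewrite ger0_norm ?enorm_ge0//.
by rewrite (le_trans (enorm_le_normD _))// lerD.
Qed.

Lemma expectation_centered :
  \int[P]_a (xi a).1 = 0 /\ \int[P]_a (xi a).2 = 0.
Proof.
case: bx => h1 h2; split; rewrite /centered /= RintegralB//= ?Rintegral_prob_cst ?subrr//;
  by [exact: bmeas_integrable|apply: bmeas_integrable; exact: bmeas_cst].
Qed.

Lemma centeredB a b : xi a - xi b = x a - x b.
Proof. by rewrite /centered opprB addrA subrK. Qed.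

Let mdiff : measurable_fun setT (fun z : T * T => (x z.1 - x z.2).1) /\
  measurable_fun setT (fun z : T * T => (x z.1 - x z.2).2).
Proof.
have [[m1 _] [m2 _]] := bx.
split; apply: measurable_funB.
- exact: measurable_comp_fst m1.
- exact: measurable_comp_snd m1.
- exact: measurable_comp_fst m2.
- exact: measurable_comp_snd m2.
Qed.

Section kernel_pairing.
Variable psi : T -> R * R.
Hypothesis bpsi : bmeas2 psi.

Let H (z : T * T) := dotp (psi z.1) (K (x z.1 - x z.2)).

Let mH : measurable_fun setT H.
Proof.
have [[p1 _] [p2 _]] := bpsi.
have [k1 k2] := measurable_kernel mdiff.1 mdiff.2.
apply: measurable_funD; apply: measurable_funM => //.
- exact: measurable_comp_fst p1.
- exact: measurable_comp_fst p2.
Qed.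

Lemma kernel_pairing_bound : exists c', forall a, (\int[P]_b `|H (a, b)|%:E <= c'%:E)%E.
Proof.
have [_ [M hM]] := bmeas_enorm bpsi.
exists (M * c) => a.
have M0 : 0 <= M by rewrite (le_trans (normr_ge0 _) (hM a)).
have mi : measurable_fun setT (fun b => (enorm (x a - x b))^-1).
  apply: (measurableT_comp measurable_invr); have [[m1 _] [m2 _]] := bx.
  by apply: measurable_enorm; exact: measurable_funB.
apply: (@le_trans _ _ (\int[P]_b (M%:E * (enorm (x a - x b))^-1%:E))%E).
  apply: ge0_le_integral => //.
  - apply/measurable_EFinP; apply: measurableT_comp => //.
    exact: (measurableT_comp mH).
  - by apply: emeasurable_funM => //; apply/measurable_EFinP.
  - move=> b _; rewrite -EFinM lee_fin; apply: (le_trans (dotp_le _ _)).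
    apply: ler_pM; rewrite ?enorm_ge0 ?enorm_kernel_le//=.
    by rewrite (le_trans (ler_norm _) (hM a)).
rewrite ge0_integralZl//; last 2 first.
  - exact/measurable_EFinP.
  - by move=> b _; rewrite lee_fin invr_ge0 enorm_ge0.
by rewrite EFinM lee_wpmul2l// lee_fin.
Qed.

Lemma integrable_kernel_pairing : PP.-integrable setT (EFin \o H).
Proof. by have [c' h] := kernel_pairing_bound; exact: (@integrable_prod _ _ _ _ _ P P _ c' mH h). Qed.

End kernel_pairing.

Lemma integrable_kernel a :
  P.-integrable setT (EFin \o (fun b => (K (x a - x b)).1)) /\
  P.-integrable setT (EFin \o (fun b => (K (x a - x b)).2)).
Proof.
have [[k1 k2] [m1 m2]] := (measurable_kernel mdiff.1 mdiff.2, mdiff).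
have h1 : bmeas2 (fun _ : T => (1, 0) : R * R) by split; exact: bmeas_cst.
have h2 : bmeas2 (fun _ : T => (0, 1) : R * R) by split; exact: bmeas_cst.
have [c1 l1] := kernel_pairing_bound h1; have [c2 l2] := kernel_pairing_bound h2.
split.
- have E b : (K (x a - x b)).1 = dotp (1, 0) (K (x a - x b)).
    by rewrite /dotp mul1r mul0r addr0.
  under eq_fun do rewrite E.
  apply: (@integrable_section _ _ _ _ _ P (fun z => dotp (1, 0) (K (x z.1 - x z.2))) c1 _ l1 a).
  by apply/measurable_EFinP; exact: measurable_int (integrable_kernel_pairing h1).
- have E b : (K (x a - x b)).2 = dotp (0, 1) (K (x a - x b)).
    by rewrite /dotp mul1r mul0r add0r.
  under eq_fun do rewrite E.
  apply: (@integrable_section _ _ _ _ _ P (fun z => dotp (0, 1) (K (x z.1 - x z.2))) c2 _ l2 a).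
  by apply/measurable_EFinP; exact: measurable_int (integrable_kernel_pairing h2).
Qed.

Lemma dotp_self_velocity (u : R * R) a :
  dotp u (S a) = \int[P]_b dotp u (K (x a - x b)).
Proof.
have [i1 i2] := integrable_kernel a.
rewrite /dotp /= RintegralD//; last 2 first.
  exact: (integrableZl measurableT u.1 i1).
  exact: (integrableZl measurableT u.2 i2).
by rewrite !RintegralZl.
Qed.

Lemma self_velocity_pairing (psi : T -> R * R) : bmeas2 psi ->
  bmeas (fun a => dotp (psi a) (S a)) /\
  \int[P]_a dotp (psi a) (S a) = \int[PP]_z dotp (psi z.1) (K (x z.1 - x z.2)).
Proof.
move=> bpsi; have [c' h] := kernel_pairing_bound bpsi.
have mH : measurable_fun setT (fun z : T * T => dotp (psi z.1) (K (x z.1 - x z.2))).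
  by apply/measurable_EFinP; exact: measurable_int (integrable_kernel_pairing bpsi).
rewrite -(@Rintegral_iter _ _ _ _ _ P P _ c' mH h).
have -> : (fun a => dotp (psi a) (S a)) =
    (fun a => \int[P]_b dotp (psi a) (K (x a - x b))).
  by apply/funext => a; rewrite dotp_self_velocity.
by split => //; exact: (@bmeas_section_Rintegral _ _ _ _ _ P P _ c' mH h).
Qed.

Lemma bmeas_self_velocity : bmeas2 S.
Proof.
have h1 : bmeas2 (fun _ : T => (1, 0) : R * R) by split; exact: bmeas_cst.
have h2 : bmeas2 (fun _ : T => (0, 1) : R * R) by split; exact: bmeas_cst.
have [l1 _] := self_velocity_pairing h1; have [l2 _] := self_velocity_pairing h2.
split.
- by move: l1; rewrite /dotp /=; under eq_fun do rewrite mul1r mul0r addr0.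
- by move: l2; rewrite /dotp /=; under eq_fun do rewrite mul1r mul0r add0r.
Qed.

(* Symmetrization in the two variables, using that the kernel is odd. *)
Lemma self_velocity_symmetrized (psi : T -> R * R) : bmeas2 psi ->
  PP.-integrable setT (EFin \o (fun z => dotp (psi z.1 - psi z.2) (K (x z.1 - x z.2)))) /\
  2 * \int[P]_a dotp (psi a) (S a) =
  \int[PP]_z dotp (psi z.1 - psi z.2) (K (x z.1 - x z.2)).
Proof.
move=> bpsi; have iH := integrable_kernel_pairing bpsi.
have [_ ->] := self_velocity_pairing bpsi.
have iH' : PP.-integrable setT (EFin \o (fun z => dotp (psi z.2) (K (x z.2 - x z.1)))).
  have mH : measurable_fun setT (fun z : T * T => dotp (psi z.1) (K (x z.1 - x z.2))).
    by apply/measurable_EFinP; exact: measurable_int iH.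
  have mswap : measurable_fun setT (fun z : T * T => (z.2, z.1)) by exact: measurable_fun_pair.
  apply/integrable12ltyP.
    by apply/measurable_EFinP; apply: (measurableT_comp mH mswap).
  apply/(@integrable21ltyP _ _ _ _ _ P P (EFin \o (fun z => dotp (psi z.1) (K (x z.1 - x z.2))))) => //.
  exact/measurable_EFinP.
have E z : dotp (psi z.1 - psi z.2) (K (x z.1 - x z.2)) =
    dotp (psi z.1) (K (x z.1 - x z.2)) + dotp (psi z.2) (K (x z.2 - x z.1)).
  by rewrite -(opprB (x z.1)) biot_savart_kernelN /dotp /=; ring.
split.
  by under eq_fun do rewrite E; exact: (integrableD measurableT iH iH').
under [RHS]eq_Rintegral do rewrite E.
rewrite RintegralD//.
rewrite (@Rintegral_swap _ _ _ P (fun z => dotp (psi z.1) (K (x z.1 - x z.2))) iH).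
by rewrite mulr2n mulrDl mul1r.
Qed.

(** Against a constant vector the symmetrized integrand is zero: the internal forces do not move the
    mean position. *)
Lemma expectation_self_velocity : expectation2 S = 0.
Proof.
suff h (u : R * R) : \int[P]_a dotp u (S a) = 0.
  have := h (1, 0); have := h (0, 1); rewrite /dotp /= /expectation2.
  under eq_Rintegral do rewrite mul1r mul0r add0r.
  by move=> ->; under eq_Rintegral do rewrite mul1r mul0r addr0; move=> ->.
have bu : bmeas2 (fun _ : T => u) by split; exact: bmeas_cst.
have [_] := self_velocity_symmetrized bu.
rewrite (_ : (fun z : T * T => _) = (fun _ => 0)); last first.
  by apply/funext => z; rewrite subrr /dotp /= !mul0r addr0.
by rewrite Rintegral0 => /eqP; rewrite mulf_eq0 pnatr_eq0 /= => /eqP.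
Qed.

(** The symmetrized integrand pairs x_a - x_b with a kernel perpendicular to it: the
    self-interaction preserves the moment of inertia. *)
Lemma energy_self_velocity : \int[P]_a dotp (xi a) (S a) = 0.
Proof.
have [_] := self_velocity_symmetrized bmeas_centered.
rewrite (_ : (fun z : T * T => _) = (fun _ => 0)); last first.
  by apply/funext => z; rewrite centeredB dotp_kernel (mulrC (_.2)) subrr mul0r.
by rewrite Rintegral0 => /eqP; rewrite mulf_eq0 pnatr_eq0 /= => /eqP.
Qed.

(** Every term of the expansion is a product of one function of each variable, one of them a
    coordinate of [xi], whose mean is zero. This supplies the null term that [kernel_moment_bound]
    subtracts. *)
Lemma crossp_moment_eq0 (phi : T -> R) : bmeas phi ->
  let ct (z : T * T) := crossp (xi z.1) (xi z.2) * (phi z.1 - phi z.2) in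
  bmeas ct /\ \int[PP]_z ct z = 0.
Proof.
move=> bphi ct.
have [[b1 b2] [e1 e2]] := (bmeas_centered, expectation_centered).
pose f1 a := (xi a).1 * phi a; pose f2 a := (xi a).2 * phi a.
have [bf1 bf2] : bmeas f1 /\ bmeas f2 by split; exact: bmeasM.
have ctE : ct = (fun z => (f1 z.1 * (xi z.2).2 - f2 z.1 * (xi z.2).1) -
   ((xi z.1).1 * f2 z.2 - (xi z.1).2 * f1 z.2)).
  by apply/funext => z; rewrite /ct /crossp /f1 /f2; ring.
have bt (f g : T -> R) : bmeas f -> bmeas g -> bmeas (fun z : T * T => f z.1 * g z.2).
  by move=> bf bg; apply: bmeasM; [exact: bmeas_fst|exact: bmeas_snd].
have h1 := bt _ _ bf1 b2; have h2 := bt _ _ bf2 b1.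
have h3 := bt _ _ b1 bf2; have h4 := bt _ _ b2 bf1.
have i1 := bmeas_integrable PP h1; have i2 := bmeas_integrable PP h2.
have i3 := bmeas_integrable PP h3; have i4 := bmeas_integrable PP h4.
split; first by rewrite ctE; apply: bmeasB; exact: bmeasB.
rewrite ctE RintegralB//; last 2 first.
  exact: (integrableB measurableT i1 i2).
  exact: (integrableB measurableT i3 i4).
rewrite !RintegralB// (Rintegral_prodM P P bf1 b2) (Rintegral_prodM P P bf2 b1).
rewrite (Rintegral_prodM P P b1 bf2) (Rintegral_prodM P P b2 bf1).
by rewrite e1 e2 !mulr0 !mul0r !subrr.
Qed.

(** Symmetrize against |xi|^(2 (m + 2)) xi, subtract the null integral of [ct], and bound pointwise
    with [kernel_moment_bound]. The bound is a sum of products over the two variables, so it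
    integrates to a product of lower moments without any singular integral. *)
Lemma moment_self_velocity (m : nat) :
  `|\int[P]_a (sqn (xi a) ^+ m.+2 * dotp (xi a) (S a))|
  <= 6 * m.+2%:R * (\int[P]_a sqn (xi a) * \int[P]_a (sqn (xi a) ^+ m.+1)).
Proof.
have [b1 b2] := bmeas_centered; have bs := bmeas_sqn_centered.
pose psi a : R * R := (sqn (xi a) ^+ m.+2 * (xi a).1, sqn (xi a) ^+ m.+2 * (xi a).2).
have bpsi : bmeas2 psi by split; apply: bmeasM => //; exact: bmeasX.
have -> : \int[P]_a (sqn (xi a) ^+ m.+2 * dotp (xi a) (S a)) = \int[P]_a dotp (psi a) (S a).
  by apply: eq_Rintegral => a _; rewrite /dotp /psi /=; ring.
have [iG sym] := self_velocity_symmetrized bpsi.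
have [bct ct0] := crossp_moment_eq0 (bmeasX m.+1 bs).
have pi1 := @pi2_ge1 R; have pi0 : 0 < 2 * pi :> R by apply: lt_le_trans pi1.
set G := (fun z => _) in iG sym.
set ct := (fun z : T * T => _) in bct ct0.
have ict := bmeas_integrable PP bct.
have ict' : PP.-integrable setT (EFin \o (fun z => (2 * pi)^-1 * ct z)).
  exact: (integrableZl measurableT _ ict).
pose B z := 6 * m.+2%:R * (sqn (xi z.1) * sqn (xi z.2) ^+ m.+1) +
            6 * m.+2%:R * (sqn (xi z.1) ^+ m.+1 * sqn (xi z.2)).
have bb : bmeas (fun z : T * T => sqn (xi z.1) * sqn (xi z.2) ^+ m.+1).
  by apply: bmeasM; [exact: (bmeas_fst _ bs)|exact: (bmeas_snd _ (bmeasX m.+1 bs))].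
have bb' : bmeas (fun z : T * T => sqn (xi z.1) ^+ m.+1 * sqn (xi z.2)).
  by apply: bmeasM; [exact: (bmeas_fst _ (bmeasX m.+1 bs))|exact: (bmeas_snd _ bs)].
have iB : PP.-integrable setT (EFin \o B).
  by apply: bmeas_integrable; apply: bmeasD; apply: bmeasM => //; exact: bmeas_cst.
have hB : \int[PP]_z B z = 2 * (6 * m.+2%:R * (\int[P]_a sqn (xi a) * \int[P]_a (sqn (xi a) ^+ m.+1))).
  rewrite /B RintegralD//; do ?[by apply: bmeas_integrable; apply: bmeasM => //; exact: bmeas_cst].
  rewrite !RintegralZl//; do ?[exact: bmeas_integrable].
  rewrite (@Rintegral_prodM _ _ _ _ _ P P (fun a => sqn (xi a)) (fun a => sqn (xi a) ^+ m.+1))//; last exact: bmeasX.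
  rewrite (@Rintegral_prodM _ _ _ _ _ P P (fun a => sqn (xi a) ^+ m.+1) (fun a => sqn (xi a)))//; last exact: bmeasX.
  by ring.
rewrite -(@ler_pM2l _ 2)// -hB -[X in X * _]ger0_norm// -normrM sym.
have -> : \int[PP]_z G z = \int[PP]_z (G z - (2 * pi)^-1 * ct z).
  by rewrite RintegralB// RintegralZl// ct0 mulr0 subr0.
apply: le_norm_Rintegral => //.
  exact: (integrableB measurableT iG ict').
move=> z; rewrite /G -centeredB dotp_kernel.
(* The cross product of s_1 xi_1 - s_2 xi_2 with xi_1 - xi_2 is, up to sign, (s_1 - s_2) times that
   of xi_1 with xi_2. *)
rewrite (_ : _ - _ = (2 * pi)^-1 *
   ((sqn (xi z.1) ^+ m.+2 - sqn (xi z.2) ^+ m.+2) * crossp (xi z.1) (xi z.2) / sqn (xi z.1 - xi z.2)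
    - crossp (xi z.1) (xi z.2) * (sqn (xi z.1) ^+ m.+1 - sqn (xi z.2) ^+ m.+1))); last first.
  rewrite /ct /psi /= invfM /crossp /=; ring.
rewrite normrM ger0_norm; last by rewrite invr_ge0 ltW.
rewrite -[leRHS]mul1r.
apply: ler_pM => //; [by rewrite invr_ge0 ltW | by rewrite invf_le1 |].
apply: le_trans (kernel_moment_bound _ _ _) _.
by rewrite mulrDr lerD2l [X in _ * X]mulrC.
Qed.

(** The part of the kernel linear in [xi b] has mean zero. What is left is the second moment over
    |xi a|^2, together with the particles at more than half the radius of [a], whose singular
    integral is [J]. *)
Lemma radial_self_velocity (a : T) (J : R) :
  (\int[P]_(b in [set b | (sqn (xi a) < 4 * sqn (xi b))%R]) (enorm (x a - x b))^-1%:E <= J%:E)%E ->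
  `|dotp (xi a) (S a)| <=
    10 * (\int[P]_b sqn (xi b) / sqn (xi a)) + enorm (xi a) * J.
Proof.
move=> hJ.
have [b1 b2] := bmeas_centered; have bs := bmeas_sqn_centered.
have [e1 e2] := expectation_centered.
have J0 : 0 <= J.
  rewrite -lee_fin; apply: le_trans hJ; apply: integral_ge0 => b _.
  by rewrite lee_fin invr_ge0 enorm_ge0.
have [a0|a0] := eqVneq (xi a) 0.
  rewrite a0 /dotp /= !mul0r addr0 normr0 addr_ge0// ?mulr_ge0 ?enorm_ge0//.
    exact: Rintegral_ge0 (fun b _ => sqn_ge0 _).
  by rewrite invr_ge0 sqn_ge0.
pose E := [set b | sqn (xi a) < 4 * sqn (xi b)].
have mE : measurable E.
  apply: measurable_set_lt => //.
  by apply: measurable_funM => //; case: bs.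
have mi : measurable_fun setT (fun b => (enorm (x a - x b))^-1).
  apply: (measurableT_comp measurable_invr); have [[m1 _] [m2 _]] := bx.
  by apply: measurable_enorm; exact: measurable_funB.
pose h b := if sqn (xi a) < 4 * sqn (xi b) then (enorm (x a - x b))^-1 else 0.
have hE : h = ((fun b => (enorm (x a - x b))^-1) \_ E).
  apply/funext => b; rewrite /h /patch; case: ifPn => hb.
    by rewrite mem_set.
  by rewrite memNset//= => hb'; rewrite hb' in hb.
have iA : P.-integrable setT (EFin \o (fun b => (enorm (x a - x b))^-1)).
  apply/integrableP; split; first exact/measurable_EFinP.
  apply: le_lt_trans (ltry c); apply: le_trans (xc a).
  apply: ge0_le_integral => //.
  - by apply: measurableT_comp => //; apply/measurable_EFinP.
  - exact/measurable_EFinP.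
  - by move=> b _ /=; rewrite lee_fin ger0_norm// invr_ge0 enorm_ge0.
have ih : P.-integrable setT (EFin \o h).
  rewrite hE -restrict_EFin.
  have := integrableS measurableT mE (@subsetT _ _) iA.
  by rewrite integrable_mkcond.
have hhJ : \int[P]_b h b <= J.
  rewrite hE -Rintegral_mkcond -lee_fin /Rintegral fineK//.
  by apply: integrable_fin_num => //; exact: (integrableS measurableT).
rewrite dotp_self_velocity.
have [i1 i2] := integrable_kernel a.
have pi1 := @pi2_ge1 R; have pi0 : 0 < 2 * pi :> R by apply: lt_le_trans pi1.
have iD : P.-integrable setT (EFin \o (fun b => dotp (xi a) (K (x a - x b)))).
  exact: integrable_EFinD (integrable_EFinZ (xi a).1 i1) (integrable_EFinZ (xi a).2 i2).
(* The linear part: with [a] fixed it has zero expectation, because [xi] is centered. *)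
pose ct b := (2 * pi * sqn (xi a))^-1 * crossp (xi a) (xi b).
have bct : bmeas ct.
  apply: bmeasM; first exact: bmeas_cst.
  by apply: bmeasB; apply: bmeasM => //; exact: bmeas_cst.
have ct0 : \int[P]_b ct b = 0.
  rewrite RintegralZl//; last first.
    by apply: bmeas_integrable; apply: bmeasB; apply: bmeasM => //; exact: bmeas_cst.
  rewrite /crossp RintegralB//; do ?[by apply: bmeas_integrable; apply: bmeasM => //; exact: bmeas_cst].
  rewrite !RintegralZl//; do ?[exact: bmeas_integrable].
  by rewrite e1 e2 !mulr0 subrr mulr0.
have -> : \int[P]_b dotp (xi a) (K (x a - x b)) = \int[P]_b (dotp (xi a) (K (x a - x b)) - ct b).
  by rewrite RintegralB ?ct0 ?subr0//; exact: bmeas_integrable.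
have iB : P.-integrable setT (EFin \o (fun b => 10 * (sqn (xi b) / sqn (xi a)) + enorm (xi a) * h b)).
  apply: integrable_EFinD; last exact: integrable_EFinZ.
  apply: bmeas_integrable; apply: bmeasM; first exact: bmeas_cst.
  by apply: bmeasM => //; exact: bmeas_cst.
apply: (@le_trans _ _ (\int[P]_b (10 * (sqn (xi b) / sqn (xi a)) + enorm (xi a) * h b))).
  apply: le_norm_Rintegral => //.
    by apply: integrable_EFinB => //; exact: bmeas_integrable.
  move=> b; rewrite -centeredB dotp_kernel /ct.
  rewrite (_ : _ - _ = (2 * pi)^-1 * (crossp (xi a) (xi b) / sqn (xi a - xi b) - crossp (xi a) (xi b) / sqn (xi a))); last first.
    by rewrite !invfM /crossp /=; ring.
  rewrite normrM ger0_norm; last by rewrite invr_ge0 ltW.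
rewrite -[leRHS]mul1r.
  apply: ler_pM => //; [by rewrite invr_ge0 ltW | by rewrite invf_le1 |].
  apply: le_trans (kernel_radial_bound _ a0) _.
  by rewrite lerD2l /h centeredB; case: ifP => //; rewrite mulr0.
rewrite RintegralD//; last 2 first.
  - apply: bmeas_integrable; apply: bmeasM; first exact: bmeas_cst.
    by apply: bmeasM => //; exact: bmeas_cst.
  - exact: (integrableZl measurableT _ ih).
rewrite !RintegralZl//; last first.
  by apply: bmeas_integrable; apply: bmeasM => //; exact: bmeas_cst.
rewrite RintegralZr//; last exact: bmeas_integrable.
by rewrite lerD2l ler_wpM2l// enorm_ge0.
Qed.

(** Markov's inequality for the [n]-th power of 4 |xi b|^2 / |xi a|^2; the event is the near zone of
    [kernel_radial_bound]. *)
Lemma chebyshev_moment (a : T) (n : nat) : xi a != 0 ->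
  fine (P [set b | sqn (xi a) < 4 * sqn (xi b)]) <=
  4 ^+ n * \int[P]_b (sqn (xi b) ^+ n) / sqn (xi a) ^+ n.
Proof.
move=> a0; have bs := bmeas_sqn_centered.
have s0 : 0 < sqn (xi a) by rewrite lt0r sqn_ge0 sqn_eq0 a0.
set E := [set b | _].
have mE : measurable E.
  apply: measurable_set_lt => //.
  by apply: measurable_funM => //; case: bs.
rewrite ler_pdivlMr ?exprn_gt0// -RintegralZl//; last first.
  by apply: bmeas_integrable; exact: bmeasX.
have -> : fine (P E) * sqn (xi a) ^+ n = \int[P]_b (\1_E b * sqn (xi a) ^+ n).
  rewrite RintegralZr//; last first.
    by apply: bmeas_integrable; split; [exact: measurable_indic|exists 1 => b; rewrite indicE; case: (_ \in _); rewrite ?normr0 ?normr1].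
  by congr (_ * _); rewrite /Rintegral integral_indic// setIT.
apply: le_Rintegral => //.
- apply: bmeas_integrable; apply: bmeasM; last exact: bmeas_cst.
  by split; [exact: measurable_indic|exists 1 => b; rewrite indicE; case: (_ \in _); rewrite ?normr0 ?normr1].
- by apply: bmeas_integrable; apply: bmeasM; [exact: bmeas_cst|exact: bmeasX].
- move=> b _; rewrite indicE; have [|] := boolP (b \in E).
    rewrite inE /E /= => hb; rewrite mul1r -exprMn lerXn2r ?nnegrE ?mulr_ge0 ?sqn_ge0//.
    exact: ltW.
  by rewrite mul0r mulr_ge0 ?exprn_ge0 ?sqn_ge0.
Qed.

End Blob.

(** * A blob in a Lipschitz external field [F] with a small error [e] *)

Section DrivenBlob.
Context d (T : measurableType d) (R : realType) (P : probability T R).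
Variables (x : T -> R * R) (c0 : R).
Hypothesis bx : bmeas2 x.
Hypothesis xc : forall a, (\int[P]_b (enorm (x a - x b))^-1%:E <= c0%:E)%E.
Variables (v F e : T -> R * R) (Gam L eta : R).
Hypotheses (bF : bmeas2 F) (be : bmeas2 e) (L0 : 0 <= L).
Hypothesis vE : forall a, v a =
  (Gam * (self_velocity P x a).1 + (F a).1 + (e a).1,
   Gam * (self_velocity P x a).2 + (F a).2 + (e a).2).
Hypothesis FL : forall a b, enorm (F a - F b) <= L * enorm (x a - x b).
Hypothesis e_eta : forall a, enorm (e a) <= eta.

Local Notation xi := (centered P x).
Local Notation S := (self_velocity P x).
Local Notation rho := (fun a => enorm (xi a)).
Local Notation Er := (\int[P]_a enorm (xi a)).

Let bxi := bmeas_centered P bx.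
Let brho : bmeas rho := bmeas_enorm bxi.

(** The space has total mass 1, hence a point at which [e_eta] applies. *)
Let eta0 : 0 <= eta.
Proof.
have [|hn] := pselect (exists a : T, True).
  by move=> [a _]; exact: le_trans (enorm_ge0 _) (e_eta a).
have : P setT = P set0 by congr (P _); rewrite -subset0 => a _; apply: hn; exists a.
by rewrite probability_setT measure0 => /eqP; rewrite eqe oner_eq0.
Qed.

Lemma expectation2_velocity : expectation2 P v =
  (\int[P]_a (F a).1 + \int[P]_a (e a).1, \int[P]_a (F a).2 + \int[P]_a (e a).2).
Proof.
have [s1 s2] := bmeas_self_velocity bx xc; have [f1 f2] := bF; have [e1 e2] := be.
have [h1 h2] : \int[P]_a (S a).1 = 0 /\ \int[P]_a (S a).2 = 0.
  by have := expectation_self_velocity bx xc; rewrite /expectation2 => -[].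
have i1 := bmeas_integrable P s1; have i2 := bmeas_integrable P s2.
have i3 := bmeas_integrable P f1; have i4 := bmeas_integrable P f2.
have i5 := bmeas_integrable P e1; have i6 := bmeas_integrable P e2.
rewrite /expectation2.
under eq_Rintegral do rewrite vE /=.
under [X in (_, X)]eq_Rintegral do rewrite vE /=.
rewrite !RintegralD//; do ?[exact: integrable_EFinZ
  |by apply: integrable_EFinD => //; exact: integrable_EFinZ].
by rewrite !RintegralZl// h1 h2 !mulr0 !add0r.
Qed.

Let drift a : R * R :=
  ((F a).1 - \int[P]_b (F b).1 + ((e a).1 - \int[P]_b (e b).1),
   (F a).2 - \int[P]_b (F b).2 + ((e a).2 - \int[P]_b (e b).2)).

(** The deviation from the mean is the average over [b] of F a - F b, at most L times |xi a| + |xi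
    b|. *)
Let oscF (i : R * R -> R) : (forall z w, i (z - w) = i z - i w) ->
  (forall z, `|i z| <= enorm z) -> bmeas (fun a => i (F a)) ->
  forall a, `|i (F a) - \int[P]_b i (F b)| <= L * (rho a + Er).
Proof.
move=> iB ile bi a.
have ii := bmeas_integrable P bi; have ic := bmeas_integrable P (bmeas_cst T (i (F a))).
have -> : i (F a) - \int[P]_b i (F b) = \int[P]_b (i (F a) - i (F b)).
  by rewrite RintegralB// Rintegral_prob_cst.
have bB : bmeas (fun b => L * (enorm (xi a) + enorm (xi b))).
  by apply: bmeasM; [|apply: bmeasD]; do ?exact: bmeas_cst.
apply: (@le_trans _ _ (\int[P]_b (L * (enorm (xi a) + enorm (xi b))))).
  apply: le_norm_Rintegral.
  - exact: integrable_EFinB.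
  - exact: bmeas_integrable.
  - move=> b; rewrite -iB; apply: (le_trans (ile _)); apply: (le_trans (FL a b)).
    by rewrite ler_wpM2l// -(centeredB P x) enormB.
rewrite RintegralZl//; last first.
  by apply: bmeas_integrable; apply: bmeasD => //; exact: bmeas_cst.
rewrite RintegralD ?Rintegral_prob_cst//; do ?exact: bmeas_integrable.
by apply: bmeas_integrable; exact: bmeas_cst.
Qed.

Let osce (i : R * R -> R) :
  (forall z, `|i z| <= enorm z) -> bmeas (fun a => i (e a)) ->
  forall a, `|i (e a) - \int[P]_b i (e b)| <= 2 * eta.
Proof.
move=> ile bi a; have ii := bmeas_integrable P bi.
apply: (le_trans (ler_normB _ _)); rewrite mulr2n mulrDl mul1r.
apply: lerD; first exact: le_trans (ile _) (e_eta a).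
by apply: Rintegral_norm_le => // b; exact: le_trans (ile _) (e_eta b).
Qed.

Lemma drift_bound a : `|dotp (xi a) (drift a)| <= 2 * rho a * (L * (rho a + Er) + 2 * eta).
Proof.
have [f1 f2] := bF; have [e1 e2] := be.
have h1 : `|(drift a).1| <= L * (rho a + Er) + 2 * eta.
  rewrite /drift /=; apply: (le_trans (ler_normD _ _)); apply: lerD.
    by apply: (@oscF fst) => //; exact: norm1_le_enorm.
  by apply: (@osce fst) => //; exact: norm1_le_enorm.
have h2 : `|(drift a).2| <= L * (rho a + Er) + 2 * eta.
  rewrite /drift /=; apply: (le_trans (ler_normD _ _)); apply: lerD.
    by apply: (@oscF snd) => //; exact: norm2_le_enorm.
  by apply: (@osce snd) => //; exact: norm2_le_enorm.
apply: (le_trans (ler_normD _ _)); rewrite !normrM.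
have -> : 2 * rho a * (L * (rho a + Er) + 2 * eta) =
  rho a * (L * (rho a + Er) + 2 * eta) + rho a * (L * (rho a + Er) + 2 * eta) by ring.
by apply: lerD; apply: ler_pM => //; [exact: norm1_le_enorm|exact: norm2_le_enorm].
Qed.

Lemma dotp_velocity a : dotp (xi a) (v a - expectation2 P v) =
  Gam * dotp (xi a) (S a) + dotp (xi a) (drift a).
Proof.
by rewrite expectation2_velocity vE /dotp /drift /=; ring.
Qed.

Lemma bmeas_drift : bmeas (fun a => dotp (xi a) (drift a)).
Proof.
have [f1 f2] := bF; have [e1 e2] := be; have [b1 b2] := bxi.
by apply: bmeasD; apply: bmeasM => //; apply: bmeasD; apply: bmeasB => //; exact: bmeas_cst.
Qed.

Lemma bmeas_dotp_self : bmeas (fun a => dotp (xi a) (S a)).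
Proof.
have [s1 s2] := bmeas_self_velocity bx xc; have [b1 b2] := bxi.
by apply: bmeasD; exact: bmeasM.
Qed.

Lemma mean_radius_ge0 : 0 <= Er.
Proof. by apply: Rintegral_ge0 => a _; exact: enorm_ge0. Qed.

(** The variance of the radius is nonnegative. *)
Lemma sqr_mean_radius : Er ^+ 2 <= \int[P]_a sqn (xi a).
Proof.
have h : 0 <= \int[P]_a ((enorm (xi a) - Er) ^+ 2).
  by apply: Rintegral_ge0 => a _; exact: sqr_ge0.
rewrite -subr_ge0; move: h.
have bs := bmeas_sqn_centered P bx.
have -> : (fun a => (enorm (xi a) - Er) ^+ 2) =
    (fun a => (sqn (xi a) - 2 * Er * enorm (xi a)) + Er ^+ 2).
  by apply/funext => a; rewrite sqrrB enorm_sqr; ring.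
have b1 : bmeas (fun a => 2 * Er * enorm (xi a)) by apply: bmeasM => //; exact: bmeas_cst.
rewrite RintegralD//; last 2 first.
  - by apply: bmeas_integrable; exact: bmeasB.
  - by apply: bmeas_integrable; exact: bmeas_cst.
rewrite RintegralB//; do ?exact: bmeas_integrable.
rewrite RintegralZl ?Rintegral_prob_cst//; last exact: bmeas_integrable.
by rewrite [X in 0 <= X -> _](_ : _ = \int[P]_a sqn (xi a) - Er ^+ 2)//; ring.
Qed.

(** The self-interaction drops out whatever the circulation [Gam], so the rate depends only on the
    Lipschitz constant and the error. *)
Lemma energy_rate :
  \int[P]_a (2 * dotp (xi a) (v a - expectation2 P v))
  <= (8 * L + 8) * (\int[P]_a sqn (xi a) + eta ^+ 2).
Proof.
have bs := bmeas_sqn_centered P bx.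
under eq_Rintegral do rewrite dotp_velocity.
rewrite RintegralZl//; last first.
  apply: bmeas_integrable; apply: bmeasD; last exact: bmeas_drift.
  by apply: bmeasM; [exact: bmeas_cst|exact: bmeas_dotp_self].
rewrite RintegralD//; last 2 first.
  - apply: bmeas_integrable; apply: bmeasM; first exact: bmeas_cst.
    exact: bmeas_dotp_self.
  - apply: bmeas_integrable; exact: bmeas_drift.
rewrite RintegralZl//; last by apply: bmeas_integrable; exact: bmeas_dotp_self.
rewrite (energy_self_velocity bx xc) mulr0 add0r.
(* From [drift_bound], with the product of radius and [eta] split by (radius - eta)^2 >= 0; after
   integration the mean radius is absorbed by [sqr_mean_radius]. *)
pose B a := (2 * L + 4) * sqn (xi a) + 2 * L * Er * enorm (xi a) + 4 * eta ^+ 2.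
have bb1 : bmeas (fun a => (2 * L + 4) * sqn (xi a)) by apply: bmeasM => //; exact: bmeas_cst.
have bb2 : bmeas (fun a => 2 * L * Er * enorm (xi a)) by apply: bmeasM => //; exact: bmeas_cst.
have bB : bmeas B by apply: bmeasD; [exact: bmeasD|exact: bmeas_cst].
have h : \int[P]_a dotp (xi a) (drift a) <= \int[P]_a B a.
  apply: le_Rintegral => //; do ?[apply: bmeas_integrable => //; exact: bmeas_drift].
  move=> a _; apply: (le_trans (ler_norm _)); apply: (le_trans (drift_bound a)).
  have := sqr_ge0 (enorm (xi a) - eta); rewrite /B -enorm_sqr.
  have := enorm_ge0 (xi a); move: (enorm (xi a)) (Er) L => r m l; nra.
have EB : \int[P]_a B a = (2 * L + 4) * \int[P]_a sqn (xi a) + 2 * L * Er ^+ 2 + 4 * eta ^+ 2.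
  rewrite /B RintegralD//; last 2 first.
    - by apply: bmeas_integrable; exact: bmeasD.
    - by apply: bmeas_integrable; exact: bmeas_cst.
  rewrite Rintegral_prob_cst RintegralD//; do ?exact: bmeas_integrable.
  rewrite !RintegralZl//; do ?exact: bmeas_integrable.
  by ring.
rewrite EB in h.
have := sqr_mean_radius; have := sqr_ge0 eta.
move: (\int[P]_a sqn (xi a)) (Er ^+ 2) (eta ^+ 2) (\int[P]_a dotp _ _) h L0 => I m h2 X.
by move=> h l0 h20 hm; nra.
Qed.

Variables (c A : R).
Hypotheses (A0 : 0 < A) (A1 : A <= 1) (Gc : `|Gam| <= c).
Hypothesis etaA : eta <= c * A.
Hypothesis IA : \int[P]_a sqn (xi a) <= c ^+ 2 * A ^+ 2.

Let c_ge0 : 0 <= c. Proof. exact: le_trans Gc. Qed.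
Let A_ge0 : 0 <= A. Proof. exact: ltW. Qed.

Lemma mean_radius_le : Er <= c * A.
Proof.
rewrite -ler_sqr ?nnegrE ?mean_radius_ge0 ?mulr_ge0//.
by rewrite exprMn; exact: le_trans sqr_mean_radius IA.
Qed.

(** The self-interaction costs c^2 A^2 times a moment two orders lower in |xi|^2, because the second
    moment is O(A^2). Such lower moments are traded for the moment itself plus a power of A, which
    closes a Gronwall inequality whose constant does not see the singular bound. *)
Lemma moment_rate (m : nat) :
  \int[P]_a (m.+3%:R * sqn (xi a) ^+ m.+2 * (2 * dotp (xi a) (v a - expectation2 P v)))
  <= 2 * m.+3%:R * (6 * m.+2%:R * c ^+ 3 + 2 * L + 2 * (L + 2) * c) *
     (\int[P]_a (sqn (xi a) ^+ m.+3) + A ^+ m.+3).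
Proof.
have bs := bmeas_sqn_centered P bx.
have bsn n : bmeas (fun a => sqn (xi a) ^+ n) by exact: bmeasX.
have -> : (fun a => m.+3%:R * sqn (xi a) ^+ m.+2 * (2 * dotp (xi a) (v a - expectation2 P v))) =
    (fun a => (2 * m.+3%:R) * (Gam * (sqn (xi a) ^+ m.+2 * dotp (xi a) (S a)) +
      sqn (xi a) ^+ m.+2 * dotp (xi a) (drift a))).
  by apply/funext => a; rewrite dotp_velocity; ring.
have b1 : bmeas (fun a => sqn (xi a) ^+ m.+2 * dotp (xi a) (S a)).
  by apply: bmeasM => //; exact: bmeas_dotp_self.
have b1' : bmeas (fun a => Gam * (sqn (xi a) ^+ m.+2 * dotp (xi a) (S a))).
  by apply: bmeasM => //; exact: bmeas_cst.
have b2 : bmeas (fun a => sqn (xi a) ^+ m.+2 * dotp (xi a) (drift a)).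
  by apply: bmeasM => //; exact: bmeas_drift.
rewrite RintegralZl//; last by apply: bmeas_integrable; exact: bmeasD.
rewrite -[leRHS]mulrA ler_wpM2l ?mulr_ge0//.
rewrite RintegralD//; do ?exact: bmeas_integrable.
rewrite RintegralZl//; last exact: bmeas_integrable.
set M := \int[P]_a (sqn (xi a) ^+ m.+3).
(* Young's inequality in crude form: the product is at most the (m + 3)-th power of the larger of
   [s] and [A]. *)
have young1 s : 0 <= s -> A ^+ 2 * s ^+ m.+1 <= s ^+ m.+3 + A ^+ m.+3.
  move=> s0; have [sA|/ltW As] := leP s A.
    apply: (@le_trans _ _ (A ^+ m.+3)); last by rewrite lerDr exprn_ge0.
    by rewrite [leRHS](exprD _ 2 m.+1) ler_wpM2l ?exprn_ge0// lerXn2r.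
  apply: (@le_trans _ _ (s ^+ m.+3)); last by rewrite lerDl exprn_ge0.
  by rewrite [leRHS](exprD _ 2 m.+1) ler_wpM2r ?exprn_ge0// lerXn2r.
(* Here the radius itself is compared with [A]; when it is smaller, A <= 1 gives |z|^2 <= A. *)
have young2 z : sqn z ^+ m.+2 * (enorm z * A) <= sqn z ^+ m.+3 + A ^+ m.+3.
  have z0 := enorm_ge0 z; have s0 := sqn_ge0 z.
  have [sA|/ltW As] := leP (enorm z) A.
    apply: (@le_trans _ _ (A ^+ m.+3)); last by rewrite lerDr exprn_ge0.
    apply: (@le_trans _ _ (A ^+ m.+2 * A)); last by rewrite [leRHS]exprSr.
    apply: ler_pM; rewrite ?exprn_ge0 ?mulr_ge0 //.
      rewrite lerXn2r ?nnegrE // -enorm_sqr expr2.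
      apply: (@le_trans _ _ (A * 1)); last by rewrite mulr1.
      by apply: ler_pM => //; exact: le_trans A1.
    by rewrite -[leRHS]mul1r; apply: ler_pM => //; exact: le_trans A1.
  apply: (@le_trans _ _ (sqn z ^+ m.+3)); last by rewrite lerDl exprn_ge0.
  by rewrite [leRHS]exprSr ler_wpM2l ?exprn_ge0// -enorm_sqr expr2 ler_wpM2l.
have self : Gam * \int[P]_a (sqn (xi a) ^+ m.+2 * dotp (xi a) (S a)) <=
    6 * m.+2%:R * c ^+ 3 * (M + A ^+ m.+3).
  apply: (le_trans (ler_norm _)); rewrite normrM.
  apply: (@le_trans _ _ (c * (6 * m.+2%:R * (c ^+ 2 * A ^+ 2 * \int[P]_a (sqn (xi a) ^+ m.+1))))).
    apply: ler_pM => //; apply: (le_trans (moment_self_velocity bx xc m)).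
    rewrite ler_wpM2l ?mulr_ge0// ler_wpM2r//.
    by apply: Rintegral_ge0 => a _; rewrite exprn_ge0 ?sqn_ge0.
  rewrite (_ : c * _ = 6 * m.+2%:R * c ^+ 3 * (A ^+ 2 * \int[P]_a (sqn (xi a) ^+ m.+1))); last by ring.
  rewrite ler_wpM2l ?mulr_ge0 ?exprn_ge0//.
  rewrite -RintegralZl//; last exact: bmeas_integrable.
  rewrite -[X in M + X](Rintegral_prob_cst P) -RintegralD//; last 2 first.
    exact: bmeas_integrable.
    by apply: bmeas_integrable; exact: bmeas_cst.
  apply: le_Rintegral => //.
  - by apply: bmeas_integrable; apply: bmeasM => //; exact: bmeas_cst.
  - by apply: bmeas_integrable; apply: bmeasD => //; exact: bmeas_cst.
  - by move=> a _; apply: young1; exact: sqn_ge0.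
have dr : \int[P]_a (sqn (xi a) ^+ m.+2 * dotp (xi a) (drift a)) <=
    (2 * L + 2 * (L + 2) * c) * (M + A ^+ m.+3).
  rewrite -[X in M + X](Rintegral_prob_cst P) -RintegralD//; last 2 first.
    exact: bmeas_integrable.
    by apply: bmeas_integrable; exact: bmeas_cst.
  have bb : bmeas (fun a => sqn (xi a) ^+ m.+3 + A ^+ m.+3).
    by apply: bmeasD => //; exact: bmeas_cst.
  rewrite -RintegralZl//; last exact: bmeas_integrable.
  apply: le_Rintegral => //; do ?exact: bmeas_integrable.
    by apply: bmeas_integrable; apply: bmeasM => //; exact: bmeas_cst.
  move=> a _; have s0 := sqn_ge0 (xi a); have r0 := enorm_ge0 (xi a).
  apply: (@le_trans _ _ (sqn (xi a) ^+ m.+2 * (2 * enorm (xi a) * (L * (enorm (xi a) + c * A) + 2 * (c * A))))).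
    rewrite ler_wpM2l ?exprn_ge0//; apply: (le_trans (ler_norm _)).
    apply: (le_trans (drift_bound a)); rewrite ler_wpM2l ?mulr_ge0//.
    by rewrite lerD// ler_wpM2l// lerD2l mean_radius_le.
  have -> : sqn (xi a) ^+ m.+2 * (2 * enorm (xi a) * (L * (enorm (xi a) + c * A) + 2 * (c * A))) =
    2 * L * sqn (xi a) ^+ m.+3 + 2 * (L + 2) * c * (sqn (xi a) ^+ m.+2 * (enorm (xi a) * A)).
    rewrite [X in 2 * L * X]exprSr -[X in _ = _ * (_ * X) + _]enorm_sqr; ring.
  rewrite [leRHS]mulrDl; apply: lerD; last first.
    by rewrite ler_wpM2l ?young2 ?mulr_ge0 ?addr_ge0.
  by rewrite ler_wpM2l ?mulr_ge0// lerDl exprn_ge0.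
by apply: (le_trans (lerD self dr)); rewrite -mulrDl -!addrA.
Qed.

Lemma particle_rate (a : T) (J : R) :
  (\int[P]_(b in [set b | (sqn (xi a) < 4 * sqn (xi b))%R]) (enorm (x a - x b))^-1%:E <= J%:E)%E ->
  2 * dotp (xi a) (v a - expectation2 P v) <=
  2 * c * (10 * (c ^+ 2 * A ^+ 2 / sqn (xi a)) + rho a * J) +
  4 * rho a * (L * (rho a + c * A) + 2 * (c * A)).
Proof.
move=> hJ; rewrite dotp_velocity mulrDr; apply: lerD.
  rewrite -mulrA ler_wpM2l//; apply: (le_trans (ler_norm _)); rewrite normrM.
  apply: ler_pM => //; apply: (le_trans (radial_self_velocity bx xc hJ)).
  by rewrite lerD2r ler_wpM2l// ler_wpM2r// invr_ge0 sqn_ge0.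
rewrite (_ : 4 * rho a * _ = 2 * (2 * rho a * (L * (rho a + c * A) + 2 * (c * A)))); last by ring.
rewrite ler_wpM2l//; apply: (le_trans (ler_norm _)); apply: (le_trans (drift_bound a)).
rewrite ler_wpM2l ?mulr_ge0 ?enorm_ge0//.
by rewrite lerD// ?ler_wpM2l// lerD2l mean_radius_le.
Qed.

End DrivenBlob.

Section DeriveExpectation.
Context d (T : measurableType d) (R : realType) (P : probability T R).

(** Domination is asked only on a window of times around [t0]: the integrands are polynomials in
    positions that may grow with time. *)
Lemma is_derive_Rintegral (f df : R -> T -> R) (t0 G : R) :
  (forall (t : R) a, is_derive t 1 (f ^~ a) (df t a)) -> (forall t, bmeas (f t)) ->
  (forall s a, t0 - 1 < s < t0 + 1 -> `|df s a| <= G) ->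
  is_derive t0 1 (fun t => \int[P]_a f t a) (\int[P]_a df t0 a).
Proof.
move=> hd bf hG.
have E s a : partial1of2 f s a = df s a.
  by rewrite partial1of2E; have := hd s a => h; rewrite derive_val.
pose I : set R := [set` `]t0 - 1, t0 + 1[].
have It : I t0 by rewrite /I /= in_itv /=; apply/andP; split; lra.
have intf s : I s -> P.-integrable setT (EFin \o f s) by move=> _; exact: bmeas_integrable.
have der s a : I s -> setT a -> derivable (f ^~ a) s 1 by move=> _ _; have := hd s a; case.
have G0 (a : T) : 0 <= `|G| by [].
have iG : P.-integrable setT (EFin \o (fun=> `|G|)).
  by apply: bmeas_integrable; exact: bmeas_cst.
have Gub s a : I s -> setT a -> `|partial1of2 f s a| <= `|G|.
  by rewrite /I /= in_itv /= => Is _; rewrite E (le_trans (hG _ _ Is))// ler_norm.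
apply: DeriveDef; first exact: (derivable_under_integral measurableT It intf der G0 iG Gub).
rewrite -derive1E (differentiation_under_integral measurableT It intf der G0 iG Gub).
by apply: eq_Rintegral => a _; rewrite E.
Qed.

End DeriveExpectation.

Lemma is_derive_exprn (R : realType) (f : R -> R) (t df : R) (n : nat) :
  is_derive t 1 f df -> is_derive t 1 (fun s => f s ^+ n) (n%:R * f t ^+ n.-1 * df).
Proof.
move=> hf; have := @is_deriveX R R f n t 1 df hf.
by rewrite (_ : f ^+ n = (fun s => f s ^+ n))//; apply/funext => s; rewrite exprfctE.
Qed.

Lemma is_derive_sqn (R : realType) (f : R -> R * R) (t : R) (df : R * R) :
  is_derive t 1 (fun s => (f s).1) df.1 -> is_derive t 1 (fun s => (f s).2) df.2 ->
  is_derive t 1 (fun s => sqn (f s)) (2 * dotp (f t) df).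
Proof.
move=> h1 h2.
have := @is_deriveD R R R _ _ t 1 _ _ (is_derive_exprn 2 h1) (is_derive_exprn 2 h2).
by move/is_derive_eq; apply; rewrite /dotp /= !expr1; ring.
Qed.

(** * Time derivatives of the mean position and of the moments *)

Section BlobDynamics.
Context d (T : measurableType d) (R : realType) (P : probability T R).
Variables (x v : R -> T -> R * R) (V : R).
Hypothesis dx : forall (t : R) a, is_derive t 1 (fun s => (x s a).1) (v t a).1 /\
                            is_derive t 1 (fun s => (x s a).2) (v t a).2.
Hypothesis bx : forall t, bmeas2 (x t).
Hypothesis bv : forall t, bmeas2 (v t).
Hypothesis vV : forall t a, enorm (v t a) <= V.

Local Notation xi t := (centered P (x t)).
Local Notation w t a := (v t a - expectation2 P (v t)).

Lemma derive_expectation2 (t : R) :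
  is_derive t 1 (fun s => (expectation2 P (x s)).1) (expectation2 P (v t)).1 /\
  is_derive t 1 (fun s => (expectation2 P (x s)).2) (expectation2 P (v t)).2.
Proof.
split.
- apply: (@is_derive_Rintegral _ T R P (fun s a => (x s a).1) (fun s a => (v s a).1) t V).
  + by move=> s a; case: (dx s a).
  + by move=> s; case: (bx s).
  + by move=> s a _; exact: le_trans (norm1_le_enorm _) (vV s a).
- apply: (@is_derive_Rintegral _ T R P (fun s a => (x s a).2) (fun s a => (v s a).2) t V).
  + by move=> s a; case: (dx s a).
  + by move=> s; case: (bx s).
  + by move=> s a _; exact: le_trans (norm2_le_enorm _) (vV s a).
Qed.

Lemma derive_sqn_centered (t : R) a :
  is_derive t 1 (fun s => sqn (xi s a)) (2 * dotp (xi t a) (w t a)).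
Proof.
have [d1 d2] := derive_expectation2 t; have [e1 e2] := dx t a.
have h1 := @is_deriveB R R R _ _ t 1 _ _ e1 d1.
have h2 := @is_deriveB R R R _ _ t 1 _ _ e2 d2.
exact: (@is_derive_sqn _ (fun s => xi s a) t (w t a) h1 h2).
Qed.

Let V0 (a : T) : 0 <= V. Proof. exact: le_trans (enorm_ge0 _) (vV 0 a). Qed.

Let norm_expectation (f : R -> T -> R) (c : R) s : bmeas (f s) ->
  (forall a, `|f s a| <= c) -> `|\int[P]_a f s a| <= c.
Proof. by move=> bf h; apply: Rintegral_norm_le => //; exact: bmeas_integrable. Qed.

Lemma centered_locally_bounded t : exists c, forall s a, t - 1 < s < t + 1 ->
  enorm (xi s a) <= c.
Proof.
have [[_ [c1 h1]] [_ [c2 h2]]] := bx t.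
exists ((c1 + V) + (c1 + V) + ((c2 + V) + (c2 + V))) => s a st.
have Vst (b : T) : V * `|s - t| <= V.
  by rewrite -[leRHS]mulr1 ler_wpM2l ?(V0 b)// ltW// ltr_distl; lra.
have k1 b : `|(x s b).1| <= c1 + V.
  rewrite -[(x s b).1](subrK (x t b).1) addrC; apply: (le_trans (ler_normD _ _)).
  apply: lerD => //; apply: le_trans (Vst b).
  apply: (@lipschitz_of_derive _ (fun s => (x s b).1) (fun s => (v s b).1)).
    by move=> u; case: (dx u b).
  by move=> u; exact: le_trans (norm1_le_enorm _) (vV u b).
have k2 b : `|(x s b).2| <= c2 + V.
  rewrite -[(x s b).2](subrK (x t b).2) addrC; apply: (le_trans (ler_normD _ _)).
  apply: lerD => //; apply: le_trans (Vst b).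
  apply: (@lipschitz_of_derive _ (fun s => (x s b).2) (fun s => (v s b).2)).
    by move=> u; case: (dx u b).
  by move=> u; exact: le_trans (norm2_le_enorm _) (vV u b).
have [b1 b2] := bx s.
apply: (le_trans (enorm_le_normD _)); apply: lerD; rewrite /centered /=;
  apply: (le_trans (ler_normB _ _)); apply: lerD => //.
- exact: (@norm_expectation (fun s a => (x s a).1)).
- exact: (@norm_expectation (fun s a => (x s a).2)).
Qed.

Lemma derive_moment (n : nat) (t : R) :
  is_derive t 1 (fun s => \int[P]_a (sqn (xi s a) ^+ n.+1))
    (\int[P]_a (n.+1%:R * sqn (xi t a) ^+ n * (2 * dotp (xi t a) (w t a)))).
Proof.
have [c hc] := centered_locally_bounded t.
apply: (@is_derive_Rintegral _ T R P (fun s a => sqn (xi s a) ^+ n.+1)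
  (fun s a => n.+1%:R * sqn (xi s a) ^+ n * (2 * dotp (xi s a) (w s a))) t
  (n.+1%:R * (c ^+ 2) ^+ n * (2 * (c * (V + (V + V)))))).
- by move=> s a; exact: (is_derive_exprn n.+1 (derive_sqn_centered s a)).
- by move=> s; apply: bmeasX; exact: bmeas_sqn_centered.
- move=> s a st; have xc := hc s a st; have c0 := le_trans (enorm_ge0 _) xc.
  rewrite !normrM normr_nat normrX (ger0_norm (sqn_ge0 _)) (@ger0_norm _ 2)//.
  apply: ler_pM; rewrite ?mulr_ge0 ?exprn_ge0 ?sqn_ge0//.
    rewrite ler_wpM2l// lerXn2r ?nnegrE ?sqn_ge0 ?sqr_ge0//.
    by rewrite -enorm_sqr lerXn2r ?nnegrE ?enorm_ge0.
  rewrite ler_wpM2l//; apply: (le_trans (dotp_le _ _)).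
  apply: ler_pM; rewrite ?enorm_ge0//.
  apply: (le_trans (enormB _ _)); apply: lerD => //.
  have [v1 v2] := bv s.
  apply: (le_trans (enorm_le_normD _)); apply: lerD => /=.
    apply: (@norm_expectation (fun s a => (v s a).1)) => // b.
    exact: le_trans (norm1_le_enorm _) (vV s b).
  apply: (@norm_expectation (fun s a => (v s a).2)) => // b.
  exact: le_trans (norm2_le_enorm _) (vV s b).
Qed.

End BlobDynamics.

(** * Moments and particles of a single blob over a time interval *)

Section BlobConfinement.
Context d (T : measurableType d) (R : realType) (P : probability T R).
Variables (c L tmax theta kap : R).
Hypotheses (c0 : 0 <= c) (L0 : 0 <= L) (tm0 : 0 <= tmax) (th0 : 0 < theta).
Variables (A t1 Gam V : R) (x v F e : R -> T -> R * R).
Hypotheses (A0 : 0 < A) (A1 : A <= 1) (t1m : t1 <= tmax) (Gc : `|Gam| <= c).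
Hypothesis dx : forall (t : R) a, is_derive t 1 (fun s => (x s a).1) (v t a).1 /\
                                  is_derive t 1 (fun s => (x s a).2) (v t a).2.
Hypotheses (bx : forall t, bmeas2 (x t)) (bv : forall t, bmeas2 (v t)).
Hypothesis vV : forall t a, enorm (v t a) <= V.
Hypothesis drv : forall t, 0 <= t <= t1 -> [/\ bmeas2 (F t), bmeas2 (e t),
     forall a, v t a = (Gam * (self_velocity P (x t) a).1 + (F t a).1 + (e t a).1,
                        Gam * (self_velocity P (x t) a).2 + (F t a).2 + (e t a).2),
     forall a b, enorm (F t a - F t b) <= L * enorm (x t a - x t b)
     & forall a, enorm (e t a) <= c * A].
Hypothesis sing : forall t, 0 <= t <= t1 -> forall a S, measurable S ->
     (\int[P]_(b in S) (enorm (x t a - x t b))^-1%:E <=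
        (c * fine (P S) `^ theta * A `^ (- kap))%:E)%E.
Hypothesis init : forall a, enorm (centered P (x 0) a) <= c * A.

Local Notation xi t := (centered P (x t)).

Let A_ge0 : 0 <= A. Proof. exact: ltW. Qed.

Let bs t : bmeas (fun a => sqn (xi t a)).
Proof. exact: bmeas_sqn_centered. Qed.

Let init2 a : sqn (xi 0 a) <= (c * A) ^+ 2.
Proof. by rewrite -enorm_sqr lerXn2r ?nnegrE ?enorm_ge0 ?mulr_ge0. Qed.

Let exp_tmax (k t : R) : 0 <= k -> 0 <= t <= t1 -> expR (k * t) <= expR (k * tmax).
Proof.
by move=> k0 /andP[_ t1t]; rewrite ler_expR ler_wpM2l// (le_trans t1t).
Qed.

Let exp_ge1 (k : R) : 0 <= k -> 1 <= expR (k * tmax).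
Proof. by move=> k0; rewrite -expR0 ler_expR mulr_ge0. Qed.

(** With E the exponential, Gronwall gives 2 c^2 E A^2; since E >= 1 this is at most (2 c E)^2 A^2.
    The second moment bound is kept a perfect square, in the form [IA] expected above. *)
Definition energy_const : R := 2 * c * expR ((8 * L + 8) * tmax).
Local Notation c1 := energy_const.

Lemma energy_const_ge : c <= c1.
Proof.
have : 1 <= expR ((8 * L + 8) * tmax) by apply: exp_ge1; nneg.
by move=> E1; rewrite /energy_const -mulrA mulrCA ler_peMr//; lra.
Qed.

Let c1_ge0 : 0 <= c1. Proof. exact: le_trans energy_const_ge. Qed.

Lemma energy_confined t : 0 <= t <= t1 ->
  \int[P]_a sqn (xi t a) <= c1 ^+ 2 * A ^+ 2.
Proof.
move=> ht.
have G : \int[P]_a (sqn (xi t a) ^+ 1) + (c * A) ^+ 2 <=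
    (\int[P]_a (sqn (xi 0 a) ^+ 1) + (c * A) ^+ 2) * expR ((8 * L + 8) * t).
  apply: (gronwall (derive_moment P dx bx bv vV 0) _ ht) => s /andP[s0 st].
  have hs : 0 <= s <= t1 by rewrite !ltW.
  have [bF be vE FL eE] := drv hs.
  have H := energy_rate (bx s) (fun a => sing hs a measurableT) bF be L0 vE FL eE.
  under eq_Rintegral do rewrite expr0 !mul1r.
  by under [X in _ <= _ * (X + _)]eq_Rintegral do rewrite expr1.
have E u : \int[P]_a (sqn (xi u a) ^+ 1) = \int[P]_a sqn (xi u a).
  by apply: eq_Rintegral => a _; rewrite expr1.
rewrite !E in G.
have i0 : \int[P]_a sqn (xi 0 a) <= (c * A) ^+ 2 by apply: Rintegral_bmeas_le.
have k0 : 0 <= 8 * L + 8 by nneg.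
have e1 := exp_ge1 k0; have et := exp_tmax k0 ht.
have et0 := expR_ge0 ((8 * L + 8) * t).
have s0 : 0 <= \int[P]_a sqn (xi 0 a) by apply: Rintegral_ge0 => a _; exact: sqn_ge0.
have z0 := sqr_ge0 (c * A).
rewrite -exprMn /energy_const.
have -> : (2 * c * expR ((8 * L + 8) * tmax) * A) ^+ 2 =
  (c * A) ^+ 2 * (4 * expR ((8 * L + 8) * tmax) ^+ 2) by ring.
move: (\int[P]_a sqn (xi 0 a)) (\int[P]_a sqn (xi t a)) ((c * A) ^+ 2) G i0 s0 z0 => I0 It z G i0 s0 z0.
move: (expR _) (expR _) e1 et et0 G => Et Em e1 et et0 G.
apply: (@le_trans _ _ (2 * z * Em)).
  apply: (@le_trans _ _ ((I0 + z) * Et)); first by apply: le_trans G; rewrite lerDl.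
  by apply: ler_pM => //; [exact: addr_ge0|lra].
by rewrite [2 * z]mulrC -mulrA ler_wpM2l//; nra.
Qed.

(** The rate of [moment_rate] with [c1] in the role of [c], as [c1] dominates both [c] and the
    constant of the second moment. *)
Definition moment_rate_const (m : nat) : R :=
  2 * m.+3%:R * (6 * m.+2%:R * c1 ^+ 3 + 2 * L + 2 * (L + 2) * c1).
Local Notation C2 := moment_rate_const.

(** The power of c^2 bounds the initial moment, A <= 1 lowering A^(2 (m + 3)) to A^(m + 3); the 1 is
    the additive term A^(m + 3) of the Gronwall inequality. *)
Definition moment_const (m : nat) : R := ((c ^+ 2) ^+ m.+3 + 1) * expR (C2 m * tmax).
Local Notation C3 := moment_const.

Let C2_ge0 m : 0 <= C2 m. Proof. by rewrite /moment_rate_const; nneg. Qed.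

Lemma moment_confined (m : nat) t : 0 <= t <= t1 ->
  \int[P]_a (sqn (xi t a) ^+ m.+3) <= C3 m * A ^+ m.+3.
Proof.
move=> ht.
have G : \int[P]_a (sqn (xi t a) ^+ m.+3) + A ^+ m.+3 <=
    (\int[P]_a (sqn (xi 0 a) ^+ m.+3) + A ^+ m.+3) * expR (C2 m * t).
  apply: (gronwall (derive_moment P dx bx bv vV m.+2) _ ht) => s /andP[s0 st].
  have hs : 0 <= s <= t1 by rewrite !ltW.
  have [bF be vE FL eE] := drv hs.
  have eE' a : enorm (e s a) <= c1 * A.
    by apply: (le_trans (eE a)); rewrite ler_wpM2r// energy_const_ge.
  have Gc' := le_trans Gc energy_const_ge.
  exact: (moment_rate (bx s) (fun a => sing hs a measurableT) bF be L0 vE FL eE' A0 A1 Gc' (lexx _) (energy_confined hs)).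
have i0 : \int[P]_a (sqn (xi 0 a) ^+ m.+3) <= (c ^+ 2) ^+ m.+3 * A ^+ m.+3.
  apply: Rintegral_bmeas_le; first exact: bmeasX.
  move=> a; rewrite -exprMn; apply: lerXn2r; rewrite ?nnegrE ?sqn_ge0 ?mulr_ge0 ?sqr_ge0//.
  apply: (le_trans (init2 a)); rewrite exprMn ler_wpM2l ?sqr_ge0// expr2.
  by rewrite -[leRHS]mulr1 ler_wpM2l.
have An : 0 <= A ^+ m.+3 by nneg.
have cn : 0 <= (c ^+ 2) ^+ m.+3 by nneg.
apply: (@le_trans _ _ (\int[P]_a (sqn (xi t a) ^+ m.+3) + A ^+ m.+3)); first by rewrite lerDl.
apply: (le_trans G); rewrite /moment_const [leRHS]mulrAC; apply: ler_pM; rewrite ?expR_ge0//.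
- apply: addr_ge0 => //; apply: Rintegral_ge0 => a _; nneg.
- by rewrite mulrDl mul1r lerD2r.
- exact: exp_tmax.
Qed.

Variables (a' : R) (m : nat).
Hypotheses (a'0 : 0 <= a') (a'12 : a' <= 2^-1).
Hypothesis hm : 1 + kap <= theta * m.+3%:R * (1 - 2 * a').

Definition tail_const : R := c * (4 ^+ m.+3 * C3 m) `^ theta.
Local Notation C5 := tail_const.
Definition particle_rate_const : R :=
  2 * c1 * (10 * c1 ^+ 2 + C5) + 4 * (L * (1 + c1) + 2 * c1).
Local Notation C6 := particle_rate_const.
Definition particle_const : R := (c ^+ 2 + 1) * expR (C6 * tmax).

Let C3_ge0 : 0 <= C3 m. Proof. by rewrite /moment_const; nneg. Qed.
Let C5_ge0 : 0 <= C5. Proof. by rewrite /tail_const; nneg. Qed.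
Let C6_ge0 : 0 <= C6. Proof. by rewrite /particle_rate_const; nneg. Qed.

(** With n = m + 3, Chebyshev bounds the mass of the near zone by a multiple of A^n A^(- 2 a' n).
    Raised to the power [theta] and multiplied by A^(-kap), this is O(A) exactly under [hm]. *)
Lemma tail_confined t a : 0 <= t <= t1 -> A `^ (2 * a') <= sqn (xi t a) ->
  (\int[P]_(b in [set b | (sqn (xi t a) < 4 * sqn (xi t b))%R])
     (enorm (x t a - x t b))^-1%:E <= (C5 * A)%:E)%E.
Proof.
move=> ht sA.
have s0 : 0 < sqn (xi t a) by apply: lt_le_trans sA; exact: powR_gt0.
have mE : measurable [set b | sqn (xi t a) < 4 * sqn (xi t b)].
  apply: measurable_set_lt => //; apply: measurable_funM => //.
  by case: (bs t).
apply: (le_trans (sing ht a mE)); rewrite lee_fin.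
have a0 : xi t a != 0 by rewrite -sqn_eq0 gt_eqF.
have ch := chebyshev_moment (bx t) m.+3 a0.
set p := fine _ in ch *.
have p0 : 0 <= p by apply: fine_ge0.
have hp : p <= 4 ^+ m.+3 * C3 m * A `^ (m.+3%:R * (1 - 2 * a')).
  apply: (le_trans ch); rewrite ler_pdivrMr ?exprn_gt0//.
  apply: (@le_trans _ _ (4 ^+ m.+3 * (C3 m * A ^+ m.+3))).
    by rewrite ler_wpM2l ?exprn_ge0// moment_confined.
  rewrite -(mulrA _ (C3 m)) -[leRHS]mulrA ler_wpM2l ?exprn_ge0// -[leRHS]mulrA.
  rewrite ler_wpM2l//.
  apply: (@le_trans _ _ (A `^ (m.+3%:R * (1 - 2 * a')) * (A `^ (2 * a')) ^+ m.+3)).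
    rewrite -[X in _ <= _ * X]powR_mulrn ?powR_ge0// -powRrM -powRD; last by rewrite (gt_eqF A0) implybT.
    rewrite -powR_mulrn//.
    by rewrite le_eqVlt; apply/orP; left; apply/eqP; congr (_ `^ _); ring.
  by rewrite ler_wpM2l ?powR_ge0// lerXn2r ?nnegrE ?powR_ge0 ?sqn_ge0.
have Am : A `^ (theta * m.+3%:R * (1 - 2 * a')) * A `^ (- kap) <= A.
  rewrite -powRD; last by rewrite (gt_eqF A0) implybT.
  rewrite -[leRHS]powRr1//; apply: ger_powR; first by rewrite A0.
  by rewrite lerBrDr.
rewrite /tail_const; set D := _ * C3 m in hp *.
have D0 : 0 <= D by rewrite /D mulr_ge0 ?exprn_ge0.
rewrite -!mulrA ler_wpM2l//.
apply: (@le_trans _ _ ((D * A `^ (m.+3%:R * (1 - 2 * a'))) `^ theta * A `^ (- kap))).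
  rewrite ler_wpM2r ?powR_ge0//; apply: ge0_ler_powR; rewrite ?nnegrE ?(ltW th0)//.
  by rewrite mulr_ge0 ?powR_ge0.
rewrite powRM ?powR_ge0// -powRrM -mulrA ler_wpM2l ?powR_ge0//.
by rewrite (_ : _ * theta = theta * m.+3%:R * (1 - 2 * a'))//; ring.
Qed.

(** Beyond the threshold (c^2 + 1) A^(2 a') every term of [particle_rate] is at most a multiple of
    |xi|^2, so a particle that has left the disc recedes at most exponentially. In c^2 + 1, the c^2
    covers the initial position and the 1 gives A^(2 a') <= |xi|^2. *)
Lemma particle_confined t a : 0 <= t <= t1 ->
  sqn (xi t a) <= particle_const * A `^ (2 * a').
Proof.
move=> ht.
have a12 := a'12; have a0' := a'0.
have thr0 : 0 <= (c ^+ 2 + 1) * A `^ (2 * a') by nneg.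
have G : sqn (xi t a) <= (c ^+ 2 + 1) * A `^ (2 * a') * expR (C6 * t).
  have := gronwall_threshold (T := t1) C6_ge0 thr0 (fun t => derive_sqn_centered P dx bx vV t a).
  move/(_ _ _ t ht); apply; last first.
    apply: (le_trans (init2 a)); rewrite exprMn; apply: ler_pM; rewrite ?sqr_ge0//.
      by rewrite lerDl.
    rewrite -powR_mulrn//; apply: ger_powR; first by rewrite A0.
    lra.
  move=> s /andP[s0 st] sthr; have hs : 0 <= s <= t1 by rewrite !ltW.
  have sA : A `^ (2 * a') <= sqn (xi s a).
    apply: ltW; apply: le_lt_trans sthr.
    by rewrite -[leLHS]mul1r ler_wpM2r ?powR_ge0// lerDr sqr_ge0.
  have [bF be vE FL eE] := drv hs.
  have eE' b : enorm (e s b) <= c1 * A.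
    by apply: (le_trans (eE b)); rewrite ler_wpM2r// energy_const_ge.
  have Gc' := le_trans Gc energy_const_ge.
  apply: le_trans (particle_rate (bx s) (fun a => sing hs a measurableT) bF be L0 vE FL eE' A0 Gc' (lexx _) (energy_confined hs) (tail_confined hs sA)) _.
  have rA : A <= enorm (xi s a).
    rewrite -ler_sqr ?nnegrE ?enorm_ge0// enorm_sqr; apply: le_trans sA.
    rewrite -powR_mulrn//; apply: ger_powR; first by rewrite A0.
    lra.
  (* Uses A^2 <= A^(4 a'), that is a' <= 1/2. *)
  have A2s : A ^+ 2 / sqn (xi s a) <= sqn (xi s a).
    have s1 : 0 < sqn (xi s a) by apply: lt_le_trans sA; exact: powR_gt0.
    rewrite ler_pdivrMr//; apply: (@le_trans _ _ (A `^ (2 * a') * A `^ (2 * a'))).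
      rewrite -powRD; last by rewrite (gt_eqF A0) implybT.
      rewrite -powR_mulrn//; apply: ger_powR; first by rewrite A0.
      lra.
    by apply: ler_pM; rewrite ?powR_ge0.
  have r0 := enorm_ge0 (xi s a).
  have rr : enorm (xi s a) * A <= sqn (xi s a) by rewrite -enorm_sqr expr2 ler_wpM2l.
  rewrite /particle_rate_const [leRHS]mulrDl; apply: lerD.
    rewrite -[leRHS]mulrA ler_wpM2l ?mulr_ge0//.
    rewrite [leRHS]mulrDl; apply: lerD.
      by rewrite -(mulrA (c1 ^+ 2)) (mulrA 10) ler_wpM2l// mulr_ge0 ?sqr_ge0.
    by rewrite mulrCA ler_wpM2l.
  have -> : 4 * enorm (xi s a) * (L * (enorm (xi s a) + c1 * A) + 2 * (c1 * A)) =
    4 * L * sqn (xi s a) + 4 * (L + 2) * c1 * (enorm (xi s a) * A).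
    by rewrite -enorm_sqr; ring.
  have -> : 4 * (L * (1 + c1) + 2 * c1) * sqn (xi s a) =
    4 * L * sqn (xi s a) + 4 * (L + 2) * c1 * sqn (xi s a) by ring.
  by rewrite lerD2l ler_wpM2l ?mulr_ge0 ?addr_ge0.
apply: (le_trans G); rewrite /particle_const mulrAC.
by rewrite ler_wpM2r ?powR_ge0// ler_wpM2l ?exp_tmax//; nneg.
Qed.

Lemma mean_radius_confined t : 0 <= t <= t1 ->
  \int[P]_a enorm (xi t a) <= c1 * A.
Proof.
move=> ht; have [bF be vE FL eE] := drv ht.
have Gc' := le_trans Gc energy_const_ge.
exact: (mean_radius_le (bx t) A0 Gc' (energy_confined ht)).
Qed.

End BlobConfinement.

(** * Interacting blobs *)

Section SeparatedBlobs.
Context d (T : measurableType d) (R : realType) (P Q : probability T R).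
Variables (x y : T -> R * R) (delta : R).
Hypotheses (bx : bmeas2 x) (by_ : bmeas2 y) (delta0 : 0 < delta).
Hypothesis sep : forall a b, 2 * delta <= enorm (x a - y b).
Local Notation K := biot_savart_kernel.

(** A coordinate chosen by a boolean, so that one proof serves both. *)
Definition prj (i : bool) (z : R * R) : R := if i then z.1 else z.2.

Lemma prjB i z w : prj i (z - w) = prj i z - prj i w.
Proof. by case: i. Qed.

Lemma norm_prj_le i z : `|prj i z| <= enorm z.
Proof. by case: i; [exact: norm1_le_enorm|exact: norm2_le_enorm]. Qed.

Definition blob_field (z : R * R) : R * R := expectation2 Q (fun b => K (z - y b)).

Lemma prj_blob_field i z : prj i (blob_field z) = \int[Q]_b prj i (K (z - y b)).
Proof. by case: i. Qed.

Let kernel_bounded i a b : `|prj i (K (x a - y b))| <= (2 * delta)^-1.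
Proof.
apply: (le_trans (norm_prj_le _ _)); apply: (le_trans (enorm_kernel_le _)).
by rewrite lef_pV2 ?posrE ?mulr_gt0// (lt_le_trans _ (sep a b))// mulr_gt0.
Qed.

Let nz a b : x a - y b != 0.
Proof. by rewrite -enorm_gt0 (lt_le_trans _ (sep a b))// mulr_gt0. Qed.

Let mker i : measurable_fun setT (fun z : T * T => prj i (K (x z.1 - y z.2))).
Proof.
have [[mx1 _] [mx2 _]] := bx; have [[my1 _] [my2 _]] := by_.
have h1 : measurable_fun setT (fun z : T * T => (x z.1 - y z.2).1).
  apply: measurable_funB; [exact: measurable_comp_fst mx1|exact: measurable_comp_snd my1].
have h2 : measurable_fun setT (fun z : T * T => (x z.1 - y z.2).2).
  apply: measurable_funB; [exact: measurable_comp_fst mx2|exact: measurable_comp_snd my2].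
by have [k1 k2] := measurable_kernel h1 h2; case: i.
Qed.

Let kernel_int_bounded i a :
  (\int[Q]_b `|prj i (K (x (a, b).1 - y (a, b).2))|%:E <= ((2 * delta)^-1)%:E)%E.
Proof.
apply: (@le_trans _ _ (\int[Q]_b ((2 * delta)^-1)%:E)%E).
  apply: ge0_le_integral => //.
  - apply/measurable_EFinP; apply: measurableT_comp => //.
    exact: (measurableT_comp (mker i)).
  - by move=> b _; rewrite lee_fin.
by rewrite integral_cst// [X in (_ * X)%E]probability_setT mule1.
Qed.

Lemma bmeas_blob_field : bmeas2 (fun a => blob_field (x a)).
Proof.
split.
- exact: (@bmeas_section_Rintegral _ _ _ _ _ P Q _ _ (mker true) (kernel_int_bounded true)).
- exact: (@bmeas_section_Rintegral _ _ _ _ _ P Q _ _ (mker false) (kernel_int_bounded false)).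
Qed.

Lemma bmeas_kernel i a : bmeas (fun b => prj i (K (x a - y b))).
Proof.
split; last by exists (2 * delta)^-1.
rewrite (_ : (fun b => _) = (fun b => prj i (K (x (a, b).1 - y (a, b).2))))//.
exact: (measurableT_comp (mker i)).
Qed.

(** At distance at least 2 delta from the sources, [enorm_kernelB] makes the kernel Lipschitz with
    constant 1 / (2 delta)^2. *)
Lemma blob_field_lipschitz i a b :
  `|prj i (blob_field (x a)) - prj i (blob_field (x b))|
  <= enorm (x a - x b) / (4 * delta ^+ 2).
Proof.
rewrite !prj_blob_field -RintegralB//; do ?[apply: bmeas_integrable; exact: bmeas_kernel].
apply: Rintegral_norm_le.
  by apply: bmeas_integrable; apply: bmeasB; exact: bmeas_kernel.
move=> g; rewrite -prjB; apply: (le_trans (norm_prj_le _ _)).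
apply: (le_trans (enorm_kernelB (nz _ _) (nz _ _))).
rewrite (_ : x a - y g - (x b - y g) = x a - x b); last by rewrite opprB addrA subrK.
rewrite ler_wpM2l ?enorm_ge0// lef_pV2 ?posrE; last 2 first.
  - by rewrite mulr_gt0// enorm_gt0.
  - by rewrite mulr_gt0// exprn_gt0.
have := ler_pM (mulr_ge0 (ler0n _ 2) (ltW delta0)) (mulr_ge0 (ler0n _ 2) (ltW delta0)) (sep a g) (sep b g).
by apply: le_trans; rewrite le_eqVlt; apply/orP; left; apply/eqP; ring.
Qed.

(** Replaces an interaction of clouds by one of point vortices; the price is the mean distance of
    each cloud to its vortex. *)
Lemma blob_field_mean i (p q : R * R) : 2 * delta <= enorm (p - q) ->
  `|\int[P]_a prj i (blob_field (x a)) - prj i (K (p - q))| <=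
  (\int[P]_a enorm (x a - p) + \int[Q]_b enorm (y b - q)) / (4 * delta ^+ 2).
Proof.
move=> pq; have d2 : 0 < 4 * delta ^+ 2 by rewrite mulr_gt0// exprn_gt0.
have bxp : bmeas (fun a => enorm (x a - p)).
  by apply: bmeas_enorm; have [h1 h2] := bx; split; apply: bmeasB => //; exact: bmeas_cst.
have byq : bmeas (fun b => enorm (y b - q)).
  by apply: bmeas_enorm; have [h1 h2] := by_; split; apply: bmeasB => //; exact: bmeas_cst.
have bf : bmeas (fun a => prj i (blob_field (x a))) by case: bmeas_blob_field; case: i.
have nzpq : p - q != 0 by rewrite -enorm_gt0 (lt_le_trans _ pq)// mulr_gt0.
rewrite -[X in _ - X](Rintegral_prob_cst P) -RintegralB//; last 2 first.
  - exact: bmeas_integrable.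
  - by apply: bmeas_integrable; exact: bmeas_cst.
have -> : (\int[P]_a enorm (x a - p) + \int[Q]_b enorm (y b - q)) / (4 * delta ^+ 2) =
    \int[P]_a ((enorm (x a - p) + \int[Q]_b enorm (y b - q)) / (4 * delta ^+ 2)).
  rewrite RintegralZr//; last first.
    by apply: bmeas_integrable; apply: bmeasD => //; exact: bmeas_cst.
  rewrite RintegralD ?Rintegral_prob_cst//; first exact: bmeas_integrable.
  by apply: bmeas_integrable; exact: bmeas_cst.
apply: le_norm_Rintegral.
- by apply: bmeas_integrable; apply: bmeasB => //; exact: bmeas_cst.
- apply: bmeas_integrable; apply: bmeasM; last exact: bmeas_cst.
  by apply: bmeasD => //; exact: bmeas_cst.
move=> a; rewrite prj_blob_field -[X in _ - X](Rintegral_prob_cst Q) -RintegralB//; last 2 first.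
  - by apply: bmeas_integrable; exact: bmeas_kernel.
  - by apply: bmeas_integrable; exact: bmeas_cst.
have -> : (enorm (x a - p) + \int[Q]_b enorm (y b - q)) / (4 * delta ^+ 2) =
    \int[Q]_b ((enorm (x a - p) + enorm (y b - q)) / (4 * delta ^+ 2)).
  rewrite RintegralZr//; last first.
    by apply: bmeas_integrable; apply: bmeasD => //; exact: bmeas_cst.
  rewrite RintegralD ?Rintegral_prob_cst//; last exact: bmeas_integrable.
  by apply: bmeas_integrable; exact: bmeas_cst.
apply: le_norm_Rintegral.
- by apply: bmeas_integrable; apply: bmeasB; [exact: bmeas_kernel|exact: bmeas_cst].
- apply: bmeas_integrable; apply: bmeasM; last exact: bmeas_cst.
  by apply: bmeasD => //; exact: bmeas_cst.
move=> b; rewrite -prjB; apply: (le_trans (norm_prj_le _ _)).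
apply: (le_trans (enorm_kernelB (nz _ _) nzpq)); apply: ler_pM.
- exact: enorm_ge0.
- by rewrite invr_ge0 mulr_ge0 ?enorm_ge0.
- rewrite (_ : x a - y b - (p - q) = (x a - p) - (y b - q)) ?enormB//.
  by rewrite !opprB addrACA [RHS]addrACA; congr (_ + _); rewrite addrC.
- rewrite lef_pV2 ?posrE//; last by rewrite mulr_gt0// enorm_gt0.
  have := ler_pM (mulr_ge0 (ler0n _ 2) (ltW delta0)) (mulr_ge0 (ler0n _ 2) (ltW delta0)) (sep a b) pq.
  by apply: le_trans; rewrite le_eqVlt; apply/orP; left; apply/eqP; ring.
Qed.

End SeparatedBlobs.

Lemma sqr_sum_le (R : realFieldType) (M : nat) (f : 'I_M -> R) :
  (\sum_(l < M) f l) ^+ 2 <= M%:R * \sum_(l < M) f l ^+ 2.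
Proof.
rewrite expr2 mulr_suml.
apply: (@le_trans _ _ (\sum_(l < M) \sum_(k < M) ((f l ^+ 2 + f k ^+ 2) / 2))).
  apply: ler_sum => l _; rewrite mulr_sumr; apply: ler_sum => k _.
  by have := sqr_ge0 (f l - f k); nra.
rewrite le_eqVlt; apply/orP; left; apply/eqP.
have -> : \sum_(l < M) \sum_(k < M) ((f l ^+ 2 + f k ^+ 2) / 2) =
    (\sum_(l < M) \sum_(k < M) f l ^+ 2 + \sum_(l < M) \sum_(k < M) f k ^+ 2) / 2.
  rewrite -big_split mulr_suml; apply: eq_bigr => l _ /=.
  by rewrite -big_split mulr_suml; apply: eq_bigr.
under eq_bigr do rewrite sumr_const card_ord -[_ *+ M]mulr_natl.
by rewrite -mulr_sumr sumr_const card_ord -[_ *+ M]mulr_natl; field.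
Qed.

(** * All blobs together: bootstrap on the separation *)

Section MultiVortex.
Context d (T : measurableType d) (R : realType) (M : nat).
Variables (P : 'I_M -> probability T R) (gam Gam : 'I_M -> R).
Variables (c delta tmax theta kap a' A V : R) (m0 : nat).
Variables (x v e : 'I_M -> R -> T -> R * R) (p pv : 'I_M -> R -> R * R).
Local Notation K := biot_savart_kernel.
Hypotheses (c0 : 0 <= c) (delta0 : 0 < delta) (tm0 : 0 <= tmax) (th0 : 0 < theta).
Hypotheses (a'0 : 0 <= a') (a'12 : a' <= 2^-1).
Hypothesis hm : 1 + kap <= theta * m0.+3%:R * (1 - 2 * a').
Hypotheses (A0 : 0 < A) (A1 : A <= 1).
Hypotheses (Gc : forall m, `|Gam m| <= c) (Gg : forall m, `|Gam m - gam m| <= c * Num.sqrt A).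
Hypothesis dx : forall m (t : R) a, is_derive t 1 (fun s => (x m s a).1) (v m t a).1 /\
                                    is_derive t 1 (fun s => (x m s a).2) (v m t a).2.
Hypothesis dp : forall m (t : R), is_derive t 1 (fun s => (p m s).1) (pv m t).1 /\
                                  is_derive t 1 (fun s => (p m s).2) (pv m t).2.
Hypotheses (bx : forall m t, bmeas2 (x m t)) (bv : forall m t, bmeas2 (v m t)).
Hypotheses (vV : forall m t a, enorm (v m t a) <= V) (pV : forall m t, enorm (pv m t) <= V).
Hypothesis be : forall m t, 0 <= t <= tmax -> bmeas2 (e m t).
Hypothesis ec : forall m t, 0 <= t <= tmax -> forall a, enorm (e m t a) <= c * A.
Hypothesis vE : forall m t, 0 <= t <= tmax -> forall a, v m t a =
  (\sum_(l < M) Gam l * (blob_field (P l) (x l t) (x m t a)).1 + (e m t a).1,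
   \sum_(l < M) Gam l * (blob_field (P l) (x l t) (x m t a)).2 + (e m t a).2).
Hypothesis pvE : forall m t, 0 <= t <= tmax -> pv m t =
  (\sum_(l < M | l != m) gam l * (K (p m t - p l t)).1,
   \sum_(l < M | l != m) gam l * (K (p m t - p l t)).2).
Hypothesis psep : forall m l t, 0 <= t <= tmax -> l != m -> 4 * delta <= enorm (p m t - p l t).
Hypothesis sing : forall m t, 0 <= t <= tmax -> forall a S, measurable S ->
     (\int[P m]_(b in S) (enorm (x m t a - x m t b))^-1%:E <=
        (c * fine (P m S) `^ theta * A `^ (- kap))%:E)%E.
Hypothesis init : forall m a, enorm (x m 0 a - p m 0) <= A.

Definition external_field m t a : R * R :=
  (\sum_(l < M | l != m) Gam l * (blob_field (P l) (x l t) (x m t a)).1,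
   \sum_(l < M | l != m) Gam l * (blob_field (P l) (x l t) (x m t a)).2).
Local Notation F := external_field.

(** Two coordinates, each with at most [M] fields of constant c / (4 delta^2). *)
Definition lip_const : R := M%:R * c / (2 * delta ^+ 2).
Local Notation L := lip_const.

Let L0 : 0 <= L.
Proof. by rewrite divr_ge0 ?mulr_ge0 ?exprn_ge0// ltW. Qed.

Let prjF i m t a : prj i (F m t a) =
  \sum_(l < M | l != m) Gam l * prj i (blob_field (P l) (x l t) (x m t a)).
Proof. by case: i. Qed.

Section bootstrap.
Variable t1 : R.
Hypothesis t1m : t1 <= tmax.
Hypothesis boot : forall t, 0 <= t <= t1 -> forall m a, enorm (x m t a - p m t) <= delta.

Let tT t : 0 <= t <= t1 -> 0 <= t <= tmax.
Proof. by move=> /andP[-> /le_trans ->]. Qed.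

(** The vortices are 4 delta apart and each blob stays within delta of its own. *)
Let sep t : 0 <= t <= t1 -> forall m l, l != m -> forall a b,
  2 * delta <= enorm (x m t a - x l t b).
Proof.
move=> ht m l lm a b; have := psep (tT ht) lm; have := boot ht m a; have := boot ht l b.
have -> : p m t - p l t = (x m t a - x l t b) - (x m t a - p m t) + (x l t b - p l t).
  move: (p m t) (p l t) (x m t a) (x l t b) => [p1 p2] [q1 q2] [u1 u2] [w1 w2].
    by congr (_, _) => /=; ring.
move=> h1 h2 /le_trans h3; have := h3 _ (enormD _ _) => h4.
have := enormB (x m t a - x l t b) (x m t a - p m t); lra.
Qed.

Lemma bmeas_external_field m t : 0 <= t <= t1 -> bmeas2 (F m t).
Proof.
move=> ht.
have h i : bmeas (fun a => prj i (F m t a)).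
  have bl l : bmeas (fun a => if l != m then
      Gam l * prj i (blob_field (P l) (x l t) (x m t a)) else 0).
    have [lm|lm] := boolP (l != m); last exact: bmeas_cst.
    apply: bmeasM; first exact: bmeas_cst.
    by case: (bmeas_blob_field (P m) (P l) (bx m t) (bx l t) delta0 (sep ht lm)); case: (i).
  by under eq_fun do rewrite prjF big_mkcond; exact: (bmeas_sum _ bl).
by split; [exact: (h true)|exact: (h false)].
Qed.

Lemma external_field_lipschitz m t a b : 0 <= t <= t1 ->
  enorm (F m t a - F m t b) <= L * enorm (x m t a - x m t b).
Proof.
move=> ht; have d2 : 0 < 4 * delta ^+ 2 by rewrite mulr_gt0// exprn_gt0.
have h i : `|prj i (F m t a - F m t b)| <= M%:R * c * (enorm (x m t a - x m t b) / (4 * delta ^+ 2)).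
  rewrite prjB !prjF -sumrB; apply: (le_trans (ler_norm_sum _ _ _)).
  rewrite -mulrA mulr_natl -[X in _ *+ X]card_ord -sumr_const big_mkcond /=.
  apply: ler_sum => l _; case: ifPn => lm; last first.
    by rewrite mulr_ge0// divr_ge0 ?enorm_ge0// ltW.
  rewrite -mulrBr normrM ler_pM//.
  exact: (blob_field_lipschitz (P l) (bx m t) (bx l t) delta0 (sep ht lm)).
apply: (le_trans (enorm_le_normD _)); apply: (le_trans (lerD (h true) (h false))).
rewrite /L le_eqVlt; apply/orP; left; apply/eqP.
by field; rewrite gt_eqF.
Qed.

(** The initial radius around the mean is 3 A: A for the distance to the vortex and 2 A, one for
    each coordinate, for that of the mean. *)
Let c' := c + 3.

Let c'0 : 0 <= c'. Proof. by rewrite addr_ge0. Qed.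

Let B m t := expectation2 (P m) (x m t).

Lemma center_init m : enorm (B m 0 - p m 0) <= 2 * A.
Proof.
have h i : `|prj i (B m 0 - p m 0)| <= A.
  have b0 : bmeas (fun a => prj i (x m 0 a)) by have [] := bx m 0; case: i.
  rewrite prjB -[X in _ - X](Rintegral_prob_cst (P m)).
  have -> : prj i (B m 0) = \int[P m]_a prj i (x m 0 a) by case: (i).
  rewrite -RintegralB//; do ?[apply: bmeas_integrable => //; exact: bmeas_cst].
  apply: Rintegral_norm_le; first by apply: bmeas_integrable; apply: bmeasB => //; exact: bmeas_cst.
  by move=> a; rewrite -prjB; exact: le_trans (norm_prj_le _ _) (init m a).
by apply: (le_trans (enorm_le_normD _)); have := h true; have := h false; rewrite /prj; lra.
Qed.

Lemma centered_init m a : enorm (centered (P m) (x m 0) a) <= c' * A.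
Proof.
apply: (le_trans (enorm_trans (p m 0) _ _)); rewrite [enorm (p m 0 - _)]enormBC.
have h1 := init m a; have h2 := center_init m; have h3 : 0 <= c * A by rewrite mulr_ge0 ?(ltW A0).
rewrite /c'; rewrite /B in h2; lra.
Qed.

Lemma blob_drive m t : 0 <= t <= t1 -> [/\ bmeas2 (F m t), bmeas2 (e m t),
     forall a, v m t a = (Gam m * (self_velocity (P m) (x m t) a).1 + (F m t a).1 + (e m t a).1,
                        Gam m * (self_velocity (P m) (x m t) a).2 + (F m t a).2 + (e m t a).2),
     forall a b, enorm (F m t a - F m t b) <= L * enorm (x m t a - x m t b)
     & forall a, enorm (e m t a) <= c' * A].
Proof.
move=> ht; split.
- exact: bmeas_external_field.
- exact: be (tT ht).
- by move=> a; rewrite (vE m (tT ht)) (bigD1 m)//= [in X in (_, X)](bigD1 m).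
- by move=> a b; exact: external_field_lipschitz.
- by move=> a; apply: (le_trans (ec m (tT ht) a)); rewrite ler_wpM2r ?lerDl// ltW.
Qed.

Let sing' m t : 0 <= t <= t1 -> forall a S, measurable S ->
     (\int[P m]_(b in S) (enorm (x m t a - x m t b))^-1%:E <=
        (c' * fine (P m S) `^ theta * A `^ (- kap))%:E)%E.
Proof.
move=> ht a S mS; apply: (le_trans (sing m (tT ht) a mS)).
by rewrite lee_fin -!mulrA ler_wpM2r ?mulr_ge0 ?powR_ge0// lerDl.
Qed.

Let Gc' m : `|Gam m| <= c'. Proof. by rewrite (le_trans (Gc m))// lerDl. Qed.

Local Notation c1 := (energy_const c' L tmax).
Local Notation C7 := (particle_const c' L tmax theta m0).

Lemma blob_particle m t a : 0 <= t <= t1 ->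
  sqn (centered (P m) (x m t) a) <= C7 * A `^ (2 * a').
Proof.
exact: (particle_confined c'0 L0 tm0 th0 A0 A1 t1m (Gc' m) (@dx m) (bx m) (bv m) (@vV m)
  (@blob_drive m) (@sing' m) (centered_init m) a'0 a'12 hm).
Qed.

Lemma blob_mean_radius m t : 0 <= t <= t1 ->
  \int[P m]_a enorm (centered (P m) (x m t) a) <= c1 * A.
Proof.
exact: (mean_radius_confined c'0 L0 tm0 A0 t1m (Gc' m) (@dx m) (bx m) (bv m) (@vV m)
  (@blob_drive m) (@sing' m) (centered_init m)).
Qed.

(** In order: displacement of the two clouds, error in the circulation times the kernel at distance
    4 delta, and the perturbation [e]. *)
Definition center_rate_const : R :=
  M%:R * c * ((2 * c1 + 2) / (4 * delta ^+ 2) + (4 * delta)^-1) + c.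
Local Notation c9 := center_rate_const.

Let dist m t := enorm (B m t - p m t).

(** The blob's own field has mean zero. The field of every other blob differs from that of its
    vortex by the mean radius O(A), the distances of the centers, and the circulation error, which
    is the source of the square root of A. *)
Lemma center_rate i m t : 0 <= t <= t1 ->
  `|prj i (expectation2 (P m) (v m t) - pv m t)| <=
  c9 * (Num.sqrt A + \sum_(l < M) dist l t).
Proof.
move=> ht; have [bF be' vE' FL eE] := blob_drive m ht.
have d2 : 0 < 4 * delta ^+ 2 by rewrite mulr_gt0// exprn_gt0.
have sA0 : 0 <= Num.sqrt A := sqrtr_ge0 A.
have A0' := ltW A0.
have sAA : A <= Num.sqrt A.
  rewrite -[X in X <= _](sqr_sqrtr A0') expr2 -[leRHS]mulr1 ler_wpM2l//.
  by rewrite -sqrtr1 ler_sqrt.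
set S := \sum_(l < M) dist l t.
have dist0 l : 0 <= dist l t := enorm_ge0 _.
have S0 : 0 <= S by apply: sumr_ge0.
have distS l : dist l t <= S by rewrite /S (bigD1 l)//= lerDl sumr_ge0.
have c10 : 0 <= c1 by rewrite /energy_const !mulr_ge0// expR_ge0.
have near l : \int[P l]_a enorm (x l t a - p l t) <= c1 * A + S.
  have bxi := bmeas_enorm (bmeas_centered (P l) (bx l t)).
  have bxp : bmeas (fun a => enorm (x l t a - p l t)).
    by apply: bmeas_enorm; have [h1 h2] := bx l t; split; apply: bmeasB => //; exact: bmeas_cst.
  apply: (@le_trans _ _ (\int[P l]_a (enorm (centered (P l) (x l t) a) + dist l t))).
    apply: le_Rintegral => //.
    - exact: bmeas_integrable.
    - by apply: bmeas_integrable; apply: bmeasD => //; exact: bmeas_cst.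
    - by move=> a _; exact: enorm_trans.
  rewrite RintegralD//; last 2 first.
    - exact: bmeas_integrable.
    - by apply: bmeas_integrable; exact: bmeas_cst.
  by rewrite Rintegral_prob_cst lerD// blob_mean_radius.
have bf l (lm : l != m) : bmeas (fun a => prj i (blob_field (P l) (x l t) (x m t a))).
  by case: (bmeas_blob_field (P m) (P l) (bx m t) (bx l t) delta0 (sep ht lm)); case: i.
have EF : prj i (expectation2 (P m) (v m t)) =
    \sum_(l < M | l != m) Gam l * \int[P m]_a prj i (blob_field (P l) (x l t) (x m t a))
    + \int[P m]_a prj i (e m t a).
  rewrite (expectation2_velocity (bx m t) (fun a => @sing' m t ht a _ measurableT) bF be' vE').
  have -> : prj i (\int[P m]_a (F m t a).1 + \int[P m]_a (e m t a).1,
      \int[P m]_a (F m t a).2 + \int[P m]_a (e m t a).2) =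
    \int[P m]_a prj i (F m t a) + \int[P m]_a prj i (e m t a) by case: (i).
  congr (_ + _); under eq_Rintegral do rewrite prjF big_mkcond.
  rewrite Rintegral_sum; last first.
    move=> l; have [lm|lm] := boolP (l != m); apply: bmeas_integrable; last exact: bmeas_cst.
    by apply: bmeasM; [exact: bmeas_cst|exact: bf].
  rewrite [RHS]big_mkcond; apply: eq_bigr => l _; case: ifPn => lm; last exact: Rintegral_prob_cst.
  by rewrite RintegralZl//; apply: bmeas_integrable; exact: bf.
(* The error in position is weighted with the true circulation, the error in circulation with the
   exact vortex kernel. *)
have -> : prj i (expectation2 (P m) (v m t) - pv m t) =
   \sum_(l < M | l != m) (Gam l * (\int[P m]_a prj i (blob_field (P l) (x l t) (x m t a))
        - prj i (K (p m t - p l t))) + (Gam l - gam l) * prj i (K (p m t - p l t)))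
   + \int[P m]_a prj i (e m t a).
  rewrite prjB EF (pvE m (tT ht)).
  have -> : prj i (\sum_(l < M | l != m) gam l * (K (p m t - p l t)).1,
      \sum_(l < M | l != m) gam l * (K (p m t - p l t)).2) =
    \sum_(l < M | l != m) gam l * prj i (K (p m t - p l t)) by case: (i).
  rewrite addrAC -sumrB; congr (_ + _); apply: eq_bigr => l _; ring.
apply: (le_trans (ler_normD _ _)).
have he : `|\int[P m]_a prj i (e m t a)| <= c * A.
  apply: Rintegral_norm_le; first by apply: bmeas_integrable; case: be'; case: (i).
  by move=> a; exact: le_trans (norm_prj_le _ _) (ec m (tT ht) a).
have term l : l != m -> `|Gam l * (\int[P m]_a prj i (blob_field (P l) (x l t) (x m t a))
        - prj i (K (p m t - p l t))) + (Gam l - gam l) * prj i (K (p m t - p l t))| <=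
    c * ((2 * c1 + 2) / (4 * delta ^+ 2) + (4 * delta)^-1) * (Num.sqrt A + S).
  move=> lm; have pl := psep (tT ht) lm.
  have d4 : 0 < 4 * delta by rewrite mulr_gt0.
  apply: (le_trans (ler_normD _ _)); rewrite [X in _ <= X * _]mulrDr [leRHS]mulrDl; apply: lerD.
    rewrite normrM -[leRHS]mulrA; apply: ler_pM => //.
    have pl' : 2 * delta <= enorm (p m t - p l t) by apply: le_trans pl; lra.
    apply: (le_trans (blob_field_mean (P m) (P l) (bx m t) (bx l t) delta0 (sep ht lm) i pl')).
    rewrite [leRHS]mulrAC ler_wpM2r ?invr_ge0 ?(ltW d2)//.
    apply: (le_trans (lerD (near m) (near l))).
    have : c1 * A <= c1 * Num.sqrt A by rewrite ler_wpM2l.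
    have : 0 <= c1 * S by rewrite mulr_ge0.
    have -> : (2 * c1 + 2) * (Num.sqrt A + S) =
      2 * (c1 * Num.sqrt A) + 2 * Num.sqrt A + 2 * (c1 * S) + 2 * S by ring.
    lra.
  rewrite normrM [leRHS]mulrAC.
  apply: (@le_trans _ _ (c * Num.sqrt A * (4 * delta)^-1)).
    apply: ler_pM => //; apply: (le_trans (norm_prj_le _ _)); apply: (le_trans (enorm_kernel_le _)).
    by rewrite lef_pV2 ?posrE// (lt_le_trans d4).
  by rewrite ler_wpM2r ?invr_ge0 ?(ltW d4)// ler_wpM2l// lerDl.
rewrite /c9 mulrDl; apply: lerD; last first.
  by apply: (le_trans he); rewrite ler_wpM2l// (le_trans sAA)// lerDl.
apply: (le_trans (ler_norm_sum _ _ _)).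
rewrite -!mulrA mulr_natl -[X in _ *+ X]card_ord -sumr_const big_mkcond /=.
apply: ler_sum => l _; case: ifPn => lm; first by rewrite mulrA term.
by rewrite !mulr_ge0 ?addr_ge0 ?divr_ge0 ?mulr_ge0 ?addr_ge0 ?mulr_ge0 ?invr_ge0 ?mulr_ge0 ?(ltW delta0) ?exprn_ge0 ?(ltW delta0).
Qed.

Let c9_ge0 : 0 <= c9.
Proof.
have c10 : 0 <= c1 by rewrite /energy_const !mulr_ge0// expR_ge0.
have dd := ltW delta0.
by rewrite /center_rate_const; nneg.
Qed.

(** With S the sum of the distances and D that of their squares, the derivative of D is at most 4 c9
    (A^(1/2) S + S^2), and S^2 <= M D. *)
Definition center_growth_const : R := 8 * c9 * M%:R + 4 * c9.
Definition center_const : R := (4 * M%:R + 1) * expR (center_growth_const * tmax).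

Let center_growth_ge0 : 0 <= center_growth_const.
Proof. by have h := c9_ge0; rewrite /center_growth_const; nneg. Qed.

(** Gronwall for the sum of squared distances, which stays differentiable when a center passes
    through its vortex. Initially it is at most M (2 A)^2 <= 4 M A. *)
Lemma center_confined m t : 0 <= t <= t1 ->
  sqn (B m t - p m t) <= center_const * A.
Proof.
move=> ht.
pose D s := \sum_(l < M) sqn (B l s - p l s).
pose dD s := \sum_(l < M) (2 * dotp (B l s - p l s) (expectation2 (P l) (v l s) - pv l s)).
have A0' := ltW A0.
have dDP (s : R) : is_derive s 1 D (dD s).
  have -> : D = \sum_(l < M) (fun s => sqn (B l s - p l s)) by apply/funext => u; rewrite fct_sumE.
  apply: is_derive_sum => l.
  have [e1 e2] := derive_expectation2 (P l) (@dx l) (bx l) (@vV l) s.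
  have [q1 q2] := dp l s.
  have h1 := @is_deriveB R R R _ _ s 1 _ _ e1 q1.
  have h2 := @is_deriveB R R R _ _ s 1 _ _ e2 q2.
  exact: (@is_derive_sqn _ (fun s => B l s - p l s) s (expectation2 (P l) (v l s) - pv l s) h1 h2).
have D0 l s : sqn (B l s - p l s) <= D s.
  by rewrite /D (bigD1 l)//= lerDl sumr_ge0// => k _; exact: sqn_ge0.
have rate s : 0 < s < t1 -> dD s <= center_growth_const * (D s + A).
  move=> /andP[s0 st]; have hs : 0 <= s <= t1 by rewrite !ltW.
  set S := \sum_(l < M) dist l s; set sA := Num.sqrt A.
  have SD : S ^+ 2 <= M%:R * D s.
    apply: (le_trans (sqr_sum_le _)); rewrite ler_wpM2l// ler_sum// => l _.
    by rewrite /dist enorm_sqr.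
  have S0 : 0 <= S by apply: sumr_ge0 => l _; exact: enorm_ge0.
  have sA0 : 0 <= sA := sqrtr_ge0 _.
  have sA2 : sA ^+ 2 = A by rewrite sqr_sqrtr.
  have c90 := c9_ge0.
  apply: (@le_trans _ _ (\sum_(l < M) (4 * c9 * (sA + S) * dist l s))).
    apply: ler_sum => l _; apply: (@le_trans _ _ (2 * (dist l s * (2 * c9 * (sA + S))))).
      rewrite ler_wpM2l//; apply: (le_trans (ler_norm _)); apply: (le_trans (dotp_le _ _)).
      rewrite ler_wpM2l ?enorm_ge0//; apply: (le_trans (enorm_le_normD _)).
      have := center_rate true l hs; have := center_rate false l hs; rewrite /prj -/S -/sA; lra.
    by rewrite le_eqVlt; apply/orP; left; apply/eqP; ring.
  rewrite -mulr_sumr -/S.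
  have -> : center_growth_const * (D s + A) =
     4 * c9 * (2 * (M%:R * D s) + A + 2 * M%:R * A + D s) by rewrite /center_growth_const; ring.
  rewrite -[leLHS]mulrA ler_wpM2l ?mulr_ge0//.
  have MA : 0 <= M%:R * A by rewrite mulr_ge0.
  have Ds : 0 <= D s by apply: sumr_ge0 => l _; exact: sqn_ge0.
  have := sqr_ge0 (sA - S); rewrite -sA2; rewrite -sA2 in MA; nra.
have G := gronwall dDP rate ht.
apply: (@le_trans _ _ (D t + A)); first by apply: (le_trans (D0 m t)); rewrite lerDl.
apply: (le_trans G); rewrite /center_const [leRHS]mulrAC; apply: ler_pM.
- by rewrite addr_ge0// sumr_ge0// => l _; exact: sqn_ge0.
- exact: expR_ge0.
- rewrite mulrDl mul1r lerD2r.
  apply: (@le_trans _ _ (\sum_(l < M) 4 * A)); last first.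
    by rewrite sumr_const card_ord -[_ *+ M]mulr_natl mulrA [M%:R * 4]mulrC.
  apply: ler_sum => l _; rewrite -enorm_sqr.
  apply: (@le_trans _ _ ((2 * A) ^+ 2)).
    by rewrite lerXn2r ?nnegrE ?enorm_ge0 ?mulr_ge0// center_init.
  by have AA1 := A1; rewrite exprMn -natrX ler_wpM2l// expr2 -[leRHS]mulr1 ler_wpM2l.
- rewrite ler_expR ler_wpM2l//; case/andP: ht => _ /le_trans; exact.
Qed.

Let C7_ge1 : 1 <= C7.
Proof.
have C60 : 0 <= particle_rate_const c' L tmax theta m0.
  have c10 : 0 <= c1 by rewrite /energy_const !mulr_ge0// expR_ge0.
  have t0 : 0 <= tail_const c' L tmax theta m0 by rewrite mulr_ge0 ?powR_ge0.
  have l0 := L0; rewrite /particle_rate_const; nneg.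
rewrite /particle_const -[leLHS]mulr1; apply: ler_pM => //; first by rewrite lerDr sqr_ge0.
by rewrite -expR0 ler_expR mulr_ge0.
Qed.

Let cc_ge1 : 1 <= center_const.
Proof.
rewrite /center_const -[leLHS]mulr1; apply: ler_pM => //; first by rewrite lerDr mulr_ge0.
by rewrite -expR0 ler_expR mulr_ge0.
Qed.

Definition vortex_const : R := C7 + center_const.

Lemma vortex_const_gt0 : 0 < vortex_const.
Proof. by rewrite addr_gt0// (lt_le_trans ltr01). Qed.

Lemma vortex_confined m t a : 0 <= t <= t1 ->
  enorm (x m t a - p m t) <= vortex_const * A `^ a'.
Proof.
move=> ht; apply: (le_trans (enorm_trans (B m t) _ _)).
have A0' := ltW A0.
have E : A `^ (2 * a') = A `^ a' ^+ 2 by rewrite mulrC powRrM powR_mulrn ?powR_ge0.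
(* For k >= 1 the square root of [k] is at most [k], which avoids roots in the constants. *)
have bnd z k : 1 <= k -> sqn z <= k * A `^ (2 * a') -> enorm z <= k * A `^ a'.
  move=> k1 h; have k0 := le_trans ler01 k1.
  rewrite -ler_sqr ?nnegrE ?enorm_ge0 ?mulr_ge0 ?powR_ge0//.
  rewrite enorm_sqr exprMn -E; apply: (le_trans h).
  by rewrite ler_wpM2r ?powR_ge0// expr2 -[leLHS]mulr1 ler_wpM2l.
rewrite mulrDl; apply: lerD; first by apply: bnd => //; exact: blob_particle.
apply: bnd => //; apply: (le_trans (center_confined m ht)).
rewrite ler_wpM2l ?(le_trans ler01)// -[leLHS]powRr1//.
apply: ger_powR; first by rewrite A0.
by have h := a'12; lra.
Qed.

End bootstrap.

Hypothesis small : vortex_const * A `^ a' <= delta / 2.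
Hypothesis Adelta : A <= delta.

(** A continuity argument in discrete form: confinement improves the distance from delta to delta /
    2, and over a time step of fixed length no distance grows by more than delta / 2. *)
Lemma vortex_confined_global m t a : 0 <= t <= tmax ->
  enorm (x m t a - p m t) <= vortex_const * A `^ a'.
Proof.
have V0 : 0 <= V by exact: le_trans (enorm_ge0 _) (pV m 0).
have d0 := delta0; have sm := small; have tm := tm0.
(* The 1 keeps the denominator positive when [V] is zero. *)
pose h := delta / (8 * V + 1).
have V1 : 0 < 8 * V + 1 by rewrite ltr_wpDl// mulr_ge0.
have h0 : 0 < h by rewrite divr_gt0.
have Vh : 4 * V * h <= delta / 2.
  have -> : 4 * V * h = delta / 2 * (8 * V / (8 * V + 1)) by rewrite /h; field; rewrite gt_eqF.
  rewrite -[leRHS]mulr1 ler_wpM2l ?divr_ge0 ?ltW//.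
  by rewrite ltr_pdivrMr// mul1r ltrDl.
(* Two coordinates for the particle and two for the vortex make 4 V. *)
have lip l b s u : enorm (x l s b - p l s) <= enorm (x l u b - p l u) + 4 * V * `|s - u|.
  have k1 (f df : R -> R) : (forall t : R, is_derive t 1 f (df t)) -> (forall t, `|df t| <= V) ->
      `|f s - f u| <= V * `|s - u| by exact: lipschitz_of_derive.
  have hx : enorm (x l s b - x l u b) <= 2 * V * `|s - u|.
    apply: (le_trans (enorm_le_normD _)) => /=.
    have -> : 2 * V * `|s - u| = V * `|s - u| + V * `|s - u| by ring.
    apply: lerD.
      apply: (k1 (fun t => (x l t b).1) (fun t => (v l t b).1)) => r; first by case: (dx l r b).
      exact: le_trans (norm1_le_enorm _) (vV l r b).
    apply: (k1 (fun t => (x l t b).2) (fun t => (v l t b).2)) => r; first by case: (dx l r b).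
    exact: le_trans (norm2_le_enorm _) (vV l r b).
  have hp : enorm (p l u - p l s) <= 2 * V * `|s - u|.
    rewrite enormBC; apply: (le_trans (enorm_le_normD _)) => /=.
    have -> : 2 * V * `|s - u| = V * `|s - u| + V * `|s - u| by ring.
    apply: lerD.
      apply: (k1 (fun t => (p l t).1) (fun t => (pv l t).1)) => r; first by case: (dp l r).
      exact: le_trans (norm1_le_enorm _) (pV l r).
    apply: (k1 (fun t => (p l t).2) (fun t => (pv l t).2)) => r; first by case: (dp l r).
    exact: le_trans (norm2_le_enorm _) (pV l r).
  apply: (le_trans (enorm_trans (x l u b) _ _)).
  have := enorm_trans (p l u) (x l u b) (p l s); lra.
have boot n : forall s, 0 <= s <= tmax -> s <= n%:R * h -> forall l b, enorm (x l s b - p l s) <= delta.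
  elim: n => [|n IH] s /andP[s0 sT] sn l b.
    have -> : s = 0 by apply/eqP; rewrite eq_le s0 andbT; rewrite mul0r in sn.
    exact: le_trans (init l b) Adelta.
  have [sh|hs] := leP s (n%:R * h); first by apply: IH => //; rewrite s0.
  pose u := n%:R * h.
  have u0 : 0 <= u by rewrite mulr_ge0// ltW.
  have uT : u <= tmax by rewrite (le_trans _ sT)// ltW.
  have C : enorm (x l u b - p l u) <= vortex_const * A `^ a'.
    apply: (@vortex_confined u uT) => // [r /andP[r0 ru] k g|]; last by rewrite u0 lexx.
    by apply: IH => //; rewrite r0 (le_trans ru).
  apply: (le_trans (lip l b s u)).
  have : 4 * V * `|s - u| <= 4 * V * h.
    rewrite ler_wpM2l ?mulr_ge0// ger0_norm; last by rewrite subr_ge0 ltW.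
    rewrite lerBlDr /u.
    by rewrite -[X in X + _]mul1r -mulrDl nat1r.
  lra.
move=> ht; apply: (@vortex_confined tmax (lexx _)) => // s hs l b.
apply: (boot (Num.bound (tmax / h))) => //.
have th0' : 0 <= tmax / h by rewrite divr_ge0// ltW.
case/andP: hs => _ /le_trans; apply; rewrite -ler_pdivrMr//.
exact: ltW (archi_boundP th0').
Qed.

End MultiVortex.

(** * Singular integrals *)

Section SingularIntegrals.
Context d (T : measurableType d) (R : realType) (mu : {measure set T -> \bar R}).
Variable phi : T -> R.
Hypotheses (mphi : measurable_fun setT phi) (phi0 : forall x, 0 <= phi x).
Hypothesis tail : forall r : R, 0 < r -> (mu [set x | (phi x < r)%R] <= (4 * r ^+ 2)%:E)%E.

Lemma dyadic_bracket (h r : R) : 0 < r -> r < h ->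
  exists k : nat, h / 2 ^+ k.+1 <= r < h / 2 ^+ k.
Proof.
move=> r0 rh; have h0 := lt_trans r0 rh.
have ex : exists n : nat, h / 2 ^+ n <= r.
  exists (Num.bound (h / r)); rewrite ler_pdivrMr ?exprn_gt0// -ler_pdivrMl//.
  have hr : 0 <= h / r by rewrite divr_ge0 ?ltW.
  rewrite mulrC; apply: (le_trans (ltW (archi_boundP hr))).
  by rewrite -natrX ler_nat ltnW// ltn_expl.
case: (ex_minnP ex) => -[|n] hn hmin.
  by move: hn; rewrite expr0 divr1 leNgt rh.
exists n; rewrite hn /= ltNge; apply/negP => hn'.
by have := hmin n hn'; rewrite ltnn.
Qed.

Lemma nneseries_geometric (C z : R) : 0 <= C -> 0 <= z < 1 ->
  (\sum_(0 <= j <oo) (C * z ^+ j)%:E = (C / (1 - z))%:E)%E.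
Proof.
move=> C0 /andP[z0 z1]; apply/cvg_lim => //.
rewrite (_ : (fun n => _) = EFin \o series (geometric C z)); last first.
  by apply/funext => n; rewrite /= /series /= sumEFin.
by apply: cvg_EFin; [exact: nearW|apply: cvg_geometric_series; rewrite ger0_norm].
Qed.

(* Zero where phi = 0, since 0 `^ (- s) = 0. *)
Definition near_power (s h : R) (x : T) : R := if phi x < h then (phi x) `^ (- s) else 0.
(** Sum of the geometric series of ratio 2^(s - 2): at scale h / 2^j the integrand is at most (2^(j
    + 1) / h)^s on a set of measure at most 4 (h / 2^j)^2. *)
Definition near_power_const (s : R) : R := 4 * 2 `^ s / (1 - 2 `^ (s - 2)).

Lemma measurable_near_power s h : measurable_fun setT (near_power s h).
Proof.
apply: measurable_fun_ifT => //.
- by apply: measurable_fun_ltr.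
- apply: (@measurableT_comp _ _ _ _ _ _ (fun x : R => x `^ (- s))) => //.
Qed.

Lemma two_powR_lt1 (s : R) : s < 2 -> 2 `^ (s - 2) < 1 :> R.
Proof.
move=> s2; rewrite -opprB powRN invf_lt1 ?powR_gt0//.
rewrite -[ltLHS](_ : 1 `^ (2 - s) = 1); last by rewrite powR1.
by rewrite gt0_ltr_powR ?subr_gt0 ?nnegrE ?ltr1n.
Qed.

Lemma near_power_const_ge0 s : s < 2 -> 0 <= near_power_const s.
Proof.
move=> s2; rewrite mulr_ge0 ?mulr_ge0 ?powR_ge0// invr_ge0 subr_ge0 ltW//.
exact: two_powR_lt1.
Qed.

(** Dyadic decomposition. All that is known of [phi] is the measure of its sublevel sets, so the
    same estimate serves distances to particles moved by any measure preserving map; s < 2 is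
    integrability in the plane. *)
Lemma near_power_integral s h : 0 < s -> s < 2 -> 0 < h ->
  (\int[mu]_x (near_power s h x)%:E <= (near_power_const s * h `^ (2 - s))%:E)%E.
Proof.
move=> s0 s2 h0.
pose E j := [set x | phi x < h / 2 ^+ j].
have mE j : measurable (E j) by exact: measurable_set_lt.
have hj j : 0 < h / 2 ^+ j by rewrite divr_gt0// exprn_gt0.
pose u (j : nat) x := ((2 ^+ j.+1 / h) `^ s * \1_(E j) x)%:E.
have u0 j x : (0 <= u j x)%E by rewrite lee_fin mulr_ge0 ?powR_ge0.
have mu_ j : measurable_fun setT (u j).
  by apply/measurable_EFinP; apply: measurable_funM => //; exact: measurable_indic.
have pw x : ((near_power s h x)%:E <= \sum_(0 <= j <oo) u j x)%E.
  have S0 : (0 <= \sum_(0 <= j <oo) u j x)%E by apply: nneseries_ge0 => j _ _.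
  rewrite /near_power; case: ifPn => xh //.
  have [->|px] := eqVneq (phi x) 0; first by rewrite powR0// oppr_eq0 gt_eqF.
  have px0 : 0 < phi x by rewrite lt0r px phi0.
  have [k /andP[k1 k2]] := dyadic_bracket px0 xh.
  apply: (@le_trans _ _ (u k x)); last first.
    apply: (@le_trans _ _ (\sum_(0 <= j < k.+1) u j x)%E); last exact: nneseries_lim_ge.
    by rewrite big_nat_recr//= leeDr// sume_ge0.
  rewrite lee_fin indicE mem_set//= mulr1 powRN.
  rewrite -powR_inv1 ?powR_ge0// -powRrM mulrN1 -mulN1r powRrM powR_inv1 ?(ltW px0)//.
  apply: ge0_ler_powR; rewrite ?nnegrE ?(ltW s0) ?invr_ge0 ?(ltW px0)//.
    by rewrite divr_ge0 ?exprn_ge0// ltW.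
  rewrite -[leRHS]invrK lef_pV2 ?posrE// ?invr_gt0 ?divr_gt0 ?exprn_gt0//.
  by rewrite invf_div.
apply: (@le_trans _ _ (\int[mu]_x \sum_(0 <= j <oo) u j x)%E).
  apply: ge0_le_integral => //.
  - by move=> x _; rewrite lee_fin /near_power; case: ifP => // _; exact: powR_ge0.
  - by apply/measurable_EFinP; exact: measurable_near_power.
  - exact: ge0_emeasurable_sum.
rewrite integral_nneseries//.
pose C := 4 * 2 `^ s * h `^ (2 - s); pose z : R := 2 `^ (s - 2).
have z0 : 0 <= z by exact: powR_ge0.
have z1 : z < 1 by exact: two_powR_lt1.
have C0 : 0 <= C by rewrite !mulr_ge0 ?powR_ge0.
have -> : near_power_const s * h `^ (2 - s) = C / (1 - z).
  by rewrite /near_power_const /C /z mulrAC.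
rewrite -(nneseries_geometric C0); last by rewrite z0.
apply: lee_nneseries => [j _ _|j _].
  by apply: integral_ge0 => x _; exact: u0.
rewrite (_ : u j = (fun x => ((2 ^+ j.+1 / h) `^ s)%:E * (\1_(E j) x)%:E)%E); last first.
  by apply/funext => x; rewrite -EFinM.
rewrite ge0_integralZl//; last 2 first.
  - by apply/measurable_EFinP; exact: measurable_indic.
  - by rewrite lee_fin powR_ge0.
rewrite integral_indic// setIT.
apply: (@le_trans _ _ (((2 ^+ j.+1 / h) `^ s)%:E * (4 * (h / 2 ^+ j) ^+ 2)%:E)%E).
  by rewrite lee_wpmul2l ?lee_fin ?powR_ge0// tail.
rewrite -EFinM lee_fin le_eqVlt; apply/orP; left; apply/eqP.
have h0' := ltW h0.
have -> : (2 ^+ j.+1 / h) `^ s = 2 `^ s * (2 `^ s) ^+ j * h `^ (- s).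
  rewrite powRM ?exprn_ge0 ?invr_ge0// exprS powRM ?exprn_ge0//.
  congr (_ * _ * _).
    by rewrite -(powR_mulrn j (powR_ge0 _ _)) -(powR_mulrn j (ler0n _ 2)) -!powRrM mulrC.
  by rewrite -powR_inv1// -powRrM mulN1r.
have -> : C = 4 * 2 `^ s * (h `^ (- s) * h ^+ 2).
  rewrite /C -powR_mulrn// -powRD; last by rewrite (gt_eqF h0) implybT.
  by rewrite addrC.
have -> : z ^+ j = (2 `^ s) ^+ j * (2 ^+ j) ^- 2.
  rewrite /z powRD; last by rewrite pnatr_eq0 implybT.
  rewrite exprMn; congr (_ * _).
  by rewrite powRN powR_mulrn// exprVn -!exprM mulnC.
by field; rewrite expf_neq0// pnatr_eq0.
Qed.

Section hoelder_near.
Variables (f : T -> R) (q N : R).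
Hypotheses (mf : measurable_fun setT f) (q2 : 2 < q) (N0 : 0 < N).
Hypothesis fq : ('N[mu]_q%:E[EFin \o f] <= N%:E)%E.

(** The conjugate exponent: q > 2 amounts to q' < 2, so that 1 / |x| is locally in L^q'. *)
Let q' := q / (q - 1).
Let q1 : 1 < q. Proof. by move: q2; lra. Qed.
Let q0 : 0 < q. Proof. by move: q2; lra. Qed.
Let q'0 : 0 < q'. Proof. by rewrite divr_gt0// subr_gt0. Qed.
Let q'2 : q' < 2.
Proof. by rewrite ltr_pdivrMr ?subr_gt0//; move: q2; lra. Qed.
Let qq' : q^-1 + q'^-1 = 1.
Proof. by rewrite /q' invf_div -[X in X + _]mul1r -mulrDl addrCA subrr addr0 divff// gt_eqF. Qed.

Definition near_const : R := near_power_const q' `^ q'^-1.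

Lemma near_singular_integral h : 0 < h ->
  (\int[mu]_x (`|f x| * near_power 1 h x)%:E <= (near_const * N * h `^ (1 - 2 / q))%:E)%E.
Proof.
move=> h0.
have mk := measurable_near_power 1 h.
have k0 x : 0 <= near_power 1 h x by rewrite /near_power; case: ifP => // _; exact: powR_ge0.
have := hoelder mu mf mk q0 q'0 qq'.
rewrite Lnorm1.
have -> : (\int[mu]_x `|(EFin \o (f \* near_power 1 h)%R) x| = \int[mu]_x (`|f x| * near_power 1 h x)%:E)%E.
  by apply: eq_integral => x _ /=; rewrite normrM [X in _ * X]ger0_norm.
move=> H; apply: (le_trans H).
have C0 := near_power_const_ge0 q'2.
have Nk : ('N[mu]_q'%:E[EFin \o near_power 1 h] <= (near_const * h `^ (1 - 2 / q))%:E)%E.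
  rewrite unlock.
  have -> : (\int[mu]_x (`|(EFin \o near_power 1 h) x| `^ q') = \int[mu]_x (near_power q' h x)%:E)%E.
    apply: eq_integral => x _; rewrite [(_ \o _) _]/= abse_EFin ger0_norm// poweR_EFin; congr EFin.
    rewrite /near_power; case: ifP => _; first by rewrite -powRrM mulN1r.
    by rewrite powR0// gt_eqF.
  have I0 : (0 <= \int[mu]_x (near_power q' h x)%:E)%E.
    apply: integral_ge0 => x _; rewrite lee_fin /near_power; case: ifP => // _; exact: powR_ge0.
  apply: (@le_trans _ _ (((near_power_const q' * h `^ (2 - q'))%:E) `^ q'^-1)%E).
    apply: gt0_ler_poweR; rewrite ?invr_ge0 ?(ltW q'0)//.
    - by rewrite in_itv/= I0 leey.
    - by rewrite in_itv/= lee_fin mulr_ge0 ?powR_ge0//= leey.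
    - exact: near_power_integral.
  rewrite poweR_EFin lee_fin powRM ?powR_ge0// /near_const.
  (* The exponents agree: (2 - q') / q' = 1 - 2 / q. *)
  rewrite -powRrM le_eqVlt; apply/orP; left; apply/eqP; congr (_ * _ `^ _).
  rewrite /q'; have h1 := q1; have h2 := q0; field.
  by rewrite !gt_eqF// subr_gt0.
have NN : (0 <= 'N[mu]_q'%:E[EFin \o near_power 1 h])%E by exact: Lnorm_ge0.
apply: (@le_trans _ _ (N%:E * (near_const * h `^ (1 - 2 / q))%:E)%E).
  by apply: lee_pmul => //; exact: Lnorm_ge0.
by rewrite -EFinM lee_fin mulrCA mulrA.
Qed.

(** Hoelder within distance [h], and the total mass divided by [h] beyond. *)
Lemma singular_integral_split m h : 0 < h -> (\int[mu]_x `|f x|%:E <= m%:E)%E ->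
  (\int[mu]_x (`|f x| / phi x)%:E <= (near_const * N * h `^ (1 - 2 / q) + m / h)%:E)%E.
Proof.
move=> h0 f1.
have mi : measurable_fun setT (fun x => (phi x)^-1) := measurableT_comp measurable_invr mphi.
have k0 x : 0 <= near_power 1 h x by rewrite /near_power; case: ifP => // _; exact: powR_ge0.
have mnf : measurable_fun setT (fun x => `|f x|) by exact: measurableT_comp.
apply: (@le_trans _ _ (\int[mu]_x ((`|f x| * near_power 1 h x)%:E + (`|f x| / h)%:E))%E).
  apply: ge0_le_integral => //.
  - by move=> x _; rewrite lee_fin divr_ge0.
  - by apply/measurable_EFinP; exact: measurable_funM.
  - apply: emeasurable_funD; apply/measurable_EFinP; apply: measurable_funM => //.
    exact: measurable_near_power.
  - move=> x _; rewrite -EFinD lee_fin -mulrDr ler_wpM2l// /near_power.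
    case: ltP => [xh|hx]; first by rewrite powR_inv1// lerDl invr_ge0 ltW.
    by rewrite add0r lef_pV2// posrE (lt_le_trans h0).
rewrite ge0_integralD//; last 4 first.
- by move=> x _; rewrite lee_fin mulr_ge0.
- apply/measurable_EFinP; apply: measurable_funM => //; exact: measurable_near_power.
- by move=> x _; rewrite lee_fin divr_ge0// ltW.
- by apply/measurable_EFinP; exact: measurable_funM.
rewrite EFinD; apply: leeD; first exact: near_singular_integral.
under eq_integral do rewrite EFinM muleC.
rewrite ge0_integralZl//; last 2 first.
- exact/measurable_EFinP.
- by rewrite lee_fin invr_ge0 ltW.
by rewrite [(m / h)]mulrC EFinM lee_wpmul2l// lee_fin invr_ge0 ltW.
Qed.

Definition velocity_const : R := near_const + 1.

Lemma velocity_const_ge0 : 0 <= velocity_const.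
Proof. by rewrite addr_ge0 ?powR_ge0. Qed.

(* The radius h = (m / N)^(q / (2 q - 2)) balances the two contributions. *)
Lemma singular_integral_bound m : 0 <= m -> (\int[mu]_x `|f x|%:E <= m%:E)%E ->
  (\int[mu]_x (`|f x| / phi x)%:E <=
   (velocity_const * (N `^ (q / (2 * q - 2)) * m `^ ((q - 2) / (2 * q - 2))))%:E)%E.
Proof.
move=> m0 f1; have hq := q2; have hN := N0; have q22 : 0 < 2 * q - 2 by lra.
have ab : q / (2 * q - 2) + (q - 2) / (2 * q - 2) = 1.
  by field; rewrite gt_eqF.
have be0 : 0 < (q - 2) / (2 * q - 2) by rewrite divr_gt0// subr_gt0.
have hN0 := ltW hN.
have pos k : 0 < k -> (\int[mu]_x `|f x|%:E <= k%:E)%E ->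
    (\int[mu]_x (`|f x| / phi x)%:E <=
     (velocity_const * (N `^ (q / (2 * q - 2)) * k `^ ((q - 2) / (2 * q - 2))))%:E)%E.
  move=> k0 fk; have k0' := ltW k0.
  pose h := (k / N) `^ (q / (2 * q - 2)).
  have kN : 0 < k / N by rewrite divr_gt0.
  have h0 : 0 < h by rewrite powR_gt0.
  have e1 : N * h `^ (1 - 2 / q) = N `^ (q / (2 * q - 2)) * k `^ ((q - 2) / (2 * q - 2)).
    rewrite /h -powRrM (_ : _ * (1 - 2 / q) = (q - 2) / (2 * q - 2)); last first.
      by field; rewrite !gt_eqF//; lra.
    rewrite powRM ?invr_ge0// -[N^-1]powR_inv1// -powRrM mulrCA [RHS]mulrC; congr (_ * _).
    rewrite -[X in X * _]powRr1// -powRD; last by rewrite (gt_eqF hN) implybT.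
    by congr (_ `^ _); rewrite -[X in X + _]ab; ring.
  have e2 : k / h = N `^ (q / (2 * q - 2)) * k `^ ((q - 2) / (2 * q - 2)).
    rewrite /h powRM ?invr_ge0// invfM -[N^-1]powR_inv1// -powRrM.
    rewrite -powRN -powRN mulN1r opprK mulrA mulrC; congr (_ * _).
    rewrite -[X in X * _]powRr1// -powRD; last by rewrite (gt_eqF k0) implybT.
    by congr (_ `^ _); rewrite -[X in X - _]ab; ring.
  apply: (le_trans (singular_integral_split h0 fk)).
  rewrite lee_fin -(mulrA near_const) e1 e2 /velocity_const.
  by rewrite [leRHS]mulrDl mul1r.
move: m0; rewrite le_eqVlt => /orP[/eqP m0|m0]; last exact: pos.
(* With zero mass no balancing radius exists; the bound holds for every larger mass [k], and [k]
   below is chosen to make it smaller than a prescribed [e]. *)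
rewrite -m0 in f1 *; rewrite [0 `^ _]powR0 ?gt_eqF// !mulr0.
apply/lee_addgt0Pr => e e0; rewrite add0e.
pose D := velocity_const * N `^ (q / (2 * q - 2)).
have D0 : 0 <= D by rewrite mulr_ge0 ?powR_ge0 ?velocity_const_ge0.
have D1 : 0 < D + 1 by rewrite ltr_wpDl.
pose k := (e / (D + 1)) `^ ((q - 2) / (2 * q - 2))^-1.
have eD : 0 < e / (D + 1) by rewrite divr_gt0.
have k0 : 0 < k by rewrite powR_gt0.
apply: (le_trans (pos k k0 _)).
  by apply: (le_trans f1); rewrite lee_fin ltW.
rewrite lee_fin mulrA -/D /k -powRrM mulVf ?gt_eqF// powRr1 ?(ltW eD)//.
by rewrite mulrCA -[leRHS]mulr1 ler_wpM2l ?(ltW e0)// ler_pdivrMr// mul1r lerDl.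
Qed.

End hoelder_near.

(** * Bounded densities against the singular kernels *)

Section bounded_near.
Variables (f : T -> R) (Kb m : R).
Hypotheses (mf : measurable_fun setT f) (Kb0 : 0 <= Kb).
Hypothesis fK : {ae mu, forall x, `|f x| <= Kb}.
Hypothesis f1 : (\int[mu]_x `|f x|%:E <= m%:E)%E.

Let mnf : measurable_fun setT (fun x => `|f x|).
Proof. exact: measurableT_comp. Qed.

Lemma bounded_near_integral h : 0 < h ->
  (\int[mu]_x (`|f x| * near_power 1 h x)%:E <= (Kb * near_power_const 1 * h)%:E)%E.
Proof.
move=> h0; have mk := measurable_near_power 1 h.
have k0 x : 0 <= near_power 1 h x by rewrite /near_power; case: ifP => // _; exact: powR_ge0.
apply: (@le_trans _ _ (\int[mu]_x (Kb%:E * (near_power 1 h x)%:E))%E).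
  apply: ae_ge0_le_integral => //.
  - by move=> x _; rewrite lee_fin mulr_ge0.
  - by apply/measurable_EFinP; exact: measurable_funM.
  - by move=> x _; rewrite -EFinM lee_fin mulr_ge0.
  - by apply: emeasurable_funM => //; exact/measurable_EFinP.
  - by apply: filterS fK => x fx _; rewrite -EFinM lee_fin ler_wpM2r.
rewrite ge0_integralZl//; last 2 first.
  - exact/measurable_EFinP.
  - by move=> x _; rewrite lee_fin.
rewrite -mulrA EFinM lee_wpmul2l ?lee_fin//.
have h1 : 2 - 1 = 1 :> R by lra.
by have := @near_power_integral 1 h ltr01 (ltr1n _ 2) h0; rewrite h1 powRr1// ltW.
Qed.

Lemma expr4 j : 4 ^+ j = (2 ^+ j) ^+ 2 :> R.
Proof. by rewrite -exprM mulnC exprM (_ : 2 ^+ 2 = 4 :> R)//; ring. Qed.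

(** The inverse square, which controls differences of the kernel, just fails to be integrable in the
    plane; cutting at 2^-n makes its integral grow linearly in [n]. *)
Definition truncated_square (n : nat) (x : T) : R := (Num.max (phi x) (2 ^- n) ^+ 2)^-1.

Lemma measurable_truncated_square n : measurable_fun setT (truncated_square n).
Proof.
apply: (measurableT_comp measurable_invr); apply: measurable_funX.
by apply: measurable_maxr => //; exact: measurable_cst.
Qed.

Lemma truncated_square_ge0 n x : 0 <= truncated_square n x.
Proof. by rewrite invr_ge0 sqr_ge0. Qed.

(** At a value of [phi] in the k-th dyadic ring the inverse square is at most 4^(k + 1), and the
    k-th summand alone suffices; the 1 handles phi >= 1. *)
Lemma truncated_square_le n x : truncated_square n x <=
  1 + \sum_(j < n.+1) 4 * 4 ^+ j * \1_[set y | phi y < 2 ^- j] x.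
Proof.
have S0 : 0 <= \sum_(j < n.+1) 4 * 4 ^+ j * \1_[set y | phi y < 2 ^- j] x :> R.
  by apply: sumr_ge0 => j _; rewrite !mulr_ge0 ?exprn_ge0.
have [x1|x1] := leP 1 (phi x).
  apply: (@le_trans _ _ 1); last by rewrite lerDl.
  rewrite invf_le1 ?exprn_gt0 ?lt_max ?(lt_le_trans ltr01 x1)//.
  by rewrite exprn_ege1// le_max x1.
have [k [kn k1 k2]] : exists k : nat, [/\ (k < n.+1)%N, phi x < 2 ^- k &
    truncated_square n x <= 4 * 4 ^+ k].
  have [xn|nx] := ltP (phi x) (2 ^- n).
    exists n; split => //; rewrite /truncated_square max_r ?(ltW xn)//.
    by rewrite exprVn invrK -expr4 ler_peMl ?exprn_ge0// ler1n.
  have px : 0 < phi x by rewrite (lt_le_trans _ nx)// invr_gt0 exprn_gt0.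
  have [k /andP[k1 k2]] := dyadic_bracket px x1.
  rewrite !mul1r in k1 k2; exists k; split => //.
    rewrite ltnS leqNgt; apply/negP => nk.
    have : 2 ^- k <= 2 ^- n :> R.
      by rewrite lef_pV2 ?posrE ?exprn_gt0// ler_eXn2l ?ltr1n// ltnW.
    by move=> h; have := lt_le_trans k2 (le_trans h nx); rewrite ltxx.
  rewrite /truncated_square max_l//.
  rewrite -[4 * _]exprS (_ : 4 ^+ k.+1 = ((2 ^- k.+1) ^+ 2)^-1 :> R); last first.
    by rewrite exprVn invrK -expr4.
  rewrite lef_pV2 ?posrE ?exprn_gt0 ?invr_gt0 ?exprn_gt0//.
  by rewrite lerXn2r ?nnegrE ?invr_ge0 ?exprn_ge0.
apply: (le_trans k2); rewrite (bigD1 (Ordinal kn))//= indicE mem_set//= mulr1.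
rewrite addrCA lerDl addr_ge0// sumr_ge0// => j _.
Qed.

(** Each dyadic scale contributes the same amount 16 [Kb]: this is the logarithm in the
    log-Lipschitz modulus. *)
Lemma truncated_square_integral n :
  (\int[mu]_x (`|f x| * truncated_square n x)%:E <= (m + 16 * Kb * n.+1%:R)%:E)%E.
Proof.
pose E (j : nat) := [set y | phi y < 2 ^- j].
have mE j : measurable (E j) by exact: measurable_set_lt.
have p2 j : 0 < 2 ^- j :> R by rewrite invr_gt0 exprn_gt0.
have g0 j x : (0 <= (4 * 4 ^+ j * Kb * \1_(E j) x)%:E)%E.
  by rewrite lee_fin !mulr_ge0 ?exprn_ge0.
have mg j : measurable_fun setT (fun x => (4 * 4 ^+ j * Kb * \1_(E j) x)%:E).
  by apply/measurable_EFinP; apply: measurable_funM => //; exact: measurable_indic.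
apply: (@le_trans _ _ (\int[mu]_x (`|f x|%:E + \sum_(j < n.+1) (4 * 4 ^+ j * Kb * \1_(E j) x)%:E))%E).
  apply: ae_ge0_le_integral => //.
  - by move=> x _; rewrite lee_fin mulr_ge0 ?truncated_square_ge0.
  - apply/measurable_EFinP; apply: measurable_funM => //; exact: measurable_truncated_square.
  - by move=> x _; rewrite adde_ge0// sume_ge0.
  - apply: emeasurable_funD; first exact/measurable_EFinP.
    by apply: emeasurable_sum => j; exact: mg.
  - apply: filterS fK => x fx _; rewrite sumEFin -EFinD lee_fin.
    apply: (@le_trans _ _ (`|f x| * (1 + \sum_(j < n.+1) 4 * 4 ^+ j * \1_(E j) x))).
      by rewrite ler_wpM2l// truncated_square_le.
    rewrite mulrDr mulr1 lerD2l mulr_sumr; apply: ler_sum => j _.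
    have h0 : 0 <= 4 * 4 ^+ j * \1_(E j) x :> R by rewrite !mulr_ge0 ?exprn_ge0.
    by rewrite [leRHS]mulrAC mulrC ler_wpM2l.
rewrite ge0_integralD//; last 3 first.
- exact/measurable_EFinP.
- by move=> x _; rewrite sume_ge0.
- by apply: emeasurable_sum => j; exact: mg.
rewrite EFinD; apply: leeD => //.
rewrite ge0_integral_sum//.
apply: (@le_trans _ _ (\sum_(j < n.+1) (16 * Kb)%:E)%E).
  apply: lee_sum => j _.
  rewrite (_ : (fun x => _) = (fun x => (4 * 4 ^+ j * Kb)%:E * (\1_(E j) x)%:E)%E); last first.
    by apply/funext => x; rewrite -EFinM.
  rewrite ge0_integralZl//; last 2 first.
    - by apply/measurable_EFinP; exact: measurable_indic.
    - by rewrite lee_fin !mulr_ge0 ?exprn_ge0.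
  rewrite integral_indic// setIT.
  apply: (@le_trans _ _ ((4 * 4 ^+ j * Kb)%:E * (4 * (2 ^- j) ^+ 2)%:E)%E).
    by rewrite lee_wpmul2l ?lee_fin ?tail// !mulr_ge0 ?exprn_ge0.
  rewrite -EFinM lee_fin exprVn expr4 le_eqVlt; apply/orP; left.
  by apply/eqP; field; rewrite expf_neq0// pnatr_eq0.
by rewrite sumEFin sumr_const card_ord -[_ *+ n.+1]mulr_natr.
Qed.

End bounded_near.

End SingularIntegrals.

(** * Planar Lebesgue measure and measure preserving maps *)

Section DenseFamily.
Context {R : realType}.

Definition dense_family (T : pseudoMetricType R) (I : Type) (c : I -> T) :=
  forall x (e : R), 0 < e -> exists i, ball (c i) e x.

Lemma nbhs_dense_ball (T : pseudoMetricType R) (I : Type) (c : I -> T) x (U : set T) :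
  dense_family c -> nbhs x U ->
  exists i (n : nat), ball (c i) (n.+1%:R^-1 : R) x /\ ball (c i) (n.+1%:R^-1 : R) `<=` U.
Proof.
move=> dc /nbhs_ballP[e /= e0 eU].
have e2 : 0 < 2 / e by rewrite divr_gt0.
pose n := Num.bound (2 / e).
have hn : n.+1%:R^-1 + n.+1%:R^-1 <= e.
  have h : 2 / e <= n.+1%:R.
    by rewrite (le_trans (ltW (archi_boundP (ltW e2))))// ler_nat.
  have : 2 / n.+1%:R <= e by rewrite ler_pdivrMr// mulrC -ler_pdivrMr.
  by rewrite mulrDl mul1r.
have [i ix] := dc x n.+1%:R^-1 (ltac:(by rewrite invr_gt0)).
exists i, n; split => // y iy; apply: eU; apply: (le_ball hn).
by apply: ball_triangle iy; exact: ball_sym.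
Qed.

Lemma dense_ratr : dense_family (@ratr R : rat -> R).
Proof.
move=> x e e0; have [q] : exists q : rat, ratr q \in `]x - e, x + e[%R.
  by apply: rat_in_itvoo; lra.
rewrite in_itv/= => /andP[q1 q2]; exists q.
by rewrite /ball/= ltr_norml; lra.
Qed.

Lemma dense_pair (T1 T2 : pseudoMetricType R) (I1 I2 : Type) (c1 : I1 -> T1) (c2 : I2 -> T2) :
  dense_family c1 -> dense_family c2 ->
  dense_family (fun i : I1 * I2 => (c1 i.1, c2 i.2) : (T1 * T2)%type).
Proof.
move=> d1 d2 [x y] e e0; have [i ix] := d1 x e e0; have [j jy] := d2 y e e0.
by exists (i, j).
Qed.

Definition dense2 (i : rat * rat) : R * R := (ratr i.1, ratr i.2).
Lemma dense_dense2 : dense_family dense2.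
Proof. exact: dense_pair dense_ratr dense_ratr. Qed.

Definition dense3 (i : rat * (rat * rat)) : R * (R * R) := (ratr i.1, dense2 i.2).
Lemma dense_dense3 : dense_family dense3.
Proof. exact: dense_pair dense_ratr dense_dense2. Qed.

Lemma measurable_ball1 (x e : R) : measurable (ball x e : set (measurableTypeR R)).
Proof. by rewrite ball_itv; exact: measurable_itv. Qed.

Lemma measurable_ball2 (x : R * R) (e : R) : measurable (ball x e : set (borel2 (R := R))).
Proof.
case: x => x y; rewrite (_ : ball _ _ = ball x e `*` ball y e)//.
by apply: measurableX; exact: measurable_ball1.
Qed.

Lemma measurable_ball3 (x : R * (R * R)) (e : R) :
  measurable (ball x e : set (measurableTypeR R * borel2 (R := R))).
Proof.
case: x => x y; rewrite (_ : ball _ _ = ball x e `*` ball y e)//.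
by apply: measurableX; [exact: measurable_ball1|exact: measurable_ball2].
Qed.

(** Measurability refers to the product sigma-algebra; an open set belongs to it as a countable
    union of product balls with rational centers. *)
Lemma open_measurable3 (U : set (R * (R * R))) : open U ->
  measurable (U : set (measurableTypeR R * borel2 (R := R))).
Proof.
move=> oU.
pose F (k : rat * (rat * rat) * nat) : set (measurableTypeR R * borel2 (R := R)) :=
  if `[< ball (dense3 k.1) (k.2.+1%:R^-1 : R) `<=` U >]
  then ball (dense3 k.1) (k.2.+1%:R^-1 : R) else set0.
rewrite (_ : U = \bigcup_k F k).
  apply: countable_bigcupT_measurable; first exact: countableP.
  by move=> k; rewrite /F; case: ifP => // _; exact: measurable_ball3.
apply/seteqP; split => [x Ux|x [k _]].
  have [i [n [ix iU]]] := nbhs_dense_ball dense_dense3 (open_nbhs_nbhs (conj oU Ux)).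
  by exists (i, n) => //; rewrite /F /=; case: asboolP.
by rewrite /F; case: asboolP => // kU; exact: kU.
Qed.

Lemma closed_measurable3 (F : set (R * (R * R))) : closed F ->
  measurable (F : set (measurableTypeR R * borel2 (R := R))).
Proof.
move=> cF; rewrite -[F]setCK; apply: measurableC; apply: open_measurable3.
exact: closed_openC.
Qed.

(** Lindeloef: countably many balls on which [f] vanishes almost everywhere cover the complement of
    the essential support. *)
Lemma negligible_setC_esupp (f : R * R -> R) :
  (@leb2 R).-negligible (~` esupp f `&` [set y | f y <> 0]).
Proof.
pose B (k : rat * rat * nat) := ball (dense2 k.1) (k.2.+1%:R^-1 : R) `&` [set y | f y <> 0].
pose F k := if `[< (@leb2 R).-negligible (B k) >] then B k else set0.
have nF k : (@leb2 R).-negligible (F k).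
  by rewrite /F; case: asboolP => // _; exact: negligible_set0.
have [g gs] : exists g : nat -> rat * rat * nat, forall k, exists n, g n = k.
  exists (fun n => odflt (0, 0, 0%N) (unpickle n)) => k.
  by exists (pickle k); rewrite pickleK.
apply: (negligibleS _ (negligible_bigcup (fun n => nF (g n)))).
move=> x [/= /contrapT[U Ux nU] fx].
have [i [n [ix iU]]] := nbhs_dense_ball dense_dense2 Ux.
have [k gk] := gs (i, n); exists k => //; rewrite gk /F; case: asboolP => //.
by case; apply: (negligibleS _ nU) => y [yi fy]; split => //; exact: iU.
Qed.

End DenseFamily.

Section AlmostEverywhere.
Context d (T : measurableType d) (R : realType) (nu : {measure set T -> \bar R}).

Lemma ae_imply (P Q : T -> Prop) : (forall x, P x -> Q x) ->
  {ae nu, forall x, P x} -> {ae nu, forall x, Q x}.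
Proof. by move=> PQ; apply: filterS. Qed.

Lemma ae_conj (P Q : T -> Prop) : {ae nu, forall x, P x} -> {ae nu, forall x, Q x} ->
  {ae nu, forall x, P x /\ Q x}.
Proof. by move=> hP hQ; apply: filterI. Qed.

Lemma ae_conj_all (n : nat) (P : 'I_n -> T -> Prop) : (forall i, {ae nu, forall x, P i x}) ->
  {ae nu, forall x, forall i, P i x}.
Proof. exact: filter_forall. Qed.

End AlmostEverywhere.

Section PlanarMeasure.
Context {R : realType}.
Local Notation mu := (@leb2 R).

Lemma measurable_fst2 : measurable_fun [set: borel2] (fun x : borel2 (R := R) => x.1 : R).
Proof. exact: measurable_fst. Qed.

Lemma measurable_snd2 : measurable_fun [set: borel2] (fun x : borel2 (R := R) => x.2 : R).
Proof. exact: measurable_snd. Qed.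

Lemma measurable_dist (x : R * R) :
  measurable_fun [set: borel2] (fun y : borel2 (R := R) => enorm (x - y)).
Proof.
apply: measurable_enorm => /=; apply: measurable_funB => //.
Qed.

Lemma measurable_eball (x : R * R) r : measurable (eball x r : set (borel2 (R := R))).
Proof.
rewrite (_ : eball x r = [set y | enorm (x - y) < r]).
  by apply: measurable_set_lt => //; exact: measurable_dist.
by apply/seteqP; split => y; rewrite /eball /= enormBC.
Qed.

(** The disc lies in a square of side 2 r, which avoids its exact area. *)
Lemma leb2_eball (x : R * R) (r : R) : 0 < r -> (mu [set y | (enorm (x - y) < r)%R] <= (4 * r ^+ 2)%:E)%E.
Proof.
move=> r0; case: x => x1 x2.
pose I (a : R) : set R := `]a - r, a + r[%classic.
have mI a : measurable (I a) by exact: measurable_itv.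
have lI a : lebesgue_measure (I a) = (2 * r)%:E :> \bar R.
  rewrite lebesgue_measure_itv/= lte_fin ifT; last by lra.
  by rewrite -EFinD; congr EFin; lra.
apply: (@le_trans _ _ (mu (I x1 `*` I x2))).
  apply: le_measure; rewrite ?inE.
  - by apply: measurable_set_lt => //; exact: measurable_dist.
  - by apply: measurableX; exact: mI.
  move=> [y1 y2] /= h; rewrite /I /= !in_itv/=.
  have h1 := le_lt_trans (norm1_le_enorm _) h; have h2 := le_lt_trans (norm2_le_enorm _) h.
  by move: h1 h2 => /=; rewrite !ltr_norml; lra.
have -> : mu (I x1 `*` I x2) = (lebesgue_measure (I x1) * lebesgue_measure (I x2))%E.
  by apply: product_measure1E; exact: mI.
by rewrite !lI -EFinM lee_fin; nra.
Qed.

Section measure_preserving.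
Variable Y : R * R -> R * R.
Hypothesis mY : measure_preserving Y.

Let mY' : measurable_fun [set: borel2] (Y : borel2 -> borel2) := mY.1.

Lemma mp_measurable1 : measurable_fun [set: borel2] (fun b : borel2 (R := R) => (Y b).1 : R).
Proof. exact: (measurableT_comp measurable_fst2). Qed.

Lemma mp_measurable2 : measurable_fun [set: borel2] (fun b : borel2 (R := R) => (Y b).2 : R).
Proof. exact: (measurableT_comp measurable_snd2). Qed.

Lemma mp_ge0_integral (f : R * R -> \bar R) :
  measurable_fun [set: borel2] (f : borel2 -> \bar R) -> (forall x, 0 <= f x)%E ->
  (\int[mu]_x f x = \int[mu]_b f (Y b))%E.
Proof.
move=> mf f0.
rewrite (eq_measure_integral (pushforward mu (Y : borel2 -> borel2))); last first.
  by move=> A mA _; apply: esym; apply: mY.2.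
by rewrite (ge0_integral_pushforward mY')//.
Qed.

Lemma mp_integral (f : R * R -> \bar R) :
  measurable_fun [set: borel2] (f : borel2 -> \bar R) ->
  (\int[mu]_x f x = \int[mu]_b f (Y b))%E.
Proof.
move=> mf; rewrite integralE [RHS]integralE; congr (_ - _)%E.
- rewrite (mp_ge0_integral (measurable_funepos mf) (funepos_ge0 f)).
  by congr (integral mu setT _); apply/funext => b; rewrite !unlock.
- rewrite (mp_ge0_integral (measurable_funeneg mf) (funeneg_ge0 f)).
  by congr (integral mu setT _); apply/funext => b; rewrite !unlock.
Qed.

(** Carries a property from almost every label to almost every point: the exceptional set has the
    measure of its preimage. *)
Lemma mp_ae (B : set (R * R)) : measurable (B : set borel2) ->
  {ae mu, forall b, B (Y b)} -> {ae mu, forall x, B x}.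
Proof.
move=> mB [N [mN N0 BN]]; exists (~` B); split => //; first exact: measurableC.
have : (mu (Y @^-1` (~` B)) <= mu N)%E.
  apply: le_measure; rewrite ?inE//.
  by rewrite -[X in measurable X]setTI; apply: mY' => //; exact: measurableC.
rewrite N0 mY.2; last exact: measurableC.
by move=> h; apply/eqP; rewrite eq_le h measure_ge0.
Qed.

Lemma mp_dist_tail x r : 0 < r -> (mu [set b | (enorm (x - Y b) < r)%R] <= (4 * r ^+ 2)%:E)%E.
Proof.
move=> r0; apply: le_trans (leb2_eball x r0); rewrite le_eqVlt; apply/orP; left; apply/eqP.
apply: (mY.2 [set y | enorm (x - y) < r]).
by apply: measurable_set_lt => //; exact: measurable_dist.
Qed.

Lemma mp_measurable_dist x :
  measurable_fun [set: borel2] (fun b : borel2 (R := R) => enorm (x - Y b)).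
Proof.
by apply: measurable_enorm => /=; apply: measurable_funB => //;
  [exact: mp_measurable1|exact: mp_measurable2].
Qed.

(** A change of variables for finite [r]. For the essential supremum, the superlevel sets of |f| and
    |g| have equal measures. *)
Lemma mp_Lnorm2 (r : \bar R) (f g : R * R -> R) : measurable2 f ->
  (1 <= r)%E -> (forall b, f (Y b) = g b) -> Lnorm2 r f = Lnorm2 r g.
Proof.
move=> mf r1 fg; rewrite /Lnorm2 unlock.
case: r r1 => [r r1|_|//]; lazy beta iota.
  rewrite mp_ge0_integral.
  - by congr poweR; apply: eq_integral => b _; rewrite [(_ \o f) _]/= fg.
  - apply/measurable_EFinP; apply: (@measurableT_comp _ _ _ _ _ _ (fun z : R => z `^ r)) => //.
    exact: measurableT_comp.
  - by move=> x; rewrite lee_fin powR_ge0.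
case: ifPn => // _.
have gE : g = f \o Y by apply/funext => b /=; rewrite fg.
have mabs : measurable_fun [set: borel2] (abse \o (EFin \o f) : borel2 -> \bar R).
  by apply: measurableT_comp => //; exact/measurable_EFinP.
have mabsg : measurable_fun [set: borel2] (abse \o (EFin \o g) : borel2 -> \bar R).
  by rewrite gE; exact: (measurableT_comp mabs mY').
rewrite (ess_supEmu0 _ mabs) (ess_supEmu0 _ mabsg).
have E y : mu ((abse \o (EFin \o g)) @^-1` `]y, +oo[%classic) = mu ((abse \o (EFin \o f)) @^-1` `]y, +oo[%classic).
  rewrite gE; apply: (mY.2 ((abse \o (EFin \o f)) @^-1` `]y, +oo[%classic)).
  by rewrite -[X in measurable X]setTI; apply: mabs => //; exact: emeasurable_itv.
by apply: congr1; apply/seteqP; split => y; [exact: (etrans (E y))|exact: (etrans (esym (E y)))].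
Qed.

End measure_preserving.

End PlanarMeasure.

(** * Velocity in Lagrangian labels *)

Section KernelDifference.
Context {R : realType}.
Local Notation K := (@biot_savart_kernel R).

(** If both points are at least [h] away, [enorm_kernelB] applies and 1 / (|z| |z'|) is at most the
    sum of the inverse squares. Otherwise the triangle inequality leaves twice the larger kernel,
    paid by the near terms. *)
Lemma kernel_difference_bound (z z' : R * R) (h : R) : 0 < h ->
  enorm (K z - K z') <= enorm (z - z') *
     ((Num.max (enorm z) h ^+ 2)^-1 + (Num.max (enorm z') h ^+ 2)^-1)
   + 2 * ((if enorm z < h then enorm z `^ (- 1) else 0)
          + (if enorm z' < h then enorm z' `^ (- 1) else 0)).
Proof.
move=> h0; wlog zz' : z z' / enorm z <= enorm z'.
  move=> H; have [zz'|/ltW z'z] := leP (enorm z) (enorm z'); first exact: H.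
  rewrite enormBC (enormBC z); apply: (le_trans (H _ _ z'z)).
  by rewrite [X in _ * X + _]addrC [X in _ + _ * X]addrC.
have near0 (u : R * R) : 0 <= if enorm u < h then enorm u `^ (- 1) else 0.
  by case: ifP => // _; exact: powR_ge0.
have trunc0 (u : R * R) : 0 <= (Num.max (enorm u) h ^+ 2)^-1.
  by rewrite invr_ge0 sqr_ge0.
have first0 : 0 <= enorm (z - z') *
     ((Num.max (enorm z) h ^+ 2)^-1 + (Num.max (enorm z') h ^+ 2)^-1).
  by rewrite mulr_ge0 ?enorm_ge0 ?addr_ge0.
have Kle (u : R * R) := enorm_kernel_le u.
have inv u : enorm u `^ (- 1) = (enorm u)^-1 :> R by rewrite powR_inv1 ?enorm_ge0.
(* Separate because the near term of a zero argument is zero by convention; for |z'| >= h the bound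
   then comes from |z'| |z'|^(-2). *)
have [z0|z0] := eqVneq z 0.
  rewrite z0 sub0r enormN in zz' *.
  have -> : K 0 = 0 :> R * R.
    apply/eqP; rewrite -enorm0_eq0 eq_le enorm_ge0 andbT.
    by apply: (le_trans (Kle 0)); rewrite enorm0 invr0.
  rewrite sub0r enormN; have [z'h|hz'] := ltP (enorm z') h.
    apply: (le_trans (Kle z')); rewrite enorm0 h0 -inv.
    have := near0 z'; rewrite z'h => h1; have := powR_ge0 (0 : R) (-1).
    have := trunc0 0; have := trunc0 z'; have := enorm_ge0 z'; rewrite enorm0.
    by nra.
  have z'0 : 0 < enorm z' := lt_le_trans h0 hz'.
  have := near0 0; rewrite addr0.
  set a := (if _ then _ else _) => a0; apply: (le_trans (Kle z')).
  rewrite mulrDr -addrA addrCA.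
  rewrite (_ : enorm z' * (enorm z' ^+ 2)^-1 = (enorm z')^-1); last first.
    by rewrite expr2 invfM mulrA divff ?mul1r ?gt_eqF.
  by rewrite lerDl addr_ge0 ?mulr_ge0 ?enorm_ge0.
have ez0 : 0 < enorm z by rewrite enorm_gt0.
have ez'0 : 0 < enorm z' := lt_le_trans ez0 zz'.
have z'0 : z' != 0 by rewrite -enorm_gt0.
have [zh|hz] : enorm z < h \/ h <= enorm z by case: ltP; [left|right].
  apply: (@le_trans _ _ (2 * (enorm z)^-1)).
    apply: (le_trans (enormB _ _)); rewrite mulrDl mul1r lerD//.
    by apply: (le_trans (Kle z')); rewrite lef_pV2.
  by rewrite zh inv -[leLHS]add0r lerD// ler_wpM2l// lerDl.
rewrite !ltNge hz (le_trans hz zz') /= addr0 mulr0 addr0 !max_l ?(le_trans hz zz')//.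
apply: (le_trans (enorm_kernelB z0 z'0)); rewrite ler_wpM2l ?enorm_ge0//.
rewrite invfM -!exprVn; set a := (enorm z)^-1; set b := (enorm z')^-1.
by nra.
Qed.

End KernelDifference.

Section LagrangianVelocity.
Context {R : realType}.
Local Notation K := (@biot_savart_kernel R).
Local Notation mu := (@leb2 R).
Variables (Y : R * R -> R * R) (w0 : R * R -> R).
Hypotheses (mY : measure_preserving Y) (mw0 : measurable2 w0).

Definition lagrangian_velocity (x : R * R) : R * R :=
  (\int[mu]_b ((K (x - Y b)).1 * w0 b), \int[mu]_b ((K (x - Y b)).2 * w0 b)).

Lemma velocity_lagrangian (w : R * R -> R) x : measurable2 w ->
  {ae mu, forall b, w (Y b) = w0 b} -> velocity w x = lagrangian_velocity x.
Proof.
move=> mw ww0.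
have [mk1 mk2] : measurable_fun [set: borel2] (fun y : borel2 (R := R) => (K (x - y)).1 : R) /\
    measurable_fun [set: borel2] (fun y : borel2 (R := R) => (K (x - y)).2 : R).
  by apply: measurable_kernel => /=; apply: measurable_funB.
have aux (k : R * R -> R) : measurable2 k ->
    \int[mu]_y (k y * w y) = \int[mu]_b (k (Y b) * w0 b).
  move=> mk; rewrite /Rintegral; congr fine.
  have mkw : measurable_fun [set: borel2] (EFin \o (fun y => k y * w y) : borel2 -> \bar R).
    by apply/measurable_EFinP; exact: measurable_funM.
  rewrite (mp_integral mY mkw); apply: ae_eq_integral => //.
  - exact: (measurableT_comp mkw mY.1).
  - apply/measurable_EFinP; apply: measurable_funM => //.
    exact: (measurableT_comp mk mY.1).
  - by apply: ae_imply ww0 => b wb _; rewrite [(EFin \o _) _]/= wb.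
by rewrite /velocity /lagrangian_velocity (aux _ mk1) (aux _ mk2).
Qed.

Let dist x b := enorm (x - Y b).
Let mdist x : measurable_fun [set: borel2] (dist x : borel2 -> R).
Proof. exact: mp_measurable_dist. Qed.
Let dist0 x b : 0 <= dist x b. Proof. exact: enorm_ge0. Qed.
Let dtail x r : 0 < r -> (mu [set b | (dist x b < r)%R] <= (4 * r ^+ 2)%:E)%E.
Proof. exact: mp_dist_tail. Qed.

Lemma measurable_kernel_mp x :
  measurable_fun [set: borel2] (fun b : borel2 (R := R) => (K (x - Y b)).1 : R) /\
  measurable_fun [set: borel2] (fun b : borel2 (R := R) => (K (x - Y b)).2 : R).
Proof.
by apply: measurable_kernel => /=; apply: measurable_funB => //;
  [exact: mp_measurable1|exact: mp_measurable2].
Qed.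

Lemma kernel_integrable x : (\int[mu]_b (`|w0 b| / enorm (x - Y b))%:E < +oo)%E ->
  mu.-integrable setT (EFin \o (fun b => (K (x - Y b)).1 * w0 b)) /\
  mu.-integrable setT (EFin \o (fun b => (K (x - Y b)).2 * w0 b)).
Proof.
move=> sing; have [mk1 mk2] := measurable_kernel_mp x.
have aux (k : R * R -> R) : measurable2 k ->
    (forall b, `|k b| <= enorm (K (x - Y b))) ->
    mu.-integrable setT (EFin \o (fun b => k b * w0 b)).
  move=> mk kb; apply/integrableP; split.
    by apply/measurable_EFinP; exact: measurable_funM.
  apply: le_lt_trans sing.
  apply: ge0_le_integral => //.
  - apply: measurableT_comp => //; apply/measurable_EFinP; exact: measurable_funM.
  - apply/measurable_EFinP; apply: measurable_funM; first exact: measurableT_comp.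
    exact: (measurableT_comp measurable_invr (mdist x)).
  - move=> b _; rewrite [(EFin \o _) _]/= abse_EFin lee_fin normrM mulrC ler_wpM2l//.
    exact: (le_trans (kb b) (enorm_kernel_le _)).
split; apply: aux => // b; [exact: norm1_le_enorm|exact: norm2_le_enorm].
Qed.

Lemma velocity_component_bound (k : R * R -> R) (g : R * R -> R) (B : R) :
  mu.-integrable setT (EFin \o (fun b => k b * w0 b)) ->
  (forall b, `|k b| <= g b) -> measurable2 g ->
  (\int[mu]_b (`|w0 b| * g b)%:E <= B%:E)%E ->
  `|\int[mu]_b (k b * w0 b)| <= B.
Proof.
move=> ik kg mg gB; apply: (le_trans (le_normr_Rintegral measurableT ik)).
rewrite /Rintegral -lee_fin.
have mkw : measurable_fun [set: borel2] (fun b => (`|k b * w0 b|)%:E : \bar R).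
  have /integrableP[/measurable_EFinP mi _] := ik.
  by apply/measurable_EFinP; exact: measurableT_comp.
have le : (\int[mu]_b (`|k b * w0 b|)%:E <= B%:E)%E.
  apply: le_trans gB; apply: ge0_le_integral => //.
  - by apply/measurable_EFinP; apply: measurable_funM => //; exact: measurableT_comp.
  - by move=> b _; rewrite lee_fin normrM mulrC ler_wpM2l.
rewrite fineK// ge0_fin_numE; first exact: le_lt_trans le (ltry _).
by apply: integral_ge0 => b _; rewrite lee_fin.
Qed.

Lemma lagrangian_velocity_le x (B : R) :
  (\int[mu]_b (`|w0 b| / enorm (x - Y b))%:E <= B%:E)%E ->
  enorm (lagrangian_velocity x) <= 2 * B.
Proof.
move=> sing; have [i1 i2] := kernel_integrable (le_lt_trans sing (ltry B)).
have mg : measurable2 (fun b => (enorm (x - Y b))^-1).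
  exact: (measurableT_comp measurable_invr (mdist x)).
apply: (le_trans (enorm_le_normD _)); rewrite mulrDl mul1r lerD//.
- apply: (velocity_component_bound i1 _ mg sing) => b.
  exact: (le_trans (norm1_le_enorm _) (enorm_kernel_le _)).
- apply: (velocity_component_bound i2 _ mg sing) => b.
  exact: (le_trans (norm2_le_enorm _) (enorm_kernel_le _)).
Qed.

Section bounded_vorticity.
Variables (Kb m : R).
Hypotheses (Kb0 : 0 <= Kb) (w0K : {ae mu, forall b, `|w0 b| <= Kb}).
Hypothesis w01 : (\int[mu]_b `|w0 b|%:E <= m%:E)%E.

(** Distances below 1 use the sup bound on the vorticity, the others its mass. *)
Definition velocity_bound : R := Kb * near_power_const 1 + m.

Lemma singular_velocity_bound x :
  (\int[mu]_b (`|w0 b| / enorm (x - Y b))%:E <= velocity_bound%:E)%E.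
Proof.
have mn : measurable_fun [set: borel2] (fun b => `|w0 b| : R) by exact: measurableT_comp.
have mnp := measurable_near_power (mdist x) 1 1.
have np0 b : 0 <= near_power (dist x) 1 1 b.
  by rewrite /near_power; case: ifP => // _; exact: powR_ge0.
apply: (@le_trans _ _ (\int[mu]_b ((`|w0 b| * near_power (dist x) 1 1 b)%:E + `|w0 b|%:E))%E).
  apply: ge0_le_integral => //.
  - by move=> b _; rewrite lee_fin divr_ge0 ?enorm_ge0.
  - apply/measurable_EFinP; apply: measurable_funM => //.
    exact: (measurableT_comp measurable_invr (mdist x)).
  - by apply: emeasurable_funD; apply/measurable_EFinP => //; exact: measurable_funM.
  - move=> b _; rewrite -EFinD lee_fin -{3}[`|w0 b|]mulr1 -mulrDr ler_wpM2l// /near_power /dist.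
    case: ltP => h; first by rewrite powR_inv1 ?enorm_ge0// lerDl.
    by rewrite add0r invf_le1// (lt_le_trans ltr01 h).
rewrite ge0_integralD//; last 3 first.
- by move=> b _; rewrite lee_fin mulr_ge0.
- by apply/measurable_EFinP; exact: measurable_funM.
- exact/measurable_EFinP.
rewrite /velocity_bound EFinD; apply: leeD => //.
by have := bounded_near_integral (mdist x) (dist0 x) (dtail x) mw0 Kb0 w0K ltr01; rewrite mulr1.
Qed.

(** Both centers [x] and [x'] count: twice the integral of the truncated square, and four times that
    of the near power at scale 2^-n. *)
Definition log_lipschitz_const : R := 2 * m + 32 * Kb + 4 * (Kb * near_power_const 1).

(* Log-Lipschitz regularity: optimising over n gives a modulus d log(1/d). *)
Lemma lagrangian_velocity_log_lipschitz x x' (n : nat) :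
  enorm (lagrangian_velocity x - lagrangian_velocity x')
  <= 2 * (log_lipschitz_const * (n.+1%:R * enorm (x - x') + 2 ^- n)).
Proof.
pose h : R := 2 ^- n; have h0 : 0 < h by rewrite invr_gt0 exprn_gt0.
pose g b := enorm (x - x') * (truncated_square (dist x) n b + truncated_square (dist x') n b)
   + 2 * (near_power (dist x) 1 h b + near_power (dist x') 1 h b).
have mt y := measurable_truncated_square (mdist y) n.
have mn y := measurable_near_power (mdist y) 1 h.
have mg : measurable2 g.
  apply: (@measurable_funD _ _ _ _ (fun b => _ * _) (fun b => _ * _)).
    apply: measurable_funM; first exact: measurable_cst.
    by apply: measurable_funD; exact: mt.
  apply: measurable_funM; first exact: measurable_cst.
  by apply: measurable_funD; exact: mn.
have Kg b : enorm (K (x - Y b) - K (x' - Y b)) <= g b.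
  have := kernel_difference_bound (x - Y b) (x' - Y b) h0.
  by rewrite opprB addrA subrK.
have m0 : 0 <= m.
  by rewrite -lee_fin (le_trans _ w01)//; apply: integral_ge0 => b _; rewrite lee_fin.
have npc0 : 0 <= near_power_const 1 :> R by apply: near_power_const_ge0; rewrite ltr1n.
have B : (\int[mu]_b (`|w0 b| * g b)%:E <=
    (log_lipschitz_const * (n.+1%:R * enorm (x - x') + 2 ^- n))%:E)%E.
  pose F y b := (`|w0 b| * truncated_square (dist y) n b)%:E.
  pose G y b := (`|w0 b| * near_power (dist y) 1 h b)%:E.
  have mw : measurable_fun [set: borel2] (fun b => `|w0 b| : R) by exact: measurableT_comp.
  have mF y : measurable_fun [set: borel2] (F y).
    by apply/measurable_EFinP; apply: measurable_funM; [exact: mw|exact: mt].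
  have mG y : measurable_fun [set: borel2] (G y).
    by apply/measurable_EFinP; apply: measurable_funM; [exact: mw|exact: mn].
  have F0 y b : (0 <= F y b)%E by rewrite lee_fin mulr_ge0 ?truncated_square_ge0.
  have G0 y b : (0 <= G y b)%E.
    by rewrite lee_fin mulr_ge0// /near_power; case: ifP => // _; exact: powR_ge0.
  have dF y : (\int[mu]_b F y b <= (m + 16 * Kb * n.+1%:R)%:E)%E.
    exact: (truncated_square_integral (mdist y) (dist0 y) (dtail y) mw0 Kb0 w0K w01).
  have dG y : (\int[mu]_b G y b <= (Kb * near_power_const 1 * h)%:E)%E.
    exact: (bounded_near_integral (mdist y) (dist0 y) (dtail y) mw0 Kb0 w0K h0).
  have e0 : 0 <= enorm (x - x') by exact: enorm_ge0.
  rewrite (_ : (fun b => _) = (fun b => (enorm (x - x'))%:E * (F x b + F x' b) + 2%:E * (G x b + G x' b))%E); last first.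
    apply/funext => b; rewrite /F /G /g.
    move: (enorm _) (truncated_square (dist x) n b) (truncated_square (dist x') n b)
      (near_power (dist x) 1 h b) (near_power (dist x') 1 h b) `|w0 b| => d' a1 a2 a3 a4 v.
    by apply: (congr1 EFin (y := d' * (v * a1 + v * a2) + 2 * (v * a3 + v * a4))); ring.
  rewrite ge0_integralD//; last 4 first.
  - by move=> b _; apply: mule_ge0; [rewrite lee_fin|exact: adde_ge0].
  - by apply: emeasurable_funM => //; exact: emeasurable_funD.
  - by move=> b _; apply: mule_ge0; [rewrite lee_fin|exact: adde_ge0].
  - by apply: emeasurable_funM => //; exact: emeasurable_funD.
  rewrite ge0_integralZl//; last 2 first.
  - exact: emeasurable_funD.
  - by move=> b _; rewrite adde_ge0.
  rewrite ge0_integralZl//; last 2 first.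
  - exact: emeasurable_funD.
  - by move=> b _; rewrite adde_ge0.
  rewrite !ge0_integralD//.
  apply: (@le_trans _ _ ((enorm (x - x'))%:E * ((m + 16 * Kb * n.+1%:R)%:E + (m + 16 * Kb * n.+1%:R)%:E)
     + 2%:E * ((Kb * near_power_const 1 * h)%:E + (Kb * near_power_const 1 * h)%:E))%E).
    by apply: leeD; (rewrite lee_wpmul2l ?lee_fin//; apply: leeD).
  rewrite -[leLHS]/((enorm (x - x') * ((m + 16 * Kb * n.+1%:R) + (m + 16 * Kb * n.+1%:R))
     + 2 * ((Kb * near_power_const 1 * h) + (Kb * near_power_const 1 * h)))%:E).
  rewrite lee_fin /log_lipschitz_const -/h.
  have h0' := ltW h0; have : 1 <= n.+1%:R :> R by rewrite ler1n.
  move: (n.+1%:R) (enorm _) (near_power_const _) e0 npc0 => N d c d0 c0 N1.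
  rewrite -subr_ge0.
  rewrite (_ : _ - _ = 2 * m * d * (N - 1) + 4 * (Kb * c) * N * d + (2 * m + 32 * Kb) * h); last by ring.
  have N10 : 0 <= N - 1 by rewrite subr_ge0.
  have N0 : 0 <= N := le_trans ler01 N1.
  by nneg.
have fin y := le_lt_trans (singular_velocity_bound y) (ltry velocity_bound).
have [i1 i2] := kernel_integrable (fin x); have [i1' i2'] := kernel_integrable (fin x').
have diff (k k' : R * R -> R) : mu.-integrable setT (EFin \o (fun b => k b * w0 b)) ->
    mu.-integrable setT (EFin \o (fun b => k' b * w0 b)) ->
    (forall b, `|k b - k' b| <= g b) ->
    `|\int[mu]_b (k b * w0 b) - \int[mu]_b (k' b * w0 b)|
      <= log_lipschitz_const * (n.+1%:R * enorm (x - x') + 2 ^- n).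
  move=> ik ik' kg; rewrite -RintegralB//.
  rewrite (_ : (fun b => _) = (fun b => (k b - k' b) * w0 b)); last first.
    by apply/funext => b; rewrite mulrBl.
  apply: (velocity_component_bound _ kg mg B).
  rewrite (_ : (fun b => _) = (fun b => k b * w0 b - k' b * w0 b)); last first.
    by apply/funext => b; rewrite mulrBl.
  exact: integrable_EFinB.
apply: (le_trans (enorm_le_normD _)); rewrite mulrDl mul1r lerD//.
- by apply: diff => // b; apply: le_trans (Kg b); exact: (norm1_le_enorm (_ - _)).
- by apply: diff => // b; apply: le_trans (Kg b); exact: (norm2_le_enorm (_ - _)).
Qed.

End bounded_vorticity.

End LagrangianVelocity.

(** * Flows of log-Lipschitz fields *)

Section TangentExtension.
Context {R : realType}.

Lemma is_derive_slope (f : R -> R) (t l : R) :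
  (forall e : R, 0 < e -> exists2 d : R, 0 < d &
     forall s, s != t -> `|s - t| < d -> `|(f s - f t) / (s - t) - l| < e) ->
  is_derive t 1 f l.
Proof.
move=> H.
have cv : h^-1 *: (f (h *: 1 + t) - f t) @[h --> 0^'] --> l.
  apply/cvgrPdist_lt => e e0; have [d d0 hd] := H e e0.
  near=> h.
  have h0 : h != 0 by near: h; exact: nbhs_dnbhs_neq.
  have hd' : `|h| < d by near: h; apply: dnbhs0_lt.
  rewrite /GRing.scale /= mulr1.
  have := hd (h + t); rewrite addrK distrC mulrC; apply => //.
  by rewrite -subr_eq0 addrK.
by apply: DeriveDef; [apply: cvgP cv|rewrite /derive; apply/cvg_lim].
Unshelve. all: end_near. Qed.

Lemma slope_within (I : set R) (f : R -> R) (t l : R) :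
  (f s - f t) / (s - t) @[s --> within I t^'] --> l ->
  forall e : R, 0 < e -> exists2 d : R, 0 < d &
    forall s, I s -> s != t -> `|s - t| < d -> `|(f s - f t) / (s - t) - l| < e.
Proof.
move=> /cvgrPdist_lt H e e0; have := H e e0.
move=> /nbhs_ballP[d /= d0 hd]; exists d => // s Is st sd.
by rewrite distrC; apply: hd => //; rewrite /ball /= distrC.
Qed.

Definition clamp (T t : R) : R := Num.max 0 (Num.min t T).

Lemma clamp_id (T t : R) : 0 <= t <= T -> clamp T t = t.
Proof. by move=> /andP[t0 tT]; rewrite /clamp min_l// max_r. Qed.

Lemma clamp_itv (T t : R) : 0 <= T -> 0 <= clamp T t <= T.
Proof. by move=> T0; rewrite /clamp le_max lexx /= ge_max T0 ge_min lexx orbT. Qed.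

(* Continues c along its tangents at 0 and T, so that every time in R has a
   two-sided derivative. *)
Definition tangent_extension (T : R) (c v : R -> R) (t : R) : R :=
  c (clamp T t) + (t - clamp T t) * v (clamp T t).

Lemma tangent_extension_id (T : R) c v t : 0 <= t <= T -> tangent_extension T c v t = c t.
Proof. by move=> tT; rewrite /tangent_extension clamp_id// subrr mul0r addr0. Qed.

(** At an end of [0, T] the missing side of the difference quotient is that of a line of slope [v],
    hence exact. *)
Lemma is_derive_tangent_extension (T : R) (I : set R) (c v : R -> R) : 0 <= T ->
  (forall t, 0 <= t <= T -> I t) ->
  (forall t, 0 <= t <= T -> (c s - c t) / (s - t) @[s --> within I t^'] --> v t) ->
  forall t : R, is_derive t 1 (tangent_extension T c v) (v (clamp T t)).
Proof.
move=> T0 IT cv t; apply: is_derive_slope => e e0.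
have cl0 s : s < 0 -> clamp T s = 0.
  by move=> s0; rewrite /clamp min_l ?max_l ?(ltW s0)// (le_trans (ltW s0)).
have clT s : T < s -> clamp T s = T.
  by move=> sT; rewrite /clamp min_r ?max_r// ltW.
have [t0|t0] := ltP t 0.
  exists (- t); first by rewrite oppr_gt0.
  move=> s st; rewrite ltr_norml => /andP[_ h].
  rewrite /tangent_extension !cl0//; last by lra.
  rewrite (_ : _ / _ = v 0) ?subrr ?normr0//.
  by field; rewrite subr_eq0.
have [Tt|tT] := ltP T t.
  exists (t - T); first by rewrite subr_gt0.
  move=> s st; rewrite ltr_norml => /andP[h _].
  rewrite /tangent_extension !clT//; last by lra.
  rewrite (_ : _ / _ = v T) ?subrr ?normr0//.
  by field; rewrite subr_eq0.
have tin : 0 <= t <= T by rewrite t0.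
have [d d0 hd] := slope_within (cv t tin) e0.
(* These radii keep [s] on the same side of 0 and [T] as an interior [t]; at an endpoint the value 1
   is an arbitrary positive number. *)
pose d1 := if 0 < t then t else 1; pose d2 := if t < T then T - t else 1.
have d10 : 0 < d1 by rewrite /d1; case: ifP.
have d20 : 0 < d2 by rewrite /d2; case: ifP => //; rewrite subr_gt0.
exists (Num.min d (Num.min d1 d2)); first by rewrite !lt_min d0 d10.
move=> s st; rewrite !lt_min => /and3P[sd sd1 sd2].
rewrite (clamp_id tin) (tangent_extension_id c v tin).
have [s0|s0] := ltP s 0.
  have t00 : t = 0.
    apply/eqP; rewrite eq_le t0 andbT leNgt; apply/negP => tp.
    by move: sd1; rewrite /d1 tp ltr_norml; lra.
  rewrite /tangent_extension cl0// t00 (_ : _ / _ = v 0) ?subrr ?normr0//.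
  by field; move: st; rewrite t00.
have [Ts|sT] := ltP T s.
  have tTT : t = T.
    apply/eqP; rewrite eq_le tT /= leNgt; apply/negP => tp.
    by move: sd2; rewrite /d2 tp ltr_norml; lra.
  rewrite /tangent_extension clT// tTT (_ : _ / _ = v T) ?subrr ?normr0//.
  by field; move: st; rewrite tTT subr_eq0.
by rewrite tangent_extension_id ?s0//; apply: hd => //; apply: IT; rewrite s0.
Qed.

Definition tangent_extension2 (T : R) (c v : R -> R * R) (t : R) : R * R :=
  (tangent_extension T (fun s => (c s).1) (fun s => (v s).1) t,
   tangent_extension T (fun s => (c s).2) (fun s => (v s).2) t).

Lemma tangent_extension2_id (T : R) c v t : 0 <= t <= T -> tangent_extension2 T c v t = c t.
Proof. by move=> tT; rewrite /tangent_extension2 !tangent_extension_id//; case: (c t). Qed.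

Lemma is_derive_tangent_extension2 (T : R) (I : set R) (c v : R -> R * R) : 0 <= T ->
  (forall t, 0 <= t <= T -> I t) ->
  (forall t, 0 <= t <= T -> velocity_within I c t (v t)) ->
  forall t : R, is_derive t 1 (fun s => (tangent_extension2 T c v s).1) (v (clamp T t)).1 /\
    is_derive t 1 (fun s => (tangent_extension2 T c v s).2) (v (clamp T t)).2.
Proof.
move=> T0 IT cv t; split.
- by apply: (is_derive_tangent_extension T0 IT) => s sT; have [] := cv s sT.
- by apply: (is_derive_tangent_extension T0 IT) => s sT; have [] := cv s sT.
Qed.

(** The backward bound, obtained from -F and -L, is what makes the flow injective. *)
Lemma gronwall_two_sided (F dF : R -> R) (L b s t : R) : s <= t ->
  (forall r : R, is_derive r 1 F (dF r)) ->
  (forall r, s < r < t -> `|dF r| <= L * (F r + b)) ->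
  F t + b <= (F s + b) * expR (L * (t - s)) /\ F s + b <= (F t + b) * expR (L * (t - s)).
Proof.
move=> st FD bd; split.
- have := @nonincreasing_of_derive _ _ _ s t (fun r => is_deriveM_expR b L (FD r)) st.
  have eE : expR (L * (t - s)) = expR (- L * s) / expR (- L * t).
    by rewrite -expRN -expRD; congr expR; ring.
  rewrite eE mulrA ler_pdivlMr ?expR_gt0//; apply=> r rst.
  rewrite pmulr_lle0 ?expR_gt0// subr_le0; apply: le_trans (bd r rst).
  exact: ler_norm.
- have ND (r : R) : is_derive r 1 (fun r => - F r) (- dF r) by exact: is_deriveN.
  have := @nonincreasing_of_derive _ _ _ s t (fun r => is_deriveM_expR (- b) (- L) (ND r)) st.
  have eE : expR (L * (t - s)) = expR (- - L * t) / expR (- - L * s).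
    by rewrite -expRN -expRD; congr expR; ring.
  rewrite eE mulrA ler_pdivlMr ?expR_gt0//.
  rewrite -!opprD !mulNr lerN2; apply=> r rst.
  rewrite -mulNr pmulr_lle0 ?expR_gt0//.
  have := bd r rst; rewrite ler_norml => /andP[h _]; lra.
Qed.

Lemma expr2V_lt (e : R) : 0 < e -> exists n : nat, 2 ^- n < e.
Proof.
move=> e0; exists (Num.bound e^-1).
have h := archi_boundP (ltW (ltac:(by rewrite invr_gt0) : 0 < e^-1)).
rewrite invf_plt ?posrE ?exprn_gt0//; apply: (lt_le_trans h).
by rewrite -natrX ler_nat ltnW// ltn_expl.
Qed.

End TangentExtension.

(** * Injectivity and continuity of the flow *)

Section FlowRegularity.
Context {R : realType}.
Variables (X U : R -> R * R -> R * R) (C V : R).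
Hypotheses (C0 : 0 <= C).
Hypothesis X0 : forall a, X 0 a = a.
Hypothesis dX : forall a t, 0 <= t -> velocity_within future (X ^~ a) t (U t (X t a)).
Hypothesis UV : forall t x, 0 <= t -> enorm (U t x) <= V.
Hypothesis UL : forall t x x' (n : nat), 0 <= t ->
  enorm (U t x - U t x') <= 2 * (C * (n.+1%:R * enorm (x - x') + 2 ^- n)).

Definition flow_extension (T : R) (a : R * R) : R -> R * R :=
  tangent_extension2 T (X ^~ a) (fun t => U t (X t a)).

Lemma flow_extension_id T a t : 0 <= t <= T -> flow_extension T a t = X t a.
Proof. by move=> tT; rewrite /flow_extension tangent_extension2_id. Qed.

Lemma is_derive_flow_extension T a : 0 <= T -> forall t : R,
  is_derive t 1 (fun s => (flow_extension T a s).1) (U (clamp T t) (X (clamp T t) a)).1 /\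
  is_derive t 1 (fun s => (flow_extension T a s).2) (U (clamp T t) (X (clamp T t) a)).2.
Proof.
move=> T0 t; apply: (is_derive_tangent_extension2 (I := future) T0).
- by move=> s /andP[].
- by move=> s /andP[s0 _]; exact: dX.
Qed.

Let s t a a' := sqn (X t a - X t a').

(** With x the distance and h = 2^-n, the derivative of x^2 is at most 4 C x ((n + 1) x + h), and x
    h <= x^2 + h^2; adding b = h^2 makes this linear. *)
Lemma flow_distance_growth a a' (n : nat) t0 t : 0 <= t0 -> t0 <= t ->
  let L := 4 * C * n.+2%:R in let b := (2 ^- n) ^+ 2 in
  s t a a' + b <= (s t0 a a' + b) * expR (L * (t - t0)) /\
  s t0 a a' + b <= (s t a a' + b) * expR (L * (t - t0)).
Proof.
move=> t00 t0t L b; have t_0 := le_trans t00 t0t.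
pose D r := flow_extension t a r - flow_extension t a' r.
pose F r := sqn (D r).
pose dU r := U (clamp t r) (X (clamp t r) a) - U (clamp t r) (X (clamp t r) a').
have FD (r : R) : is_derive r 1 F (2 * dotp (D r) (dU r)).
  have [e1 e2] := is_derive_flow_extension a t_0 r.
  have [d1 d2] := is_derive_flow_extension a' t_0 r.
  exact: (@is_derive_sqn _ D r (dU r) (is_deriveB e1 d1) (is_deriveB e2 d2)).
have Fid r : 0 <= r <= t -> F r = s r a a'.
  by move=> rt; rewrite /F /D !flow_extension_id.
rewrite -!Fid ?lexx ?t00 ?t_0//; apply: (gronwall_two_sided t0t FD) => r /andP[r0 rt].
have rin : 0 <= r <= t by rewrite (ltW rt) (le_trans t00 (ltW r0)).
rewrite normrM ger0_norm//.
have h0 : 0 <= 2 ^- n :> R by rewrite invr_ge0 exprn_ge0.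
have r00 : 0 <= r by case/andP: rin.
have Ule := UL (X r a) (X r a') n r00.
have := dotp_le (D r) (dU r); rewrite /F -enorm_sqr /dU /D clamp_id// !flow_extension_id//.
rewrite /L /b -[n.+2%:R]natr1.
move: Ule h0 (enorm_ge0 (X r a - X r a')) (enorm_ge0 (U r (X r a) - U r (X r a'))).
move: (dotp _ _) (enorm _) (enorm _) (2 ^- n) => d x u h Ule h0 x0 u0 dle.
have N0 : 0 <= n.+1%:R :> R by [].
apply: (@le_trans _ _ (2 * (x * (2 * (C * (n.+1%:R * x + h)))))).
  by rewrite ler_wpM2l// (le_trans dle)// ler_wpM2l.
move: (n.+1%:R) N0 => N N0.
rewrite -subr_ge0 (_ : _ - _ = 4 * C * (N * h ^+ 2 + (x ^+ 2 - x * h + h ^+ 2))); last by ring.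
apply: mulr_ge0; first by nneg.
by apply: addr_ge0; [nneg|nra].
Qed.

(** On a step of this length the exponential is at most 2^(n + 2), so b = 4^-n is amplified only to
    4 / 2^n, which tends to 0: a discrete form of Osgood's argument. The 1 allows for C = 0. *)
Definition flow_step : R := ln 2 / (4 * (C + 1)).

Let C1 : 0 < C + 1. Proof. by rewrite ltr_wpDl. Qed.

Lemma flow_step_gt0 : 0 < flow_step.
Proof. by rewrite divr_gt0 ?mulr_gt0// ln_gt0// ltr1n. Qed.

Lemma flow_distance_step a a' (n : nat) t0 t : 0 <= t0 -> t0 <= t <= t0 + flow_step ->
  s t a a' <= s t0 a a' * 2 ^+ n.+2 + 4 * 2 ^- n /\
  s t0 a a' <= s t a a' * 2 ^+ n.+2 + 4 * 2 ^- n.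
Proof.
move=> t00 /andP[t0t tt].
have := flow_distance_growth a a' n t00 t0t => /=.
set b := (2 ^- n) ^+ 2; set e := expR _.
have b0 : 0 <= b by exact: sqr_ge0.
have eb : e <= 2 ^+ n.+2.
  rewrite -[X in X ^+ _](@lnK R) ?posrE// -expRM_natl ler_expR.
  apply: (@le_trans _ _ (4 * C * n.+2%:R * flow_step)).
    by rewrite ler_wpM2l ?mulr_ge0// lerBlDl.
  rewrite mulrAC mulrC ler_wpM2l// /flow_step mulrCA ger_pMr ?ln_gt0 ?ltr1n//.
  by rewrite ler_pdivrMr ?mulr_gt0// mul1r ler_wpM2l// lerDl.
have be : b * 2 ^+ n.+2 = 4 * 2 ^- n.
  rewrite /b !exprS; field.
  by rewrite expf_neq0.
have s0 r : 0 <= s r a a' by exact: sqn_ge0.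
by move=> [h1 h2]; split;
  [apply: (le_trans (le_trans _ h1)); first by rewrite lerDl
  |apply: (le_trans (le_trans _ h2)); first by rewrite lerDl];
  rewrite -be -mulrDl ler_wpM2l// addr_ge0.
Qed.

Lemma flow_steps_ind (P : R -> Prop) : P 0 ->
  (forall t0 t, 0 <= t0 -> t0 <= t <= t0 + flow_step -> P t0 -> P t) ->
  forall t, 0 <= t -> P t.
Proof.
move=> P0 Pstep t t0; have h := flow_step_gt0.
have key (k : nat) : forall r, 0 <= r <= k%:R * flow_step -> P r.
  elim: k => [|k IH] r.
    by rewrite mul0r -eq_le => /eqP <-.
  rewrite -natr1 mulrDl mul1r => /andP[r0 rk].
  have [rk'|rk'] := leP r (k%:R * flow_step); first by apply: IH; rewrite r0.
  apply: (Pstep (k%:R * flow_step)).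
  - by rewrite mulr_ge0// ltW.
  - by rewrite (ltW rk').
  - by apply: IH; rewrite lexx mulr_ge0// ltW.
apply: (key (Num.bound (t / flow_step))); rewrite t0 /= -ler_pdivrMr//.
by rewrite ltW// archi_boundP// divr_ge0// ltW.
Qed.

(** If two labels meet at [t], the backward estimate bounds their squared distance at the start of
    the step by 4 / 2^n for every [n]. *)
Lemma flow_injective t : 0 <= t -> injective (X t).
Proof.
move: t; apply: flow_steps_ind => [a a'|t0 t t00 tt IH a a' e]; first by rewrite !X0.
apply: IH; apply/eqP; rewrite -subr_eq0 -sqn_eq0 eq_le sqn_ge0 andbT.
apply/ler_addgt0Pr => e' e0; rewrite add0r.
have [n hn] := expr2V_lt (ltac:(by rewrite divr_gt0) : 0 < e' / 4).
have [_] := flow_distance_step a a' n t00 tt.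
rewrite /s e subrr (_ : sqn 0 = 0 :> R); last by apply/eqP; rewrite sqn_eq0.
rewrite mul0r add0r => h; apply: (le_trans h).
by rewrite -ler_pdivlMl// mulrC ltW.
Qed.

Lemma flow_continuous_in_label t : 0 <= t -> forall a (e : R), 0 < e ->
  exists2 d : R, 0 < d & forall a', enorm (a - a') < d -> enorm (X t a - X t a') < e.
Proof.
move: t; apply: flow_steps_ind => [a e e0|t0 t t00 tt IH a e e0].
  by exists e => // a'; rewrite !X0.
have e20 : 0 < e ^+ 2 by rewrite exprn_gt0.
(* First [n] makes the additive error 4 / 2^n less than e^2 / 2; only then is the distance at [t0],
   amplified by 2^(n + 2), made small. *)
have [n hn] := expr2V_lt (ltac:(by rewrite divr_gt0) : 0 < e ^+ 2 / 8).
pose d1 := Num.sqrt (e ^+ 2 / 2 / 2 ^+ n.+2).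
have p0 : 0 < 2 ^+ n.+2 :> R by rewrite exprn_gt0.
have d10 : 0 < e ^+ 2 / 2 / 2 ^+ n.+2 by rewrite !divr_gt0.
have [d d0 hd] := IH a d1 (ltac:(by rewrite sqrtr_gt0)).
exists d => // a' /hd h.
have [h1 _] := flow_distance_step a a' n t00 tt.
rewrite -ltr_sqr ?nnegrE ?enorm_ge0 ?(ltW e0)// enorm_sqr.
apply: (le_lt_trans h1).
have : s t0 a a' < e ^+ 2 / 2 / 2 ^+ n.+2.
  rewrite /s -enorm_sqr -[ltRHS]sqr_sqrtr ?ltW//.
  by rewrite ltr_sqr ?nnegrE ?enorm_ge0 ?sqrtr_ge0.
rewrite ltr_pdivlMr// => h2; move: h2 hn; set u := _ * _ => h2 hn; lra.
Qed.

Lemma flow_lipschitz_in_time a t t' : 0 <= t -> 0 <= t' ->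
  enorm (X t a - X t' a) <= 2 * V * `|t - t'|.
Proof.
move=> t0 t'0; pose T := Num.max t t'.
have T0 : 0 <= T by rewrite le_max t0.
have tin : 0 <= t <= T by rewrite t0 le_max lexx.
have tin' : 0 <= t' <= T by rewrite t'0 le_max lexx orbT.
rewrite -(flow_extension_id a tin) -(flow_extension_id a tin').
apply: (le_trans (enorm_le_normD _)); rewrite -mulrA mulrDl mul1r.
have Uc r : enorm (U (clamp T r) (X (clamp T r) a)) <= V.
  by apply: UV; have /andP[] := clamp_itv r T0.
apply: lerD.
- apply: (@lipschitz_of_derive _ _ (fun r => (U (clamp T r) (X (clamp T r) a)).1)) => r.
    by have [] := is_derive_flow_extension a T0 r.
  exact: le_trans (norm1_le_enorm _) (Uc r).
- apply: (@lipschitz_of_derive _ _ (fun r => (U (clamp T r) (X (clamp T r) a)).2)) => r.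
    by have [] := is_derive_flow_extension a T0 r.
  exact: le_trans (norm2_le_enorm _) (Uc r).
Qed.

End FlowRegularity.

(** * Vorticity carried along by the flow *)

Section Transport.
Context {R : realType}.
Local Notation mu := (@leb2 R).
Local Notation spacetime := (measurableTypeR R * borel2 (R := R))%type.
Variables (X : R -> R * R -> R * R) (V : R).
Hypothesis V0 : 0 <= V.
Hypothesis Xinj : forall t, 0 <= t -> injective (X t).
Hypothesis Xlabel : forall t, 0 <= t -> forall a (e : R), 0 < e ->
  exists2 d : R, 0 < d & forall a', enorm (a - a') < d -> enorm (X t a - X t a') < e.
Hypothesis Xtime : forall a t t', 0 <= t -> 0 <= t' ->
  enorm (X t a - X t' a) <= V * `|t - t'|.

(** Negative times are sent to 0, which gives a map continuous on the whole space. *)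
Let Phi (z : R * (R * R)) : R * (R * R) := (Num.max 0 z.1, X (Num.max 0 z.1) z.2).

Let pos_part_lipschitz (t t' : R) : `|Num.max 0 t - Num.max 0 t'| <= `|t - t'|.
Proof.
by have [t0|t0] := leP 0 t; have [t'0|t'0] := leP 0 t';
  rewrite ?subrr ?normr0 ?subr0 ?sub0r ?normrN// ler_norml;
  apply/andP; split; have := ler_norm (t - t'); have := ler_norm (- (t - t'));
  rewrite normrN ?(ger0_norm t0) ?(ger0_norm t'0); lra.
Qed.

Let Phi_continuous : continuous Phi.
Proof.
move=> [t a]; apply/cvg_ballP => e e0.
set s := Num.max 0 t; have s0 : 0 <= s by rewrite le_max lexx.
have e2 : 0 < e / 2 by rewrite divr_gt0.
have [d d0 hd] := Xlabel s0 a e2.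
have V1 : 0 < V + 1 by rewrite ltr_wpDl.
pose r := Num.min e (Num.min (e / 2 / (V + 1)) (d / 2)).
suff : nbhs ((t, a) : R * (R * R)) [set z | ball (Phi (t, a)) e (Phi z)] by [].
apply/nbhs_ballP; exists r => /=.
  by rewrite !lt_min e0 !divr_gt0.
move=> [t' a'] [/= tt' [aa1 aa2]].
move: tt' aa1 aa2; rewrite /ball /= !lt_min => /and3P[tt1 tt2 _] /and3P[_ _ h1] /and3P[_ _ h2].
set s' := Num.max 0 t'; have s'0 : 0 <= s' by rewrite le_max lexx.
have ss : `|s - s'| <= `|t - t'| by exact: pos_part_lipschitz.
have da : enorm (a - a') < d.
  apply: (le_lt_trans (enorm_le_normD _)); move: h1 h2; rewrite /=; lra.
have ex : enorm (X s a - X s' a') < e.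
  apply: (le_lt_trans (enorm_trans (X s a') _ _)).
  rewrite [ltRHS](splitr e); apply: ltr_leD; first exact: hd.
  apply: (le_trans (Xtime a' s0 s'0)).
  apply: (@le_trans _ _ ((V + 1) * `|t - t'|)).
    by apply: ler_pM => //; rewrite lerDl.
  by rewrite -ler_pdivlMl// mulrC ltW.
split => /=; first exact: le_lt_trans ss tt1.
by split; [apply: le_lt_trans ex; exact: norm1_le_enorm (X s a - X s' a')
          |apply: le_lt_trans ex; exact: norm2_le_enorm (X s a - X s' a')].
Qed.

Definition flow_image (F : set (R * R)) : set (R * (R * R)) :=
  [set z | 0 <= z.1 /\ exists2 a, F a & X z.1 a = z.2].

Lemma measurable_flow_image F : closed F -> measurable (flow_image F : set spacetime).
Proof.
move=> cF.
pose box (n : nat) : set (R * (R * R)) :=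
  `[0, n%:R]%classic `*` ((`[- n%:R, n%:R]%classic `*` `[- n%:R, n%:R]%classic) `&` F).
have cbox n : compact (box n).
  apply: compact_setX; first exact: segment_compact.
  by apply: compact_closedI => //; apply: compact_setX; exact: segment_compact.
rewrite (_ : flow_image F = \bigcup_n (Phi @` box n)).
  apply: bigcupT_measurable => n; apply: closed_measurable3.
  apply: compact_closed; first exact: norm_hausdorff.
  apply: continuous_compact => //; apply: continuous_subspaceT.
  exact: Phi_continuous.
apply/seteqP; split => [[t x] [/= t0 [a Fa <-]]|_ [n _ [[t a] [/= t0n [_ Fa]] <-]]].
  pose n := Num.bound (t + enorm a).
  have nle : t + enorm a <= n%:R by rewrite ltW// archi_boundP// addr_ge0 ?enorm_ge0.
  have a1 := norm1_le_enorm a; have a2 := norm2_le_enorm a.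
  exists n => //; exists (t, a); last by rewrite /Phi /= max_r.
  have := enorm_ge0 a => a0.
  split => /=; first by rewrite in_itv/= t0 /=; lra.
  by split => //; split => /=; rewrite in_itv/= -ler_norml; lra.
move: t0n; rewrite in_itv/= => /andP[t0 _].
by split; rewrite /= ?max_r//; exists a.
Qed.

Definition label (z : R * (R * R)) : R * R := xget 0 [set a | X z.1 a = z.2].

(* Zero off the image of the flow: its surjectivity is not needed. *)
Definition transported (f : R * R -> R) (t : R) (x : R * R) : R :=
  f (label (t, x)) * \1_(flow_image setT) (t, x).

Lemma label_flow t a : 0 <= t -> label (t, X t a) = a.
Proof.
by move=> t0; rewrite /label; case: xgetP => [b _ /(Xinj t0)//|/(_ a)]; case.
Qed.

Lemma transported_flow f t a : 0 <= t -> transported f t (X t a) = f a.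
Proof.
move=> t0; rewrite /transported label_flow// indicE mem_set ?mulr1//.
by split => //; exists a.
Qed.

Lemma transported_neq0 f t x : transported f t x <> 0 -> exists2 a, f a <> 0 & X t a = x.
Proof.
rewrite /transported indicE; case: (boolP (_ \in _)) => [|_]; last by rewrite mulr0.
rewrite inE mulr1 => -[/= t0 [a _ <-]]; rewrite label_flow// => fa.
by exists a.
Qed.

Let label_component (k : R * R -> R) : continuous k ->
  measurable_fun [set: spacetime] (fun z => k (label z) * \1_(flow_image setT) z : R).
Proof.
move=> ck; have mG := measurable_flow_image closedT.
move=> mD; apply: (measurability _ (RGenOInfty.measurableE R)) => //.
move=> /= _ [_ [c ->] <-]; rewrite setTI.
have cF : closed [set a | k a <= c].
  rewrite (_ : [set a | k a <= c] = k @^-1` `]-oo, c]%classic).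
    by move/continuous_closedP: ck; apply; exact: lray_closed.
  by apply/seteqP; split => a; rewrite /= in_itv.
have mF := measurable_flow_image cF.
(* The sublevel set is the flow image of a closed set of labels; off the image the function is 0, so
   the complement belongs to it exactly when 0 <= c. *)
rewrite (_ : _ @^-1` _ = ~` (flow_image [set a | k a <= c] `|`
  (if 0 <= c then ~` flow_image setT else set0))).
  apply: measurableC; apply: measurableU => //.
  by case: ifP => // _; exact: measurableC.
apply/seteqP; split => [[t x]|[t x]] /=; rewrite in_itv/= andbT indicE.
  case: (boolP (_ \in _)); rewrite ?inE ?notin_setE => hG.
    rewrite mulr1 => hk [[/= t0 [a /= ac ax]]|].
      by move: hk; rewrite -ax label_flow// ltNge ac.
    by case: ifP.
  rewrite mulr0 => c0 [[/= t0 [a _ ax]]|]; first by apply: hG; split => //; exists a.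
  by rewrite leNgt c0.
move=> /not_orP[h1 h2]; case: (boolP (_ \in _)); rewrite ?inE ?notin_setE => hG.
  have [/= t0 [a _ ax]] := hG; rewrite mulr1 ltNge; apply/negP => kc; apply: h1.
  by split => //; exists a => //=; move: kc; rewrite -ax label_flow.
rewrite mulr0 ltNge; apply/negP => c0; apply: h2.
by rewrite c0.
Qed.

Lemma measurable_transported_spacetime f : measurable2 f ->
  measurable_fun [set: spacetime] (fun z => transported f z.1 z.2 : R).
Proof.
move=> mf; have mG := measurable_flow_image closedT.
(* The label extended by zero is measurable; off the image, where it is 0, the indicator removes the
   value of [f]. *)
pose l (z : spacetime) : borel2 (R := R) :=
  ((label z).1 * \1_(flow_image setT) z, (label z).2 * \1_(flow_image setT) z).
have ml : measurable_fun setT l.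
  by apply: measurable_fun_pair; [apply: (label_component (k := fst))
    |apply: (label_component (k := snd))]; move=> a; [exact: cvg_fst|exact: cvg_snd].
rewrite (_ : (fun z => _) = (fun z => f (l z) * \1_(flow_image setT) z)).
  apply: measurable_funM; first exact: (measurableT_comp mf ml).
  exact: measurable_indic.
apply/funext => -[t x]; rewrite /transported /l /= indicE.
by case: (_ \in _); rewrite ?mulr0// !mulr1; case: (label _).
Qed.

Lemma spacetime_measurable_transported f : measurable2 f ->
  spacetime_measurable (transported f).
Proof. by move=> mf; apply: measurable_funTS; exact: measurable_transported_spacetime. Qed.

Lemma measurable2_transported f t : measurable2 f -> measurable2 (transported f t).
Proof.
move=> /measurable_transported_spacetime mf.
have ms : measurable_fun [set: borel2 (R := R)] (fun x => (t, x) : spacetime).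
  by apply: measurable_fun_pair.
exact: (measurableT_comp mf ms).
Qed.

Hypothesis Xmp : forall t, 0 <= t -> measure_preserving (X t).

Lemma transported_Lnorm2 f t r : measurable2 f -> 0 <= t -> (1 <= r)%E ->
  Lnorm2 r (transported f t) = Lnorm2 r f.
Proof.
move=> mf t0 r1; apply: (mp_Lnorm2 (Xmp t0) (@measurable2_transported f t mf)) => // b.
exact: transported_flow.
Qed.

Lemma transported_total_vorticity f t : measurable2 f -> 0 <= t ->
  total_vorticity (transported f t) = total_vorticity f.
Proof.
move=> mf t0; rewrite /total_vorticity /Rintegral; congr fine.
have mt : measurable_fun [set: borel2] (EFin \o transported f t : borel2 -> \bar R).
  by apply/measurable_EFinP; exact: measurable2_transported.
rewrite (mp_integral (Xmp t0) mt); congr (integral mu setT _).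
by apply/funext => b; rewrite [LHS]/= transported_flow.
Qed.

Lemma transported_integrable f t : measurable2 f -> 0 <= t ->
  mu.-integrable setT (EFin \o f) -> mu.-integrable setT (EFin \o transported f t).
Proof.
move=> mf t0 /integrableP[_ fi].
have mt : measurable_fun [set: borel2] (EFin \o transported f t : borel2 -> \bar R).
  by apply/measurable_EFinP; exact: measurable2_transported.
apply/integrableP; split => //.
have ma : measurable_fun [set: borel2] (fun x => `|(EFin \o transported f t) x| : \bar R)%E.
  exact: measurableT_comp.
rewrite (mp_integral (Xmp t0) ma).
rewrite (_ : (fun b => _) = (fun b => `|(EFin \o f) b|%E))//.
by apply/funext => b; rewrite /= transported_flow.
Qed.

End Transport.

(** * Concentrated vorticity *)

Lemma Lnorm_le_pointwise d (T : measurableType d) (R : realType)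
    (nu : {measure set T -> \bar R}) (f g : T -> R) (q : R) : 0 < q ->
  measurable_fun setT f -> measurable_fun setT g -> (forall x, `|f x| <= `|g x|) ->
  ('N[nu]_q%:E[EFin \o f] <= 'N[nu]_q%:E[EFin \o g])%E.
Proof.
move=> q0 mf mg fg; rewrite unlock.
have mp (h : T -> R) : measurable_fun setT h ->
    measurable_fun setT (fun x => `|(EFin \o h) x| `^ q : \bar R)%E.
  move=> mh; apply/measurable_EFinP.
  by apply: (@measurableT_comp _ _ _ _ _ _ (fun z : R => z `^ q)) => //; exact: measurableT_comp.
have I0 (h : T -> R) : (0 <= \int[nu]_x (`|(EFin \o h) x| `^ q))%E.
  by apply: integral_ge0 => x _; exact: poweR_ge0.
apply: gt0_ler_poweR; rewrite ?invr_ge0 ?(ltW q0)//.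
- by rewrite in_itv/= I0 leey.
- by rewrite in_itv/= I0 leey.
apply: ge0_le_integral => //; [by move=> x _; exact: poweR_ge0|exact: mp|exact: mp|].
move=> x _; rewrite !abse_EFin !poweR_EFin lee_fin.
by apply: ge0_ler_powR => //; exact: ltW.
Qed.

Section Density.
Context d (T : measurableType d) (R : realType).
Variables (mu : {measure set T -> \bar R}) (P : probability T R) (f : T -> R).
Hypotheses (f0 : forall x, 0 <= f x).
Hypothesis fP : forall g : T -> \bar R, (forall x, 0 <= g x)%E ->
  measurable_fun [set: T] g -> (\int[P]_x g x = \int[mu]_x (g x * (f x)%:E))%E.

Lemma Rintegral_density (h : T -> R) : measurable_fun setT h ->
  \int[P]_x h x = \int[mu]_x (h x * f x).
Proof.
move=> mh; rewrite /Rintegral; congr fine.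
have mh' : measurable_fun [set: T] (EFin \o h) by exact/measurable_EFinP.
rewrite integralE [RHS]integralE; congr (_ - _)%E.
- rewrite (fP (funepos_ge0 _) (measurable_funepos mh')).
  congr (integral mu setT _); apply/funext => x.
  rewrite !unlock /=; have [hx|/ltW hx] := leP 0 (h x).
    by rewrite !max_l ?lee_fin ?mulr_ge0// -EFinM.
  by rewrite !max_r ?lee_fin ?mul0e// mulr_le0_ge0.
- rewrite (fP (funeneg_ge0 _) (measurable_funeneg mh')).
  congr (integral mu setT _); apply/funext => x.
  rewrite !unlock /=; have [hx|/ltW hx] := leP 0 (h x).
    by rewrite !max_r ?lee_fin ?mul0e ?oppr_le0 ?mulr_ge0.
  by rewrite !max_l ?lee_fin ?oppr_ge0 ?mulr_le0_ge0// -EFinM mulNr.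
Qed.

End Density.

Section PlanarVorticity.
Context {R : realType}.
Local Notation mu := (@leb2 R).
Local Notation K := (@biot_savart_kernel R).

Lemma ae_of_null (Q : R * R -> Prop) : mu setT = 0%E -> {ae mu, forall x, Q x}.
Proof. by move=> m0; exists setT; split => //; exact: measurableT. Qed.

Lemma L1_Loo_bounds (f : R * R -> R) : in_L1_Loo f -> exists Kb m : R,
  [/\ 0 <= Kb, 0 <= m, {ae mu, forall x, `|f x| <= Kb} & (\int[mu]_x `|f x|%:E <= m%:E)%E].
Proof.
case=> mf f1 foo.
have [Kb [Kb0 fK]] : exists Kb, 0 <= Kb /\ {ae mu, forall x, `|f x| <= Kb}.
  (* The norm of exponent +oo is defined by cases on the mass of the plane; in the null case every
     property holds almost everywhere. *)
  move: foo; rewrite /Lnorm2 unlock; case: ifPn => [_|]; last first.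
    rewrite -leNgt measure_le0 => /eqP m0 _; exists 0; split => //; exact: ae_of_null.
  have := ess_sup_ge mu (abse \o (EFin \o f)).
  case: (ess_sup _ _) => [r h _|//|h _].
    exists (Num.max 0 r); split; first by rewrite le_max lexx.
    by apply: ae_imply h => x; rewrite [(_ \o _) _]/= lee_fin => /le_trans; apply; rewrite le_max lexx orbT.
  by exists 0; split => //; apply: ae_imply h.
exists Kb; exists (fine (Lnorm2 1 f)).
have L0 : (0 <= Lnorm2 1 f)%E by exact: Lnorm_ge0.
split => //; first exact: fine_ge0.
rewrite fineK ?ge0_fin_numE// /Lnorm2 Lnorm1; apply: ge0_le_integral => //.
- by apply/measurable_EFinP; exact: measurableT_comp.
- by apply: measurableT_comp => //; exact/measurable_EFinP.
Qed.

Lemma spacetime_measurable_section (w : R -> R * R -> R) t : spacetime_measurable w ->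
  0 <= t -> measurable2 (w t).
Proof.
move=> mw t0.
have mfut : measurable (future `*` setT : set (measurableTypeR R * borel2 (R := R))).
  apply: measurableX => //; rewrite (_ : future = `[0, +oo[%classic); first exact: measurable_itv.
  by apply/seteqP; split => s; rewrite /future /= in_itv/= andbT.
have mp : measurable_fun [set: borel2 (R := R)]
    (fun x => (t, x) : (measurableTypeR R * borel2 (R := R))%type).
  exact: measurable_fun_pair.
apply: (measurable_comp mfut _ mw mp).
by move=> _ [x _ <-].
Qed.

Lemma signed_vorticity (f : R * R -> R) : measurable2 f -> no_sign_change f ->
  total_vorticity f != 0 -> exists s : R, [/\ `|s| = 1, {ae mu, forall x, f x = s * `|f x|},
    (\int[mu]_x `|f x|%:E = `|total_vorticity f|%:E)%E & total_vorticity f = s * `|total_vorticity f|].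
Proof.
move=> mf sf f0.
have mnf : measurable_fun [set: borel2] (fun x => `|f x|%:E : \bar R).
  by apply/measurable_EFinP; exact: measurableT_comp.
have mEf : measurable_fun [set: borel2] (EFin \o f : borel2 -> \bar R) by exact/measurable_EFinP.
set I := (\int[mu]_x `|f x|%:E)%E.
have I0 : (0 <= I)%E by apply: integral_ge0 => x _; rewrite lee_fin.
case: sf => sf.
- have e : total_vorticity f = fine I.
    rewrite /total_vorticity /Rintegral; congr fine; apply: ae_eq_integral => //.
    by apply: ae_imply sf => x fx _; rewrite [LHS]/= ger0_norm.
  (* [fine] sends +oo to 0, so a nonzero total vorticity excludes an infinite integral. *)
  have If : I \is a fin_num.
    by move: f0; rewrite e; case: (I) I0 => //=; rewrite eqxx.
  exists 1; rewrite normr1 mul1r e ger0_norm ?fine_ge0//; split => //.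
  + by apply: ae_imply sf => x fx; rewrite mul1r ger0_norm.
  + by rewrite fineK.
- have e : total_vorticity f = - fine I.
    rewrite /total_vorticity /Rintegral -fineN; congr fine.
    rewrite -integral_ge0N//; apply: ae_eq_integral => //.
      exact: measurableT_comp.
    by apply: ae_imply sf => x fx _; rewrite [LHS]/= ler0_norm// -EFinN opprK.
  have If : I \is a fin_num.
    by move: f0; rewrite e; case: (I) I0 => //=; rewrite oppr0 eqxx.
  exists (- 1); rewrite normrN1 e normrN ger0_norm ?fine_ge0// !mulN1r; split => //.
  + by apply: ae_imply sf => x fx; rewrite mulN1r ler0_norm ?opprK.
  + by rewrite fineK.
Qed.

Lemma vorticity_localized (f : R * R -> R) p r : measurable2 f -> esupp f `<=` eball p r ->
  let g x := f x * \1_(eball p r) x in measurable2 g /\ {ae mu, forall x, f x = g x}.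
Proof.
move=> mf sf g; split.
  by apply: measurable_funM => //; apply: measurable_indic; exact: measurable_eball.
have [N [mN N0 sN]] := negligible_setC_esupp f.
exists N; split => // x /= fg; apply: sN; split => [/sf bx|f0].
  by apply: fg; rewrite /g indicE mem_set// mulr1.
by apply: fg; rewrite /g f0 mul0r.
Qed.

Lemma leb2_sigma_finite : sigma_finite [set: borel2] mu.
Proof.
pose F (n : nat) : set (borel2 (R := R)) := [set y | enorm (0 - y) < n.+1%:R].
exists F.
  apply/esym/seteqP; split => // y _; exists (Num.bound (enorm (0 - y))) => //.
  rewrite /F /=; apply: (lt_le_trans (archi_boundP (enorm_ge0 _))).
  by rewrite ler_nat.
move=> n; split; first by apply: measurable_set_lt => //; exact: measurable_dist.
by apply: (le_lt_trans (leb2_eball 0 _)); rewrite ?ltry.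
Qed.

(* A copy of leb2 on which the sigma-finite structure can be inferred. *)
Definition planar_lebesgue : set (borel2 (R := R)) -> \bar R := mu.
HB.instance Definition _ := Measure.on planar_lebesgue.
HB.instance Definition _ :=
  @Measure_isSigmaFinite.Build _ _ R planar_lebesgue leb2_sigma_finite.

Section velocity_split.
Variables (Y : R * R -> R * R) (x : R * R) (M : nat).
Variables (w : R * R -> R) (g : 'I_M -> R * R -> R) (h : R * R -> R).
Hypothesis mY : measure_preserving Y.
Hypotheses (mw : measurable2 w) (mg : forall l, measurable2 (g l)) (mh : measurable2 h).
Hypothesis sumE : {ae mu, forall b, w b = \sum_(l < M) g l b + h b}.
Hypothesis sg : forall l, (\int[mu]_b (`|g l b| / enorm (x - Y b))%:E < +oo)%E.
Hypothesis sh : (\int[mu]_b (`|h b| / enorm (x - Y b))%:E < +oo)%E.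

Lemma lagrangian_velocity_split : lagrangian_velocity Y w x =
  (\sum_(l < M) (lagrangian_velocity Y (g l) x).1 + (lagrangian_velocity Y h x).1,
   \sum_(l < M) (lagrangian_velocity Y (g l) x).2 + (lagrangian_velocity Y h x).2).
Proof.
have [mk1 mk2] := measurable_kernel_mp mY x.
have aux (k : R * R -> R) : measurable2 k ->
    (forall l, mu.-integrable setT (EFin \o (fun b => k b * g l b))) ->
    mu.-integrable setT (EFin \o (fun b => k b * h b)) ->
    \int[mu]_b (k b * w b) = \sum_(l < M) \int[mu]_b (k b * g l b) + \int[mu]_b (k b * h b).
  move=> mk ig ih.
  have is_ : mu.-integrable setT (EFin \o (fun b => \sum_(l < M) k b * g l b)).
    rewrite (_ : EFin \o _ = (fun b => \sum_(l < M) (k b * g l b)%:E)%E).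
      by apply: integrable_sum => // l _; exact: ig.
    by apply/funext => b; rewrite /= sumEFin.
  transitivity (\int[mu]_b (\sum_(l < M) k b * g l b + k b * h b)).
    rewrite /Rintegral; congr fine; apply: ae_eq_integral => //.
    - by apply/measurable_EFinP; exact: measurable_funM.
    - apply/measurable_EFinP; apply: measurable_funD; last exact: measurable_funM.
      by apply: measurable_sum => l; apply: measurable_funM; [exact: mk|exact: mg].
    - by apply: ae_imply sumE => b wb _; rewrite [LHS]/= [RHS]/= wb mulrDr mulr_sumr.
  rewrite RintegralD//; congr (_ + _).
  exact: Rintegral_sum.
have ki l := kernel_integrable mY (mg l) (sg l).
have [kh1 kh2] := kernel_integrable mY mh sh.
rewrite /lagrangian_velocity /=; congr pair; apply: aux => //.
- by move=> l; case: (ki l).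
- by move=> l; case: (ki l).
Qed.

End velocity_split.

(** * One signed piece of vorticity as a probability on labels *)

Section signed_blob.
Variables (f : R * R -> R) (p : R * R) (r : R).
Hypotheses (mf : measurable2 f) (r0 : 0 < r).
Hypotheses (sf : no_sign_change f) (suf : esupp f `<=` eball p r).
Hypothesis f0 : total_vorticity f != 0.

Definition localized (x : R * R) : R := f x * \1_(eball p r) x.
Local Notation g := localized.

(* Labels outside the disc carry no vorticity; sending them to the center keeps
   the cloud bounded. *)
Definition blob_label (b : R * R) : R * R := if enorm (b - p) < r then b else p.

Lemma measurable_localized : measurable2 localized.
Proof. by have [] := vorticity_localized mf suf. Qed.

Lemma localized_ae : {ae mu, forall x, f x = localized x}.
Proof. by have [] := vorticity_localized mf suf. Qed.

Lemma blob_label_ball b : enorm (blob_label b - p) < r.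
Proof. by rewrite /blob_label; case: ifPn => // _; rewrite subrr enorm0. Qed.

Lemma blob_label_id b : enorm (b - p) < r -> blob_label b = b.
Proof. by rewrite /blob_label => ->. Qed.

Lemma localized_label b : localized b != 0 -> blob_label b = b.
Proof.
rewrite /localized indicE; case: (boolP (_ \in _)) => [|_]; last by rewrite mulr0 eqxx.
by rewrite inE => bb _; exact: blob_label_id.
Qed.

Lemma localized_le x : `|localized x| <= `|f x|.
Proof.
rewrite /localized normrM -[leRHS]mulr1 ler_wpM2l// indicE.
by case: (_ \in _); rewrite ?normr1 ?normr0.
Qed.

Lemma measurable_blob_label : measurable_fun [set: borel2] (blob_label : borel2 -> borel2).
Proof.
have lt : measurable_fun [set: borel2] (fun b : borel2 (R := R) => enorm ((b : R * R) - p) < r).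
  apply: measurable_fun_ltr => //.
  rewrite (_ : (fun x => _) = (fun x => enorm (p - x))); first exact: measurable_dist.
  by apply/funext => x; rewrite enormBC.
exact: (measurable_fun_ifT lt (@measurable_id _ _ _) (@measurable_cst _ _ _ _ _ (p : borel2))).
Qed.

Lemma localized_mass : (\int[mu]_x `|g x|%:E = `|total_vorticity f|%:E)%E.
Proof.
have [s [_ _ <- _]] := signed_vorticity mf sf f0.
apply: ae_eq_integral => //.
- by apply/measurable_EFinP; apply: measurableT_comp => //; exact: measurable_localized.
- by apply/measurable_EFinP; exact: measurableT_comp.
- by apply: ae_imply localized_ae => x <-.
Qed.

Let F := `|total_vorticity f|.
Let F0 : 0 < F. Proof. by rewrite normr_gt0. Qed.

Lemma blob_probability : exists P : probability (borel2 (R := R)) R,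
  forall h : R * R -> \bar R, (forall x, 0 <= h x)%E -> measurable_fun [set: borel2] (h : borel2 -> \bar R) ->
  (\int[P]_x h x = \int[mu]_x (h x * (`|g x| / F)%:E))%E.
Proof.
have m1 : measurable_fun [set: borel2] (fun x => `|g x| / F : R).
  by apply: measurable_funM => //; apply: measurableT_comp => //; exact: measurable_localized.
have i1 : (\int[mu]_x (`|g x| / F)%:E = 1)%E.
  rewrite (_ : (fun x => _) = (fun x => (F^-1)%:E * `|g x|%:E)%E); last first.
    by apply/funext => x; rewrite -EFinM mulrC.
  rewrite ge0_integralZl//; last 2 first.
  - by apply/measurable_EFinP; apply: measurableT_comp => //; exact: measurable_localized.
  - by rewrite lee_fin invr_ge0 ltW.
  by rewrite localized_mass -EFinM mulVf ?gt_eqF.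
apply: (@ge0_density_prob _ _ R planar_lebesgue (fun x => `|g x| / F)).
- by move=> x; rewrite divr_ge0// ltW.
- apply/integrableP; split; first exact/measurable_EFinP.
  rewrite (_ : (fun x => _) = (fun x => (`|g x| / F)%:E)); last first.
    by apply/funext => x; rewrite /= ger0_norm// divr_ge0// ltW.
  by rewrite i1 ltry.
- exact: i1.
Qed.

Section blob_law.
Variable P : probability (borel2 (R := R)) R.
Hypothesis lawP : forall h : R * R -> \bar R, (forall x, 0 <= h x)%E ->
  measurable_fun [set: borel2] (h : borel2 -> \bar R) ->
  (\int[P]_x h x = \int[mu]_x (h x * (`|g x| / F)%:E))%E.
Variable Y : R * R -> R * R.
Hypothesis mY : measure_preserving Y.

(** With a constant sign [s], both [g] and the circulation equal [s] times their absolute values, so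
    [g] is the circulation times the density |g| / F. *)
Lemma blob_velocity x : (\int[mu]_b (`|g b| / enorm (x - Y b))%:E < +oo)%E ->
  lagrangian_velocity Y g x =
  (total_vorticity f * (blob_field P (Y \o blob_label) x).1,
   total_vorticity f * (blob_field P (Y \o blob_label) x).2).
Proof.
move=> sing; have mg := measurable_localized.
have [ik1 ik2] := kernel_integrable mY mg sing.
have [s [s1 sae _ sG]] := signed_vorticity mf sf f0.
have mYl : measurable_fun [set: borel2] (Y \o blob_label : borel2 -> borel2).
  exact: (measurableT_comp mY.1 measurable_blob_label).
have [mk1 mk2] : measurable_fun [set: borel2] (fun b : borel2 (R := R) => (K (x - Y (blob_label b))).1 : R) /\
    measurable_fun [set: borel2] (fun b : borel2 (R := R) => (K (x - Y (blob_label b))).2 : R).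
  apply: measurable_kernel => /=; apply: measurable_funB => //.
    exact: (measurableT_comp measurable_fst2 mYl).
  exact: (measurableT_comp measurable_snd2 mYl).
have G0 := f0.
have aux (k : R * R -> R) : measurable_fun [set: borel2] (fun b : borel2 (R := R) => k (x - Y (blob_label b)) : R) ->
    mu.-integrable setT (EFin \o (fun b => k (x - Y b) * g b)) ->
    \int[mu]_b (k (x - Y b) * g b) =
    total_vorticity f * \int[P]_b (k (x - Y (blob_label b))).
  move=> mk ik.
  have f0' b : 0 <= `|g b| / F by rewrite divr_ge0// ltW.
  rewrite (@Rintegral_density _ (borel2 (R := R)) R mu P (fun b => `|g b| / F) f0' lawP _ mk).
  transitivity (total_vorticity f * \int[mu]_b ((total_vorticity f)^-1 * (k (x - Y b) * g b))).
    by rewrite RintegralZl// mulrA divff ?mul1r.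
  congr (_ * _); rewrite /Rintegral; congr fine; apply: ae_eq_integral => //.
  - have /integrableP[/measurable_EFinP mi _] := ik.
    by apply/measurable_EFinP; exact: measurable_funM.
  - apply/measurable_EFinP; apply: measurable_funM => //; apply: measurable_funM => //.
    exact: measurableT_comp.
  - have := ae_conj sae localized_ae; apply: ae_imply => b [sb gb] _.
    rewrite [LHS]/= [RHS]/=; congr EFin.
    have [gb0|gb0] := eqVneq (g b) 0; first by rewrite gb0 normr0 mul0r !mulr0.
    rewrite (localized_label gb0) mulrCA; congr (_ * _).
    move: sb; rewrite gb; move: (g b) => v ->; rewrite normrM s1 mul1r normr_id sG.
    have s0 : s != 0 by rewrite -normr_gt0 s1.
    by rewrite invfM -/F mulrACA mulVf// mul1r mulrC.
by congr pair; [exact: (aux (fun z => (K z).1) mk1 ik1)|exact: (aux (fun z => (K z).2) mk2 ik2)].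
Qed.

(** The singular bound for [g] restricted to [S], of mass F P(S), divided by [F]. This is where the
    exponent [theta] originates. *)
Lemma blob_singular_integral x q N (S : set (R * R)) : 2 < q -> 0 < N ->
  (Lnorm2 q%:E f <= N%:E)%E -> measurable (S : set borel2) ->
  (\int[P]_(b in S) (enorm (x - Y (blob_label b)))^-1%:E <=
    (velocity_const q * F `^ ((q - 2) / (2 * q - 2) - 1)
      * fine (P S) `^ ((q - 2) / (2 * q - 2)) * N `^ (q / (2 * q - 2)))%:E)%E.
Proof.
move=> q2 N0 fN mS; have mg := measurable_localized.
have mYl : measurable_fun [set: borel2] (Y \o blob_label : borel2 -> borel2).
  exact: (measurableT_comp mY.1 measurable_blob_label).
have md : measurable_fun [set: borel2] (fun b : borel2 (R := R) => (enorm (x - Y (blob_label b)))^-1 : R).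
  apply: (measurableT_comp measurable_invr); apply: measurable_enorm => /=; apply: measurable_funB => //.
    exact: (measurableT_comp measurable_fst2 mYl).
  exact: (measurableT_comp measurable_snd2 mYl).
have m1S : measurable_fun [set: borel2] (\1_S : borel2 -> R) by exact: measurable_indic.
have iV : (\int[P]_(b in S) (enorm (x - Y (blob_label b)))^-1%:E =
    \int[P]_b ((enorm (x - Y (blob_label b)))^-1 * \1_S b)%:E)%E.
  rewrite integral_mkcond; congr (integral P setT _); apply/funext => b.
  rewrite patchE indicE; case: (_ \in _); by rewrite ?mulr1 ?mulr0.
rewrite iV lawP; last 2 first.
- by move=> b; rewrite lee_fin mulr_ge0// invr_ge0 enorm_ge0.
- by apply/measurable_EFinP; exact: measurable_funM.
pose h b := g b * \1_S b.
have mh : measurable2 h by exact: measurable_funM.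
have hN : ('N[mu]_q%:E[EFin \o h] <= N%:E)%E.
  apply: le_trans fN; apply: Lnorm_le_pointwise => //; first exact: lt_trans q2.
  move=> b; apply: le_trans (localized_le b).
  rewrite /h normrM -[leRHS]mulr1 ler_wpM2l// indicE.
  by case: (_ \in _); rewrite ?normr1 ?normr0.
have PS : P S = ((F^-1)%:E * \int[mu]_b `|h b|%:E)%E.
  rewrite -[S in LHS]setIT -integral_indic// lawP; last 2 first.
  - by move=> b; rewrite lee_fin.
  - exact/measurable_EFinP.
  rewrite -ge0_integralZl//; last 2 first.
  - by apply/measurable_EFinP; exact: measurableT_comp.
  - by rewrite lee_fin invr_ge0 ltW.
  congr (integral mu setT _); apply/funext => b; rewrite -!EFinM; congr EFin.
  rewrite (_ : `|h b| = \1_S b * `|g b|); last by rewrite /h mulrC normrM ger0_norm.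
  by rewrite mulrA mulrC.
have Pf : P S \is a fin_num by exact: fin_num_measure.
have hS : (\int[mu]_b `|h b|%:E = (F * fine (P S))%:E)%E.
  rewrite EFinM fineK// PS muleA -EFinM divff ?mul1e// gt_eqF//.
have mS0 : 0 <= F * fine (P S) by rewrite mulr_ge0 ?fine_ge0 ?(ltW F0).
have := @singular_integral_bound _ _ R mu _ (mp_measurable_dist mY x)
  (fun b => enorm_ge0 _) (fun r r0 => mp_dist_tail mY x r0) h q N mh q2 N0 hN _ mS0.
rewrite hS => /(_ (lexx _)) H.
apply: (@le_trans _ _ ((F^-1)%:E * \int[mu]_b (`|h b| / enorm (x - Y b))%:E)%E).
  rewrite -ge0_integralZl//; last 3 first.
  - apply/measurable_EFinP; apply: measurable_funM; first exact: measurableT_comp.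
    exact: (measurableT_comp measurable_invr (mp_measurable_dist mY x)).
  - by move=> b _; rewrite lee_fin divr_ge0 ?enorm_ge0.
  - by rewrite lee_fin invr_ge0 ltW.
  rewrite le_eqVlt; apply/orP; left; apply/eqP.
  congr (integral mu setT _); apply/funext => b; rewrite -!EFinM; congr EFin.
  have [gb0|gb0] := eqVneq (g b) 0; first by rewrite /h gb0 mul0r normr0 !mul0r !mulr0.
  rewrite (localized_label gb0) (_ : `|h b| = \1_S b * `|g b|); last by rewrite /h mulrC normrM ger0_norm.
  by ring.
apply: (@le_trans _ _ ((F^-1)%:E * (velocity_const q * (N `^ (q / (2 * q - 2)) *
   (F * fine (P S)) `^ ((q - 2) / (2 * q - 2))))%:E)%E).
  by rewrite lee_wpmul2l// lee_fin invr_ge0 ltW.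
rewrite -EFinM lee_fin powRM ?fine_ge0 ?(ltW F0)//.
rewrite powRD; last by rewrite (gt_eqF F0) implybT.
rewrite powR_inv1 ?(ltW F0)//.
by rewrite le_eqVlt; apply/orP; left; apply/eqP; ring.
Qed.

End blob_law.

End signed_blob.

End PlanarVorticity.

Section YudovichFlow.
Context {R : realType}.
Local Notation mu := (@leb2 R).
Local Notation K := (@biot_savart_kernel R).

(** Everything is phrased through the initial vorticity and the flow; the solution itself no longer
    appears. *)
Record regular_flow (w0 : R * R -> R) (X : R -> R * R -> R * R) (C V : R) : Prop := {
  rf_C0 : 0 <= C;
  rf_start : forall a, X 0 a = a;
  rf_velocity : forall a t, 0 <= t ->
    velocity_within future (X ^~ a) t (lagrangian_velocity (X t) w0 (X t a));
  rf_bound : forall t x, 0 <= t -> enorm (lagrangian_velocity (X t) w0 x) <= V;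
  rf_log_lipschitz : forall t x x' (n : nat), 0 <= t ->
    enorm (lagrangian_velocity (X t) w0 x - lagrangian_velocity (X t) w0 x')
    <= 2 * (C * (n.+1%:R * enorm (x - x') + 2 ^- n));
  rf_preserving : forall t, 0 <= t -> measure_preserving (X t) }.

Lemma yudovich_regular_flow (w0 : R * R -> R) (w : R -> R * R -> R) :
  in_L1_Loo w0 -> yudovich_solution w0 w ->
  exists X C V, regular_flow w0 X C V /\
    forall t, 0 <= t -> {ae mu, forall a, w t (X t a) = w0 a}.
Proof.
move=> w0b [[mw _ _] [X [fX mpX trX]]].
have [mw0 _ _] := w0b.
have [Kb [m [Kb0 m0 w0K w01]]] := L1_Loo_bounds w0b.
exists X, (log_lipschitz_const Kb m), (2 * velocity_bound Kb m); split => //.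
have npc0 : 0 <= near_power_const 1 :> R by apply: near_power_const_ge0; rewrite ltr1n.
split => //.
- by rewrite /log_lipschitz_const; nneg.
- by move=> a; have [] := fX a.
- move=> a t t0; have [_ /(_ t t0)] := fX a.
  rewrite (velocity_lagrangian (mpX t t0) mw0) => //; last exact: trX.
  exact: spacetime_measurable_section.
- move=> t x t0; apply: (lagrangian_velocity_le (mpX t t0) mw0).
  exact: (singular_velocity_bound (mpX t t0) mw0 Kb0 w0K w01).
- move=> t x x' n t0.
  exact: (lagrangian_velocity_log_lipschitz (mpX t t0) mw0 Kb0 w0K w01).
Qed.

Section flow_measurability.
Variables (w0 : R * R -> R) (X : R -> R * R -> R * R) (C V : R).
Hypothesis RF : regular_flow w0 X C V.
Let U t := lagrangian_velocity (X t) w0.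

(** The velocity along trajectories is a pointwise limit of difference quotients in time, each
    measurable in the label. *)
Lemma measurable_flow_velocity t : 0 <= t ->
  measurable_fun [set: borel2] (fun a : borel2 (R := R) => (U t (X t a)).1 : R) /\
  measurable_fun [set: borel2] (fun a : borel2 (R := R) => (U t (X t a)).2 : R).
Proof.
move=> t0.
have aux (k : R * R -> R) : (forall s, 0 <= s -> measurable_fun [set: borel2] (fun a : borel2 (R := R) => k (X s a) : R)) ->
    (forall a, (k (X s a) - k (X t a)) / (s - t) @[s --> within future t^'] --> k (U t (X t a))) ->
    measurable_fun [set: borel2] (fun a : borel2 (R := R) => k (U t (X t a)) : R).
  move=> mk kU.
  (* Forward increments stay in the future, also for t = 0. *)
  pose s (n : nat) : R := t + n.+1%:R^-1.
  have sn n : 0 <= s n by rewrite addr_ge0.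
  apply: (@measurable_fun_cvg _ _ R setT (fun n a => (k (X (s n) a) - k (X t a)) / (s n - t))).
    move=> n; apply: measurable_funM => //; apply: measurable_funB; exact: mk.
  move=> a _; apply/cvgrPdist_lt => e e0.
  have [d d0 hd] := slope_within (kU a) e0.
  near=> n; rewrite distrC; apply: hd => //.
    exact: sn.
    by rewrite -subr_eq0 /s addrAC subrr add0r invr_eq0 pnatr_eq0.
  rewrite /s addrAC subrr add0r ger0_norm//.
  by near: n; exact: (near_infty_natSinv_lt (PosNum d0)).
split.
- apply: (aux fst) => [s s0|a]; first exact: (mp_measurable1 (rf_preserving RF s0)).
  by have [] := rf_velocity RF a t0.
- apply: (aux snd) => [s s0|a]; first exact: (mp_measurable2 (rf_preserving RF s0)).
  by have [] := rf_velocity RF a t0.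
Unshelve. all: end_near. Qed.

Lemma rf_V0 : 0 <= V.
Proof. exact: le_trans (enorm_ge0 _) (rf_bound RF 0 (lexx 0)). Qed.

Lemma flow_displacement t a : 0 <= t -> enorm (X t a - a) <= 2 * V * t.
Proof.
move=> t0.
have := flow_lipschitz_in_time (rf_velocity RF) (rf_bound RF) a t0 (lexx 0).
by rewrite (rf_start RF) subr0 (ger0_norm t0).
Qed.

End flow_measurability.

Section confined_blobs.
Variables (M : nat) (gam : 'I_M -> R) (p : 'I_M -> R -> R * R) (I : set R).
Variables (w0m : 'I_M -> R * R -> R) (w0p w0 : R * R -> R).
Variables (X : R -> R * R -> R * R) (C V : R).
Variables (T delta c c1 A eps a' q gamexp : R) (m0 : nat).
Hypothesis RF : regular_flow w0 X C V.
Let hv m t : R * R :=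
  (\sum_(l < M | l != m) gam l * (K (p m t - p l t)).1,
   \sum_(l < M | l != m) gam l * (K (p m t - p l t)).2).
Let theta := (q - 2) / (2 * q - 2).
Let kap := gamexp * (q / (2 * q - 2)).
Local Notation Gam := (fun m => total_vorticity (w0m m)).
Hypotheses (T0 : 0 <= T) (IT : forall t, 0 <= t <= T -> I t).
Hypothesis vp : forall m t, 0 <= t <= T -> velocity_within I (p m) t (hv m t).
Hypothesis delta0 : 0 < delta.
Hypothesis psep : forall m l t, 0 <= t <= T -> l != m -> 4 * delta <= enorm (p m t - p l t).
Hypotheses (mw0 : measurable2 w0) (mw0m : forall m, measurable2 (w0m m)) (mw0p : measurable2 w0p).
Hypothesis sumE : {ae mu, forall x, w0 x = \sum_(m < M) w0m m x + w0p x}.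
Hypotheses (eps0 : 0 < eps) (epsA : eps <= A) (A1 : A <= 1) (Adelta : A <= delta).
Hypotheses (sgn : forall m, no_sign_change (w0m m)).
Hypotheses (supp : forall m, esupp (w0m m) `<=` eball (p m 0) eps).
Hypothesis G0 : forall m, total_vorticity (w0m m) != 0.
Hypothesis q2 : 2 < q.
Hypothesis hN : forall m, (Lnorm2 q%:E (w0m m) <= (A `^ (- gamexp))%:E)%E.
Hypothesis hp : forall t x, 0 <= t ->
  (\int[mu]_b (`|w0p b| / enorm (x - X t b))%:E <= (c1 * A)%:E)%E.
Hypotheses (c0 : 0 <= c) (cc1 : 2 * c1 <= c) (cG : forall m, `|Gam m| <= c).
Hypothesis cS : forall m, velocity_const q * `|Gam m| `^ (theta - 1) <= c.
Hypothesis cg : forall m, `|Gam m - gam m| <= c * Num.sqrt A.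
Hypotheses (a'0 : 0 <= a') (a'12 : a' <= 2^-1).
Hypothesis hm : 1 + kap <= theta * m0.+3%:R * (1 - 2 * a').
Hypothesis small : vortex_const M c delta T theta m0 * A `^ a' <= delta / 2.

Let A0 : 0 < A. Proof. exact: lt_le_trans eps0 epsA. Qed.

(** Reduces to [vortex_confined_global], with the plane of labels under the law of each blob as
    probability space and tangent extensions as trajectories. *)
Lemma blobs_confined m t a : 0 <= t <= T -> enorm (a - p m 0) < eps ->
  enorm (X t a - p m t) <= vortex_const M c delta T theta m0 * A `^ a'.
Proof.
move=> tT aeps.
pose U t := lagrangian_velocity (X t) w0.
pose g l := localized (w0m l) (p l 0) eps.
pose lab l := blob_label (p l 0) eps.
have [P lawP] : {P : 'I_M -> probability (borel2 (R := R)) R & forall l,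
    forall h : R * R -> \bar R, (forall x, 0 <= h x)%E -> measurable_fun [set: borel2] (h : borel2 -> \bar R) ->
    (\int[P l]_x h x = \int[mu]_x (h x * (`|g l x| / `|Gam l|)%:E))%E}.
  exists (fun l => sval (cid (blob_probability (mw0m l) (sgn l) (@supp l) (G0 l)))) => l.
  exact: svalP (cid (blob_probability (mw0m l) (sgn l) (@supp l) (G0 l))).
have mg l : measurable2 (g l) by exact: measurable_localized (@supp l).
have mpX := rf_preserving RF.
have AN : 0 < A `^ (- gamexp) by rewrite powR_gt0.
have gsing l s x : 0 <= s -> (\int[mu]_b (`|g l b| / enorm (x - X s b))%:E < +oo)%E.
  move=> s0.
  have gN : ('N[mu]_q%:E[EFin \o g l] <= (A `^ (- gamexp))%:E)%E.
    apply: le_trans (hN l); apply: Lnorm_le_pointwise; [exact: lt_trans q2|exact: mg|exact: mw0m|].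
    by move=> b; exact: localized_le.
  have := @singular_integral_bound _ _ R mu _ (mp_measurable_dist (mpX s s0) x)
    (fun b => enorm_ge0 _) (fun r r0 => mp_dist_tail (mpX s s0) x r0) (g l) q _ (mg l) q2 AN gN
    `|Gam l| (normr_ge0 _).
  rewrite (localized_mass (mw0m l) (sgn l) (@supp l) (G0 l)) => /(_ (lexx _)) h.
  exact: le_lt_trans h (ltry _).
have psing s x : 0 <= s -> (\int[mu]_b (`|w0p b| / enorm (x - X s b))%:E < +oo)%E.
  by move=> s0; exact: le_lt_trans (hp x s0) (ltry _).
have gsum : {ae mu, forall b, w0 b = \sum_(l < M) g l b + w0p b}.
  have all : {ae mu, forall b, forall l, w0m l b = g l b}.
    by apply: ae_conj_all => l; exact: localized_ae (@supp l).
  apply: ae_imply (ae_conj sumE all) => b [-> gE]; congr (_ + _).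
  by apply: eq_bigr => l _; exact: gE.
(* Composing with [lab] makes every particle of the cloud start in the initial disc. *)
pose x l s b := flow_extension X U T (lab l b) s.
pose v l s b := U (clamp T s) (X (clamp T s) (lab l b)).
have V0 := rf_V0 RF.
have cl0 s : 0 <= clamp T s by have /andP[] := clamp_itv s T0.
have xid l s : 0 <= s <= T -> x l s = X s \o lab l.
  by move=> sT; apply/funext => b; rewrite /x flow_extension_id.
have vid l s b : 0 <= s <= T -> v l s b = U s (X s (lab l b)).
  by move=> sT; rewrite /v clamp_id.
have mlab l : measurable_fun [set: borel2] (lab l : borel2 -> borel2).
  exact: measurable_blob_label.
have vV l s b : enorm (v l s b) <= V by exact: (rf_bound RF).
have [mv1 mv2] : (forall l s, measurable_fun [set: borel2] (fun b : borel2 (R := R) => (v l s b).1 : R)) /\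
    (forall l s, measurable_fun [set: borel2] (fun b : borel2 (R := R) => (v l s b).2 : R)).
  split => l s; have [h1 h2] := measurable_flow_velocity RF (cl0 s).
    exact: (measurableT_comp h1 (mlab l)).
  exact: (measurableT_comp h2 (mlab l)).
have bv l s : bmeas2 (v l s).
  split; split.
  - exact: mv1.
  - by exists V => b; exact: le_trans (norm1_le_enorm _) (vV l s b).
  - exact: mv2.
  - by exists V => b; exact: le_trans (norm2_le_enorm _) (vV l s b).
have mXl l s : 0 <= s -> measurable_fun [set: borel2] (X s \o lab l : borel2 -> borel2).
  by move=> s0; exact: (measurableT_comp (mpX s s0).1 (mlab l)).
have bXl l s : 0 <= s -> bmeas2 (X s \o lab l).
  move=> s0.
  have bd b : enorm (X s (lab l b)) <= 2 * V * s + (eps + enorm (p l 0)).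
    have -> : X s (lab l b) = (X s (lab l b) - lab l b) + (lab l b - p l 0 + p l 0).
      by rewrite subrK subrK.
    apply: (le_trans (enormD _ _)); apply: lerD; first by apply: (flow_displacement RF).
    apply: (le_trans (enormD _ _)); rewrite lerD2r; apply: ltW.
    exact: blob_label_ball.
  split; split.
  - exact: (measurableT_comp measurable_fst2 (mXl l s s0)).
  - by eexists => b; exact: le_trans (norm1_le_enorm _) (bd b).
  - exact: (measurableT_comp measurable_snd2 (mXl l s s0)).
  - by eexists => b; exact: le_trans (norm2_le_enorm _) (bd b).
have bx l s : bmeas2 (x l s).
  have [b1 b2] := bXl l _ (cl0 s); have [b3 b4] := bv l s.
  split; rewrite /x /flow_extension /tangent_extension2 /tangent_extension /=.
  - by apply: bmeasD => //; apply: bmeasM => //; exact: bmeas_cst.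
  - by apply: bmeasD => //; apply: bmeasM => //; exact: bmeas_cst.
have sing l s z S : 0 <= s -> measurable (S : set borel2) ->
    (\int[P l]_(b in S) (enorm (z - X s (lab l b)))^-1%:E <=
     (c * fine (P l S) `^ theta * A `^ (- kap))%:E)%E.
  move=> s0 mS.
  apply: (le_trans (blob_singular_integral (mw0m l) (@supp l) (G0 l) (lawP l) (mpX s s0) z q2 AN (hN l) mS)).
  rewrite lee_fin -powRrM mulNr; do 2!(apply: ler_wpM2r; first exact: powR_ge0).
  exact: cS.
have bF k l s : 0 <= s <= T -> bmeas2 (fun b => blob_field (P l) (x l s) (x k s b)).
  move=> sT; have s0 : 0 <= s by case/andP: sT.
  rewrite !xid//.
  have mK : measurable_fun [set: borel2 (R := R) * borel2 (R := R)]
       (fun z => (K (X s (lab k z.1) - X s (lab l z.2))).1 : R) /\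
     measurable_fun [set: borel2 (R := R) * borel2 (R := R)]
       (fun z => (K (X s (lab k z.1) - X s (lab l z.2))).2 : R).
    have [[k1 _] [k2 _]] := bXl k s s0; have [[l1 _] [l2 _]] := bXl l s s0.
    by apply: measurable_kernel => /=; apply: measurable_funB;
      [exact: measurable_comp_fst k1|exact: measurable_comp_snd l1
      |exact: measurable_comp_fst k2|exact: measurable_comp_snd l2].
  have mKl z : measurable_fun [set: borel2] (fun b : borel2 (R := R) => (enorm (z - X s (lab l b)))^-1 : R).
    have [[l1 _] [l2 _]] := bXl l s s0.
    apply: (measurableT_comp measurable_invr); apply: measurable_enorm => /=; exact: measurable_funB.
  have Kc (i : bool) b : (\int[P l]_b' `|prj i (K (X s (lab k b) - X s (lab l b')))|%:E
      <= (c * fine (P l setT) `^ theta * A `^ (- kap))%:E)%E.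
    apply: le_trans (sing l s (X s (lab k b)) setT s0 measurableT).
    apply: ge0_le_integral => //.
    - apply/measurable_EFinP; apply: measurableT_comp => //.
      have mb : measurable_fun [set: borel2 (R := R)] (fun y => (b, y) : (borel2 (R := R) * borel2 (R := R))%type).
        exact: measurable_fun_pair.
      case: (i); [exact: (measurableT_comp mK.1 mb)|exact: (measurableT_comp mK.2 mb)].
    - exact/measurable_EFinP.
    - move=> b' _; rewrite lee_fin; apply: le_trans (norm_prj_le _ _) (enorm_kernel_le _).
  split.
  - exact: (@bmeas_section_Rintegral _ _ _ _ _ (P k) (P l) _ _ mK.1 (Kc true)).
  - exact: (@bmeas_section_Rintegral _ _ _ _ _ (P k) (P l) _ _ mK.2 (Kc false)).
(* Defined as the discrepancy, so that the decomposition of the velocity holds by construction; its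
   identification with the field of the perturbation is needed only for the bound. *)
pose e k s b : R * R := v k s b -
  (\sum_(l < M) Gam l * (blob_field (P l) (x l s) (x k s b)).1,
   \sum_(l < M) Gam l * (blob_field (P l) (x l s) (x k s b)).2).
have be k s : 0 <= s <= T -> bmeas2 (e k s).
  move=> sT; have [v1 v2] := bv k s.
  split; rewrite /e /=; apply: bmeasB => //; apply: bmeas_sum => l; have [f1 f2] := bF k l s sT.
    by apply: bmeasM => //; exact: bmeas_cst.
  by apply: bmeasM => //; exact: bmeas_cst.
have ec k s : 0 <= s <= T -> forall b, enorm (e k s b) <= c * A.
  move=> sT b; have s0 : 0 <= s by case/andP: sT.
  set z := X s (lab k b).
  have -> : e k s b = lagrangian_velocity (X s) w0p z.
    have -> : e k s b = U s z -
        (\sum_(l < M) Gam l * (blob_field (P l) (X s \o lab l) z).1,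
         \sum_(l < M) Gam l * (blob_field (P l) (X s \o lab l) z).2).
      have E l : blob_field (P l) (x l s) (x k s b) = blob_field (P l) (X s \o lab l) z.
        by rewrite (xid l s sT) (xid k s sT).
      rewrite /e (vid k s b sT).
      by apply: (congr2 (fun u u' => U s z - (u, u'))); apply: eq_bigr => l _; rewrite E.
    rewrite /U (lagrangian_velocity_split (mpX s s0) mw0 mg mw0p gsum
      (fun l => gsing l s _ s0) (psing s _ s0)).
    have bE l := blob_velocity (mw0m l) (sgn l) (@supp l) (G0 l) (lawP l) (mpX s s0) (gsing l s z s0).
    have -> : \sum_(l < M) (lagrangian_velocity (X s) (g l) z).1 =
      \sum_(l < M) Gam l * (blob_field (P l) (X s \o lab l) z).1.
      by apply: eq_bigr => l _; rewrite bE.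
    have -> : \sum_(l < M) (lagrangian_velocity (X s) (g l) z).2 =
      \sum_(l < M) Gam l * (blob_field (P l) (X s \o lab l) z).2.
      by apply: eq_bigr => l _; rewrite bE.
    move: (\sum_(l < M) _) (\sum_(l < M) _) (lagrangian_velocity _ _ _) => S1 S2 [u1 u2].
    by congr pair; rewrite /= addrAC subrr add0r.
  apply: (le_trans (lagrangian_velocity_le (mpX s s0) mw0p (hp z s0))).
  by rewrite mulrA ler_wpM2r// ltW.
pose ph l := tangent_extension2 T (p l) (hv l).
pose pv l s := hv l (clamp T s).
have phid l s : 0 <= s <= T -> ph l s = p l s by move=> sT; rewrite /ph tangent_extension2_id.
(* A common speed bound for particles and vortices. *)
pose W := V + \sum_(l < M) 2 * (`|gam l| / (4 * delta)).
have W0 : 0 <= \sum_(l < M) 2 * (`|gam l| / (4 * delta)).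
  by apply: sumr_ge0 => l _; rewrite mulr_ge0// divr_ge0// mulr_ge0// ltW.
have pvW l s : enorm (pv l s) <= W.
  have sT := clamp_itv s T0.
  have Kd k : k != l -> enorm (K (p l (clamp T s) - p k (clamp T s))) <= (4 * delta)^-1.
    move=> kl; apply: (le_trans (enorm_kernel_le _)).
    have := psep sT kl => h; rewrite lef_pV2 ?posrE ?mulr_gt0//.
    by apply: lt_le_trans h; rewrite mulr_gt0.
  have comp (i : bool) : `|\sum_(k < M | k != l) gam k * prj i (K (p l (clamp T s) - p k (clamp T s)))|
      <= \sum_(k < M) `|gam k| / (4 * delta).
    apply: (le_trans (ler_norm_sum _ _ _)); rewrite [leRHS](bigID (fun k => k != l))/=.
    apply: ler_wpDr; first by apply: sumr_ge0 => k _; rewrite divr_ge0// mulr_ge0// ltW.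
    apply: ler_sum => k kl; rewrite normrM ler_wpM2l//.
    exact: le_trans (norm_prj_le _ _) (Kd k kl).
  apply: (le_trans (enorm_le_normD _)); rewrite /W -mulr_sumr mulrDl mul1r.
  apply: ler_wpDl => //; apply: lerD; [exact: (comp true)|exact: (comp false)].
have vW l s b : enorm (v l s b) <= W by apply: (le_trans (vV l s b)); rewrite lerDl.
have th0 : 0 < theta by have h := q2; rewrite divr_gt0; lra.
have := @vortex_confined_global _ (borel2 (R := R)) R M P gam Gam c delta T theta kap a' A W m0 x v e ph pv
  c0 delta0 T0 th0 a'0 a'12 hm A0 A1 cG cg _ _ bx bv vW pvW be ec _ _ _ _ _ small Adelta m t a tT.
rewrite xid// phid// [(_ \o _) _]/= /lab blob_label_id//; apply.
- move=> l s b; exact: (is_derive_flow_extension (rf_velocity RF) (lab l b) T0 s).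
- move=> l s; exact: (is_derive_tangent_extension2 T0 IT (vp l) s).
- move=> l s sT b; rewrite /e.
  move: (v l s b) (\sum_(l0 < M) _) (\sum_(l0 < M) _) => [v1 v2] S1 S2.
  by congr pair; rewrite /= addrC subrK.
- move=> l s sT; rewrite /pv clamp_id// /hv; congr pair; apply: eq_bigr => k _; by rewrite !phid.
- by move=> l k s sT kl; rewrite !phid//; exact: psep.
- move=> l s sT b S mS; rewrite !xid//; apply: sing => //; by case/andP: sT.
- move=> l b; have T00 : (0 : R) <= 0 <= T by rewrite lexx T0.
  rewrite xid// phid// /= (rf_start RF) (le_trans _ epsA)// ltW//.
  exact: blob_label_ball.
Qed.

End confined_blobs.

End YudovichFlow.

(** * Conclusion *)

Section Assembly.
Context {R : realType}.
Local Notation mu := (@leb2 R).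

(** This explicit lower bound also makes sense for an empty index type. *)
Lemma finite_positive_bound (I : finType) (f : I -> R) : (forall i, 0 < f i) ->
  exists2 d : R, 0 < d & forall i, d <= f i.
Proof.
move=> f0; have S0 : 0 <= \sum_i (f i)^-1 by apply: sumr_ge0 => i _; rewrite invr_ge0 ltW.
have S1 : 0 < 1 + \sum_i (f i)^-1 by rewrite ltr_pwDl.
exists (1 + \sum_i (f i)^-1)^-1; first by rewrite invr_gt0.
move=> i; rewrite -[leRHS]invrK lef_pV2 ?posrE ?invr_gt0//.
rewrite (bigD1 i)//= addrCA lerDl addr_ge0// sumr_ge0// => j _.
by rewrite invr_ge0 ltW.
Qed.

Lemma powR_eventually_small (s K eta : R) : 0 < s -> 0 <= K -> 0 < eta ->
  exists2 A0 : R, 0 < A0 & forall A, 0 < A -> A < A0 -> K * A `^ s < eta.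
Proof.
move=> s0 K0 eta0; have K1 : 0 < K + 1 by rewrite ltr_wpDl.
have e1 : 0 < eta / (K + 1) by rewrite divr_gt0.
exists ((eta / (K + 1)) `^ s^-1); first by rewrite powR_gt0.
move=> A A0 AA0.
have h : A `^ s < eta / (K + 1).
  rewrite -[ltRHS](powRr1 (ltW e1)) -[X in _ < _ `^ X](mulVf (lt0r_neq0 s0)) powRrM.
  by rewrite gt0_ltr_powR// nnegrE ?powR_ge0// ltW.
apply: (@le_lt_trans _ _ (K * (eta / (K + 1)))); first by rewrite ler_wpM2l// ltW.
by rewrite mulrCA gtr_pMr// ltr_pdivrMr// mul1r ltrDl.
Qed.

Lemma powR_le_antitone (x y s : R) : 0 < y -> y <= x -> 0 <= s -> x `^ (- s) <= y `^ (- s).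
Proof.
move=> y0 yx s0; have x0 := lt_le_trans y0 yx.
rewrite !powRN lef_pV2 ?posrE ?powR_gt0//.
by rewrite ge0_ler_powR// nnegrE ltW.
Qed.

Lemma esupp_sub_closed_ball (f : R * R -> R) (p : R * R) (r : R) :
  (forall x, f x <> 0 -> enorm (x - p) <= r) -> forall x, esupp f x -> enorm (x - p) <= r.
Proof.
move=> fr x; rewrite leNgt; apply: contra_notN => rx.
pose d := (enorm (x - p) - r) / 2; have d0 : 0 < d by rewrite divr_gt0// subr_gt0.
exists (ball x d); first exact: nbhsx_ballx.
apply: (negligibleS _ (@negligible_set0 _ _ _ mu)) => y [[/= h1 h2] /fr hy].
(* The ball is one of the maximum norm, hence two coordinates of size [d]; 2 d is the gap between |x
   - p| and [r]. *)
have : enorm (x - y) < 2 * d.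
  apply: (le_lt_trans (enorm_le_normD _)); rewrite mulrDl mul1r.
  by apply: ltrD; [exact: h1|exact: h2].
have := enorm_trans y x p; rewrite /d mulrCA divff// mulr1; lra.
Qed.

Lemma Asize_eventually_small (q : R) (f : R -> R * R -> R) :
  Asize q eps (f eps) @[eps --> 0^'+] --> 0%E ->
  forall eta : R, 0 < eta -> exists2 eps0 : R, 0 < eps0 & forall eps, 0 < eps -> eps <= eps0 ->
    exists A : R, [/\ Asize q eps (f eps) = A%:E, eps <= A & A < eta].
Proof.
move=> /fine_cvgP[fin /cvgrPdist_lt cv] eta eta0.
have near : \forall eps \near 0^'+, Asize q eps (f eps) \is a fin_num /\
    `|0 - fine (Asize q eps (f eps))| < eta.
  by near=> eps; split; near: eps => //; exact: cv.
have [e /= e0 he] := near.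
exists (e / 2); first by rewrite divr_gt0.
move=> eps eps0 epse.
have [fn dist] : Asize q eps (f eps) \is a fin_num /\ `|0 - fine (Asize q eps (f eps))| < eta.
  by apply: he => //; rewrite /ball /= sub0r normrN gtr0_norm//; lra.
have epsA : (eps%:E <= Asize q eps (f eps))%E by rewrite /Asize le_max lexx orbT.
exists (fine (Asize q eps (f eps))); split.
- by rewrite fineK.
- by rewrite -lee_fin fineK.
- by move: dist; rewrite sub0r normrN => /(le_lt_trans (ler_norm _)).
Unshelve. all: end_near. Qed.

Lemma perturbation_singular_integral (q eps A : R) (f : R * R -> R) (Y : R * R -> R * R) x :
  2 < q -> measurable2 f -> measure_preserving Y -> Asize q eps f = A%:E ->
  (\int[mu]_b (`|f b| / enorm (x - Y b))%:E <= (velocity_const q * A)%:E)%E.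
Proof.
move=> q2 mf mY AE.
have A0 : (poweR (Lnorm2 q%:E f) (q / (2 * q - 2)) *
    poweR (Lnorm2 1 f) ((q - 2) / (2 * q - 2)) <= A%:E)%E.
  by rewrite -AE /Asize le_max lexx.
have al0 : 0 < q / (2 * q - 2) by rewrite divr_gt0; lra.
have be0 : 0 < (q - 2) / (2 * q - 2) by rewrite divr_gt0; lra.
have Lq0 : (0 <= Lnorm2 q%:E f)%E by exact: Lnorm_ge0.
have L10 : (0 <= Lnorm2 1 f)%E by exact: Lnorm_ge0.
have A00 : 0 <= A.
  by rewrite -lee_fin; apply: le_trans A0; rewrite mule_ge0// poweR_ge0.
have mEf : measurable_fun [set: borel2] (EFin \o f : borel2 -> \bar R) by exact/measurable_EFinP.
(* If one norm vanishes then [f] is zero almost everywhere, even when the other norm is infinite. *)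
have null r : (0 < r)%E -> Lnorm2 r f = 0%E ->
    (\int[mu]_b (`|f b| / enorm (x - Y b))%:E <= (velocity_const q * A)%:E)%E.
  move=> r0 /(Lnorm_eq0_eq0 mEf r0) f0.
  rewrite (_ : integral _ _ _ = 0%E).
    by rewrite lee_fin mulr_ge0// velocity_const_ge0.
  transitivity (\int[mu]_(b in setT) (0 : \bar R))%E; last exact: integral0.
  apply: ae_eq_integral => //.
    apply/measurable_EFinP; apply: measurable_funM; first exact: measurableT_comp.
    exact: (measurableT_comp measurable_invr (mp_measurable_dist mY x)).
  apply: ae_imply f0 => b /(_ I) /= h _.
  by have [->] := h; rewrite normr0 mul0r.
have [Lq00|Lq1] := eqVneq (Lnorm2 q%:E f) 0%E.
  by apply: null Lq00; rewrite lte_fin; lra.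
have [L100|L11] := eqVneq (Lnorm2 1 f) 0%E; first exact: null L100.
have {Lq1}Lq1 : (0 < Lnorm2 q%:E f)%E by rewrite lt0e Lq1.
have {L11}L11 : (0 < Lnorm2 1 f)%E by rewrite lt0e L11.
(* An infinite norm times a positive power of the other would make [A] infinite. *)
have [N N0 NE] : exists2 N : R, 0 < N & Lnorm2 q%:E f = N%:E.
  move: A0 Lq1; case: (Lnorm2 q%:E f) => [N _ N0|A0 _|//]; first by exists N.
  exfalso; move: A0; rewrite poweRyr ?gt_eqF// gt0_mulye// ?poweR_gt0//.
have [m m0 mE] : exists2 m : R, 0 < m & Lnorm2 1 f = m%:E.
  move: A0 L11; case: (Lnorm2 1 f) => [m _ m0|A0 _|//]; first by exists m.
  exfalso; move: A0; rewrite NE poweRyr ?gt_eqF// gt0_muley// ?poweR_gt0//.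
have f1 : (\int[mu]_b `|f b|%:E <= m%:E)%E.
  by rewrite -mE /Lnorm2 Lnorm1.
have fN : ('N[mu]_q%:E[EFin \o f] <= N%:E)%E by rewrite -NE.
apply: (le_trans (@singular_integral_bound _ _ R mu _ (mp_measurable_dist mY x)
  (fun b => enorm_ge0 _) (fun r r0 => mp_dist_tail mY x r0) f q N mf q2 N0 fN m (ltW m0) f1)).
rewrite lee_fin ler_wpM2l ?velocity_const_ge0//.
by move: A0; rewrite NE mE -EFinM lee_fin.
Qed.

(** For each pair, the squared distance is continuous on [0, T] and attains its minimum, which is
    positive because the vortices do not meet; there are finitely many pairs. *)
Lemma helmholtz_separation (M : nat) (I : set R) (p : 'I_M -> R -> R * R)
    (v : 'I_M -> R -> R * R) (T : R) : 0 <= T -> (forall t, 0 <= t <= T -> I t) ->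
  (forall m t, 0 <= t <= T -> velocity_within I (p m) t (v m t)) ->
  (forall m l t, 0 <= t <= T -> l != m -> p m t <> p l t) ->
  exists2 delta : R, 0 < delta & forall m l t, 0 <= t <= T -> l != m ->
    4 * delta <= enorm (p m t - p l t).
Proof.
move=> T0 IT vp ne.
pose ph l := tangent_extension2 T (p l) (v l).
have phid l s : 0 <= s <= T -> ph l s = p l s by move=> sT; rewrite /ph tangent_extension2_id.
have min m l : exists c, 0 <= c <= T /\ forall t, 0 <= t <= T -> sqn (p m c - p l c) <= sqn (p m t - p l t).
  have D (t : R) : is_derive t 1 (fun s => sqn (ph m s - ph l s))
      (2 * dotp (ph m t - ph l t) (v m (clamp T t) - v l (clamp T t))).
    have [e1 e2] := is_derive_tangent_extension2 T0 IT (vp m) t.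
    have [d1 d2] := is_derive_tangent_extension2 T0 IT (vp l) t.
    exact: (@is_derive_sqn _ (fun s => ph m s - ph l s) t (v m (clamp T t) - v l (clamp T t))
      (is_deriveB e1 d1) (is_deriveB e2 d2)).
  have [c cin cmin] := EVT_min T0 (continuous_subspaceT (is_derive_continuous D)).
  move: cin; rewrite in_itv/= => cin; exists c; split => // t tT.
  by have := cmin t; rewrite in_itv/= => /(_ tT); rewrite !phid.
(* The value 1 on the diagonal is a placeholder. *)
pose f (k : 'I_M * 'I_M) : R := if k.2 == k.1 then 1 else
  enorm (p k.1 (sval (cid (min k.1 k.2))) - p k.2 (sval (cid (min k.1 k.2)))).
have f0 k : 0 < f k.
  rewrite /f; case: ifPn => // kk; case: cid => c /= [cT _].
  by rewrite enorm_gt0 subr_eq0; apply/eqP; exact: ne.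
have [d d0 df] := finite_positive_bound f0.
exists (d / 4); first by rewrite divr_gt0.
move=> m l t tT lm; rewrite mulrC divfK//; apply: (le_trans (df (m, l))).
rewrite /f /= (negbTE lm); case: cid => c /= [cT cmin].
by rewrite -ler_sqr ?nnegrE ?enorm_ge0// !enorm_sqr; exact: cmin.
Qed.

End Assembly.

Theorem theorem1p1 (R : realType) (M : nat) (gam : 'I_M -> R)
  (p0 : 'I_M -> R * R) (Tstar : \bar R) (p : 'I_M -> R -> R * R)
  (q C gamexp p1 : R)
  (w0 : R -> R * R -> R) (w0m : R -> 'I_M -> R * R -> R)
  (w0p : R -> R * R -> R)
  (hgam : forall m, gam m <> 0)
  (hp0 : injective p0)
  (hp : maximal_helmholtz_solution gam p0 Tstar p)
  (hq : 2 < q)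
  (hw0 : forall eps : R, 0 < eps -> in_L1_Loo (w0 eps))
  (hw0m : forall eps : R, 0 < eps -> forall m, measurable2 (w0m eps m))
  (hw0p : forall eps : R, 0 < eps -> measurable2 (w0p eps))
  (hsum : forall eps : R, 0 < eps -> {ae leb2, forall x,
     w0 eps x = \sum_(m < M) w0m eps m x + w0p eps x})
  (hsign : forall eps : R, 0 < eps -> forall m, no_sign_change (w0m eps m))
  (hsupp : forall eps : R, 0 < eps -> forall m,
     esupp (w0m eps m) `<=` eball (p m 0) eps)
  (hcirc : forall eps : R, 0 < eps -> forall m,
     (`|gam m - total_vorticity (w0m eps m)|%:E
      <= C%:E * poweR (Asize q eps (w0p eps)) (2^-1))%E)
  (hA : Asize q eps (w0p eps) @[eps --> 0^'+] --> 0%E)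
  (hgamexp : 0 < gamexp) (hp1 : 2 < p1)
  (hLp1 : forall eps : R, 0 < eps -> forall m,
     (Lnorm2 p1%:E (w0m eps m)
      <= poweR (Asize q eps (w0p eps)) (- gamexp))%E) :
  forall T : R, (T%:E < Tstar)%E ->
  forall a : R, a < 2^-1 ->
  exists eps0 : R, 0 < eps0 /\
  forall eps : R, 0 < eps -> eps <= eps0 ->
  forall w : R -> R * R -> R, yudovich_solution (w0 eps) w ->
  exists (wm : 'I_M -> R -> R * R -> R) (wp : R -> R * R -> R),
    [/\ forall m, spacetime_measurable (wm m),
        spacetime_measurable wp,
        forall t : R, 0 <= t -> {ae leb2, forall x,
          w t x = \sum_(m < M) wm m t x + wp t x}
      & forall t : R, 0 <= t -> t <= T ->
          (forall m,
             [/\ esupp (wm m t)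
                   `<=` eball (p m t) (fine (Asize q eps (w0p eps)) `^ a),
                 leb2.-integrable setT (EFin \o wm m t)
               & total_vorticity (wm m t) = total_vorticity (w0m eps m)]) /\
          (forall r : \bar R, (1 <= r)%E ->
             Lnorm2 r (wp t) = Lnorm2 r (w0p eps))].
Proof.
move=> T TT a a12.
have [Ts0 [hp_start hp_dyn] _] := hp.
(* [T] may be negative; the confinement argument needs an interval starting at 0. *)
pose T' := Num.max 0 T.
have T'0 : 0 <= T' by rewrite le_max lexx.
have T'T : (T'%:E < Tstar)%E by rewrite /T'; case: (leP 0 T).
pose I := [set s : R | 0 <= s /\ (s%:E < Tstar)%E].
have IT t : 0 <= t <= T' -> I t.
  by move=> /andP[t0 tT]; split => //; apply: le_lt_trans T'T; rewrite lee_fin.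
pose hv m t : R * R :=
  (\sum_(l < M | l != m) gam l * (biot_savart_kernel (p m t - p l t)).1,
   \sum_(l < M | l != m) gam l * (biot_savart_kernel (p m t - p l t)).2).
have vp m t : 0 <= t <= T' -> velocity_within I (p m) t (hv m t).
  by move=> tT; have [t0 tTs] := IT t tT; have [_ /(_ m)] := hp_dyn t t0 tTs.
have pne m l t : 0 <= t <= T' -> l != m -> p m t <> p l t.
  move=> tT lm; have [t0 tTs] := IT t tT; have [ne _] := hp_dyn t t0 tTs.
  by apply: ne; apply/eqP; rewrite eq_sym.
have [delta delta0 psep] := helmholtz_separation T'0 IT vp pne.
(* Above [a], to absorb constants; positive, so that A^a' tends to 0; below 1/2, for the tail
   estimate. *)
pose a' := (Num.max a 0 + 2^-1) / 2.
have am : Num.max a 0 < 2^-1 by rewrite gt_max a12 invr_gt0 ltr0n.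
have aM : a <= Num.max a 0 by rewrite le_max lexx.
have M0 : 0 <= Num.max a 0 by rewrite le_max lexx orbT.
have a'0 : 0 < a' by rewrite /a'; lra.
have a'12 : a' < 2^-1 by rewrite /a'; lra.
have aa' : 0 < a' - a by rewrite /a'; lra.
pose theta := (p1 - 2) / (2 * p1 - 2).
pose kap := gamexp * (p1 / (2 * p1 - 2)).
have th0 : 0 < theta by rewrite divr_gt0; lra.
have tha : 0 < theta * (1 - 2 * a') by rewrite mulr_gt0//; lra.
have kap0 : 0 <= kap by rewrite mulr_ge0 ?ltW// divr_gt0; lra.
pose m0 := Num.bound ((1 + kap) / (theta * (1 - 2 * a'))).
have hm : 1 + kap <= theta * m0.+3%:R * (1 - 2 * a').
  rewrite mulrAC -ler_pdivrMl// mulrC.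
  apply: (le_trans (ltW (archi_boundP _))); first by rewrite divr_ge0 ?addr_ge0// ltW.
  by rewrite ler_nat; exact: (leq_addl 3 m0).
have gp m : 0 < `|gam m| by rewrite normr_gt0; apply/eqP; exact: hgam.
have [g g0 ggam] := finite_positive_bound gp.
(* Controls the perturbed circulation and its power theta - 1; this exponent is negative, so the
   lower bound |gam m| / 2 is the relevant one. *)
pose sc m := 2 * `|gam m| + velocity_const p1 * (`|gam m| / 2) `^ (theta - 1).
have vc0 q' : 0 <= velocity_const q' :> R by exact: velocity_const_ge0.
have sc0 m : 0 <= sc m by rewrite addr_ge0 ?mulr_ge0 ?powR_ge0.
pose c := `|C| + 2 * velocity_const q + \sum_m sc m.
have S0 : 0 <= \sum_m sc m by exact: sumr_ge0.
have c0 : 0 <= c by rewrite !addr_ge0 ?mulr_ge0.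
have scc m : sc m <= c.
  apply: (@le_trans _ _ (\sum_m sc m)).
    by rewrite (bigD1 m)//= lerDl sumr_ge0.
  by rewrite lerDr addr_ge0 ?mulr_ge0.
pose vc := vortex_const M c delta T' theta m0.
have vcp : 0 < vc by apply: vortex_const_gt0.
have half0 : 0 < 2^-1 :> R by rewrite invr_gt0.
(* [A1] starts the bootstrap, [A2] turns the constant times A^a' into less than A^a, and [A3] keeps
   each circulation between half and twice its limit in absolute value. *)
have [A1 A10 hA1] := powR_eventually_small a'0 (ltW vcp) (ltac:(by rewrite divr_gt0) : 0 < delta / 2).
have [A2 A20 hA2] := powR_eventually_small aa' (ltW vcp) (ltr01 : 0 < 1).
have [A3 A30 hA3] := powR_eventually_small half0 (normr_ge0 C) (ltac:(by rewrite divr_gt0) : 0 < g / 2).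
pose eta := Num.min (Num.min 1 delta) (Num.min A1 (Num.min A2 A3)).
have eta0 : 0 < eta by rewrite !lt_min ltr01 delta0 A10 A20.
have [eps0 eps00 heps] := Asize_eventually_small hA eta0.
exists eps0; split => // eps epsp epse w ws.
have [A [AE epsA]] := heps eps epsp epse.
rewrite !lt_min => /andP[/andP[AA1 Adelta] /and3P[AA1' AA2 AA3]].
have A0 : 0 < A := lt_le_trans epsp epsA.
have {}hA1 := hA1 A A0 AA1'; have {}hA2 := hA2 A A0 AA2; have {}hA3 := hA3 A A0 AA3.
have circ m : `|gam m - total_vorticity (w0m eps m)| <= `|C| * A `^ 2^-1.
  have := hcirc eps epsp m; rewrite AE poweR_EFin -EFinM lee_fin => /le_trans; apply.
  by rewrite ler_wpM2r ?powR_ge0// ler_norm.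
have Glow m : `|gam m| / 2 <= `|total_vorticity (w0m eps m)|.
  have := ggam m; have := circ m; have := lerB_dist (gam m) (total_vorticity (w0m eps m)).
  lra.
have Ghigh m : `|total_vorticity (w0m eps m)| <= 2 * `|gam m|.
  have := ggam m; have := circ m; have := lerB_dist (total_vorticity (w0m eps m)) (gam m).
  rewrite distrC; lra.

have G0 m : total_vorticity (w0m eps m) != 0.
  by rewrite -normr_gt0; apply: lt_le_trans (Glow m); rewrite divr_gt0.
have [X [Cx [V [RF tr]]]] := yudovich_regular_flow (hw0 eps epsp) ws.
have mw0 : measurable2 (w0 eps) by have [] := hw0 eps epsp.
have mw0m := hw0m eps epsp; have mw0p := hw0p eps epsp.
have confined m t b : 0 <= t <= T' -> enorm (b - p m 0) < eps ->
    enorm (X t b - p m t) <= vc * A `^ a'.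
  apply: (@blobs_confined R M gam p I (w0m eps) (w0p eps) (w0 eps) X Cx V T' delta c
    (velocity_const q) A eps a' p1 gamexp m0) => //.
  - exact: hsum.
  - exact: ltW.
  - exact: ltW.
  - exact: hsign.
  - exact: hsupp.
  - by move=> l; have := hLp1 eps epsp l; rewrite AE poweR_EFin.
  - move=> s x s0; exact: perturbation_singular_integral (rf_preserving RF s0) AE.
  - by rewrite /c addrAC lerDr addr_ge0.
  - move=> l; apply: le_trans (scc l); apply: (le_trans (Ghigh l)).
    by rewrite lerDl mulr_ge0 ?powR_ge0.
  - move=> l; apply: le_trans (scc l); rewrite -[leLHS]add0r lerD ?mulr_ge0// ler_wpM2l//.
    rewrite -[_ - 1]opprB; apply: powR_le_antitone.
    + by rewrite divr_gt0.
    + exact: Glow.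
    + by rewrite subr_ge0 ler_pdivrMr; lra.
  - move=> l; rewrite distrC; apply: (le_trans (circ l)); rewrite powR12_sqrt ?(ltW A0)//.
    by rewrite ler_wpM2r ?sqrtr_ge0// /c -addrA lerDl addr_ge0 ?mulr_ge0.
  - exact: ltW.
  - exact: ltW.
  - exact: ltW.
have V0 := rf_V0 RF.
have Xinj t : 0 <= t -> injective (X t).
  exact: (flow_injective (rf_C0 RF) (rf_start RF) (rf_velocity RF) (rf_log_lipschitz RF)).
have Xlabel t : 0 <= t -> forall b (e : R), 0 < e -> exists2 d : R, 0 < d &
    forall b', enorm (b - b') < d -> enorm (X t b - X t b') < e.
  exact: (flow_continuous_in_label (rf_C0 RF) (rf_start RF) (rf_velocity RF) (rf_log_lipschitz RF)).
have Xtime b t t' : 0 <= t -> 0 <= t' -> enorm (X t b - X t' b) <= 2 * V * `|t - t'|.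
  exact: (flow_lipschitz_in_time (rf_velocity RF) (rf_bound RF)).
have V20 : 0 <= 2 * V by rewrite mulr_ge0.
have mpX := rf_preserving RF.
(* The given pieces may be nonzero on a null set outside their discs; cutting them off makes the
   support condition hold at every label. *)
pose gm m := localized (w0m eps m) (p m 0) eps.
have mg m : measurable2 (gm m) by exact: (measurable_localized (mw0m m) (hsupp eps epsp m)).
have gae m : {ae leb2, forall x, w0m eps m x = gm m x} by exact: (localized_ae (mw0m m) (hsupp eps epsp m)).
have stm f : measurable2 f -> spacetime_measurable (transported X f).
  exact: (spacetime_measurable_transported V20 Xinj Xlabel Xtime).
have m2 f t : measurable2 f -> measurable2 (transported X f t).
  exact: (measurable2_transported V20 Xinj Xlabel Xtime).
exists (fun m => transported X (gm m)), (transported X (w0p eps)); split.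
- by move=> m; exact: stm.
- exact: stm.
- move=> t t0.
  (* The identity is known for almost every label; it passes to points because the zero set of [h]
     is measurable. *)
  pose h x := w t x - (\sum_(m < M) transported X (gm m) t x + transported X (w0p eps) t x).
  have mwt : measurable2 (w t).
    by apply: spacetime_measurable_section => //; have [[]] := ws.
  have mh : measurable2 h.
    apply: measurable_funB; first exact: mwt.
    apply: measurable_funD; last exact: m2.
    by apply: measurable_sum => m; exact: m2.
  have mB : measurable (h @^-1` [set 0] : set borel2).
    by rewrite -[X in measurable X]setTI; apply: mh => //; exact: measurable_set1.
  have all : {ae leb2, forall b, forall m, w0m eps m b = gm m b} by exact: ae_conj_all.
  have hB : {ae leb2, forall b, (h @^-1` [set 0]) (X t b)}.
    apply: ae_imply (ae_conj (tr t t0) (ae_conj (hsum eps epsp) all)) => b [wb [sb gb]].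
    rewrite /h /= wb sb (transported_flow Xinj)//.
    under [X in _ - (X + _)]eq_bigr do rewrite (transported_flow Xinj)// -gb.
    by rewrite subrr.
  apply: ae_imply (mp_ae (mpX t t0) mB hB) => x /= /eqP.
  by rewrite subr_eq0 => /eqP.
move=> t t0 tT; have tT' : 0 <= t <= T' by rewrite t0 le_max tT orbT.
split; last by move=> r r1; exact: (transported_Lnorm2 V20 Xinj Xlabel Xtime mpX).
move=> m; split.
- move=> x; rewrite AE /eball /= => sx.
  apply: (@le_lt_trans _ _ (vc * A `^ a')).
    apply: esupp_sub_closed_ball sx => y /(transported_neq0 Xinj)[b gb <-].
    have lb : blob_label (p m 0) eps b = b.
      by apply: (localized_label (f := w0m eps m)); apply/eqP.
    by apply: confined => //; rewrite -lb; exact: blob_label_ball.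
  (* A^a' = A^(a' - a) A^a, and the constant times the first factor is less than 1. *)
  rewrite -[X in _ * A `^ X](subrK a) powRD; last by rewrite (gt_eqF A0) implybT.
  by rewrite mulrA -[ltRHS]mul1r ltr_pM2r ?powR_gt0.
- apply: (transported_integrable V20 Xinj Xlabel Xtime mpX) => //.
  apply/integrableP; split; first by apply/measurable_EFinP; exact: mg.
  have := localized_mass (mw0m m) (hsign eps epsp m) (hsupp eps epsp m) (G0 m).
  by move=> mass; exact: (eq_ind_r (fun z => (z < +oo)%E) (ltry _) mass).
- rewrite (transported_total_vorticity V20 Xinj Xlabel Xtime mpX)//.
  rewrite /total_vorticity /Rintegral; congr fine; apply: ae_eq_integral => //.
  + by apply/measurable_EFinP; exact: mg.
  + by apply/measurable_EFinP; exact: mw0m.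
  + by apply: ae_imply (gae m) => x gx _; rewrite [LHS]/= [RHS]/= gx.
Qed.
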